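(* Suppose $A$ is a sectorial operator of angle $\sigma\in(0,\pi/2)$ on a Banach space $X$. If $A$ has maximal $\gamma$-regularity and $0\in\varrho(A)$, then $A$ is $\gamma$-sectorial.
   Context: Spaces are real; in spectral arguments one passes to complexifications. $\mathbb{R}_+=[0,\infty)$ with Lebesgue measure, $\varrho(A)$ is the resolvent set, $\mathsf D(A)$ the domain. For a Hilbert space $\mathcal H$ and a Banach space $X$, $\gamma(\mathcal H,X)$ is the completion of the finite rank operators $\sum_{n=1}^N h_n\otimes x_n$ ($h_n$ orthonormal, $(h\otimes x)h'=[h',h]x$) in the norm $\|\sum_nh_n\otimes x_n\|^2=\mathbb{E}\|\sum_n\gamma_nx_n\|^2$, $(\gamma_n)$ independent standard Gaussians; $\gamma(\mathbb{R}_+;X)=\gamma(L^2(\mathbb{R}_+),X)$. A strongly measurable $f:\mathbb{R}_+\to X$, Bochner integrable on sets of finite measure, belongs to $\gamma(\mathbb{R}_+;X)$ if $\mathbf 1_F\mapsto\int_Ff\,dt$ extends to an element of $\gamma(\mathbb{R}_+;X)$. A family $\mathscr T\subseteq\mathcal L(X)$ is $\gamma$-bounded if there is $C\ge0$ with $\mathbb{E}\|\sum_{n=1}^N\gamma_nT_nx_n\|^2\le C^2\,\mathbb{E}\|\sum_{n=1}^N\gamma_nx_n\|^2$ for all finite sequences $(T_n)$ in $\mathscr T$, $(x_n)$ in $X$. With $\Sigma_\theta=\{z\in\mathbb{C}\setminus\{0\}:|\arg z|<\theta\}$, a closed densely defined operator $A$ is sectorial of type $\sigma\in(0,\pi)$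 if it is injective with dense range, its spectrum lies in $\overline{\Sigma_\sigma}$, and for every $\sigma'\in(\sigma,\pi)$ the set $\{z(z-A)^{-1}:z\ne0,\ |\arg z|>\sigma'\}$ is uniformly bounded; it is $\gamma$-sectorial of type $\sigma$ if in addition these sets are $\gamma$-bounded, and $\gamma$-sectorial if it is $\gamma$-sectorial of some type $\sigma\in(0,\pi)$. The (sectoriality) angle is the infimum of the admissible $\sigma$. If it is $<\pi/2$, $-A$ generates a strongly continuous bounded analytic semigroup $S$. $A$ (sectorial of angle $<\pi/2$) has maximal $\gamma$-regularity if there is $C$ such that for all $f\in C^\infty_{\rm c}(0,\infty;\mathsf D(A))$ the convolution $u=S*f$, $u(t)=\int_0^tS(t-s)f(s)\,ds$, satisfies $Au\in\gamma(\mathbb{R}_+;X)$ and $\|Au\|_{\gamma(\mathbb{R}_+;X)}\le C\|f\|_{\gamma(\mathbb{R}_+;X)}$. *)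

(* Defs.v *)
From HB Require Import structures.
From mathcomp Require Import all_boot all_order all_algebra.
From mathcomp Require Import complex.
From mathcomp Require Import all_classical all_reals all_analysis.

Set Implicit Arguments.
Unset Strict Implicit.
Unset Printing Implicit Defensive.

Import Order.TTheory GRing.Theory Num.Theory.
Import numFieldNormedType.Exports.

Local Open Scope classical_set_scope.
Local Open Scope ring_scope.

(* Partially defined linear operators. The values of [app] outside of [dom]
   are irrelevant. *)
Record linop (R : realType) (X : normedModType R) := LinOp {
  dom : set X ;
  app :> X -> X ;
  dom0 : dom 0 ;
  dom_lin : forall (a : R) (x y : X), dom x -> dom y -> dom (a *: x + y) ;
  app_lin : forall (a : R) (x y : X), dom x -> dom y ->
    app (a *: x + y) = a *: app x + app y }.

Section Operators.
Context {R : realType} {X : normedModType R}.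
Implicit Types (A : linop X) (w : X * X) (z : R[i]).

Definition closed_op A := closed [set p : X * X | dom A p.1 /\ p.2 = A p.1].

(* The complexification of [X]: the pair [w] stands for [w.1 + i w.2]; it
   carries the complex norm sup_t || Re (e^(-it) w) ||. *)
Definition cscale z w : X * X :=
  (complex.Re z *: w.1 - complex.Im z *: w.2,
   complex.Im z *: w.1 + complex.Re z *: w.2).

Definition cnorm w : R :=
  sup (range (fun t : R => `|cos t *: w.1 + sin t *: w.2|)).

Definition cdom A w := dom A w.1 /\ dom A w.2.
Definition capp A w : X * X := (A w.1, A w.2).

(* [T = (z - A)^-1]; linearity of [T] is automatic. *)
Definition is_resolvent A z (T : X * X -> X * X) :=
  [/\ exists M : R, forall w, cnorm (T w) <= M * cnorm w,
      forall w, cdom A (T w) /\ cscale z (T w) - capp A (T w) = w &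
      forall w, cdom A w -> T (cscale z w - capp A w) = w].

Definition resolvent_set A : set R[i] := [set z | exists T, is_resolvent A z T].
Definition spectrum A : set R[i] := ~` resolvent_set A.

(* Principal argument, with values in ]-pi, pi] for [z != 0]. *)
Definition carg z : R :=
  let a := acos (complex.Re z / complex.Re `|z|) in
  if 0 <= complex.Im z then a else - a.

Definition sector (theta : R) : set (R[i] : numFieldType) :=
  [set z | z != 0 /\ `|carg z| < theta].

Definition sectorial_family A (theta : R) : set (X * X -> X * X) :=
  [set L | exists z T, [/\ z != 0, theta < `|carg z|, is_resolvent A z T &
                           L = (fun w => cscale z (T w))]].

Definition uniformly_bounded (F : set (X * X -> X * X)) :=
  exists C : R, forall L, F L -> forall w, cnorm (L w) <= C * cnorm w.

Definition sectorial_of_type A (s : R) :=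
  [/\ 0 < s < pi,
      [/\ closed_op A, dense (dom A), set_inj (dom A) A & dense (A @` dom A)],
      spectrum A `<=` closure (sector s) &
      forall s', s < s' < pi -> uniformly_bounded (sectorial_family A s')].

Definition sectorial A := exists s, sectorial_of_type A s.

Definition sectoriality_angle A : R := inf [set s | sectorial_of_type A s].

End Operators.

Section Gaussian.
Context {R : realType} {d : measure_display} {Omega : measurableType d}.
Variable P : probability Omega R.

Definition mutually_independent (g : nat -> {RV P >-> R}) :=
  forall (J : seq nat) (B : nat -> set R), uniq J ->
    (forall i, measurable (B i)) ->
    P (\big[setI/setT]_(i <- J) (g i @^-1` B i)) =
    (\prod_(i <- J) P (g i @^-1` B i))%E.

Definition standard_gaussian (g : {RV P >-> R}) :=
  forall B, measurable B -> distribution P g B = normal_prob 0 1 B.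

Definition gaussian_sequence (g : nat -> {RV P >-> R}) :=
  mutually_independent g /\ (forall n, standard_gaussian (g n)).

(* E (N (sum_i g_i x_i))^2, for a norm [N] on [V]. *)
Definition gauss_sq (g : nat -> {RV P >-> R}) (V : lmodType R) (N : V -> R)
    (n : nat) (x : 'I_n -> V) : \bar R :=
  'E_P[fun w => (N (\sum_(i < n) (g i w : R) *: x i)) ^+ 2].

End Gaussian.

Section GammaBounded.
Context {R : realType} {d : measure_display} {Omega : measurableType d}.
Context {P : probability Omega R} (g : nat -> {RV P >-> R}).
Context {X : normedModType R}.

Definition gamma_bounded (F : set (X * X -> X * X)) :=
  exists C : R, 0 <= C /\
    forall (n : nat) (T : 'I_n -> X * X -> X * X) (x : 'I_n -> X * X),
      (forall i, F (T i)) ->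
      (gauss_sq g cnorm (fun i => T i (x i)) <=
       (C ^+ 2)%:E * gauss_sq g cnorm x)%E.

Definition gamma_sectorial_of_type (A : linop X) (s : R) :=
  sectorial_of_type A s /\
  forall s', s < s' < pi -> gamma_bounded (sectorial_family A s').

Definition gamma_sectorial (A : linop X) :=
  exists s, gamma_sectorial_of_type A s.

End GammaBounded.

Section Bochner.
Context {R : realType} {X : normedModType R}.
Local Notation mu := (@lebesgue_measure R).

Record stepfun := StepFun {
  step_len : nat ;
  step_set : 'I_step_len -> set R ;
  step_val : 'I_step_len -> X ;
  step_measurable : forall i, measurable (step_set i) ;
  step_finite : forall i, (mu (step_set i) < +oo)%E }.

Definition step_eval (s : stepfun) (t : R) : X :=
  \sum_i (\1_(@step_set s i) t : R) *: @step_val s i.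

Definition step_integral (F : set R) (s : stepfun) : X :=
  \sum_i fine (mu (F `&` @step_set s i)) *: @step_val s i.

Definition ae_step_limit (F : set R) (f : R -> X) (s : nat -> stepfun) :=
  {ae mu, forall t, F t -> step_eval (s k) t @[k --> \oo] --> f t}.

Definition strongly_measurable (F : set R) (f : R -> X) :=
  exists s, ae_step_limit F f s.

Definition is_bochner_integral (F : set R) (f : R -> X) (x : X) :=
  exists s : nat -> stepfun,
    [/\ ae_step_limit F f s,
        (\int[mu]_(t in F) (`|f t - step_eval (s k) t|)%:E)%E
          @[k --> \oo] --> 0%E &
        step_integral F (s k) @[k --> \oo] --> x].

Definition bochner_integrable (F : set R) (f : R -> X) :=
  exists x, is_bochner_integral F f x.

Definition bochner_integral (F : set R) (f : R -> X) : X :=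
  xget 0 [set x | is_bochner_integral F f x].

End Bochner.

Section GammaSpace.
Context {R : realType} {d : measure_display} {Omega : measurableType d}.
Context {P : probability Omega R} (g : nat -> {RV P >-> R}).
Context {X : normedModType R}.
Local Notation mu := (@lebesgue_measure R).
Local Notation Rplus := (`[0, +oo[%classic : set R).

(* Elements of L^2(R_+) are given by representatives; an operator from
   L^2(R_+) to [X] is a map [(R -> R) -> X], of which only the values at
   square integrable functions are relevant. *)
Definition square_integrable (h : R -> R) :=
  measurable_fun Rplus h /\
  (\int[mu]_(t in Rplus) (h t ^+ 2)%:E < +oo)%E.

Definition ip (h k : R -> R) : R := \int[mu]_(t in Rplus) (h t * k t).

Definition orthonormal (n : nat) (h : 'I_n -> R -> R) :=
  (forall i, square_integrable (h i)) /\
  (forall i j, ip (h i) (h j) = (i == j)%:R).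

(* [U] is a finite rank operator with norm [r] in gamma(L^2(R_+), X). *)
Definition finite_rank_gamma_norm (U : (R -> R) -> X) (r : R) :=
  exists (n : nat) (h : 'I_n -> R -> R) (x : 'I_n -> X),
    [/\ orthonormal h,
        forall k, square_integrable k -> U k = \sum_i ip k (h i) *: x i &
        r = Num.sqrt (fine (gauss_sq g (fun y : X => `|y|) x))].

(* [T] belongs to the completion of the finite rank operators and has norm [r].
   The completion is realized as a space of operators: its elements are the
   pointwise limits of the sequences of finite rank operators which are Cauchy
   in the gamma norm. *)
Definition radonifying_with_norm (T : (R -> R) -> X) (r : R) :=
  exists (U : nat -> (R -> R) -> X) (q : nat -> R),
    [/\ forall k, finite_rank_gamma_norm (U k) (q k),
        forall e : R, 0 < e -> exists K : nat, forall j k : nat,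
          (K <= j)%N -> (K <= k)%N ->
          exists2 p, finite_rank_gamma_norm (fun h => U j h - U k h) p & p < e,
        forall h, square_integrable h -> U k h @[k --> \oo] --> T h &
        q k @[k --> \oo] --> r].

(* [f] belongs to gamma(R_+; X) and has norm [r]. *)
Definition has_gamma_norm (f : R -> X) (r : R) :=
  let fin F := [/\ measurable F, F `<=` Rplus & (mu F < +oo)%E] in
  [/\ strongly_measurable Rplus f,
      forall F, fin F -> bochner_integrable F f &
      exists2 T, radonifying_with_norm T r &
        forall F, fin F -> T (\1_F) = bochner_integral F f].

Definition in_gamma (f : R -> X) := exists r, has_gamma_norm f r.

End GammaSpace.

Section MaximalRegularity.
Context {R : realType} {X : normedModType R}.

Definition bounded_C0_semigroup (S : R -> X -> X) :=
  [/\ forall t, 0 <= t -> linear (S t),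
      exists M : R, forall t x, 0 <= t -> `|S t x| <= M * `|x|,
      forall x, S 0 x = x,
      forall s t x, 0 <= s -> 0 <= t -> S (s + t) x = S s (S t x) &
      forall x, S t x @[t --> 0^'+] --> x].

(* [- A] is the generator of [S]. *)
Definition generated_by_opp (A : linop X) (S : R -> X -> X) :=
  forall x y : X,
    (dom A x /\ y = - A x) <->
    (t^-1 *: (S t x - x) @[t --> 0^'+] --> y).

Definition smooth (V : normedModType R) (f : R -> V) :=
  forall n t, derivable (derive1n n f) t 1.

(* C^oo_c(0, oo; D(A)), where D(A) has the graph norm, i.e. it is identified
   with the graph of [A] in [X * X]. *)
Definition test_function (A : linop X) (f : R -> X) :=
  [/\ forall t, dom A (f t),
      smooth (fun t => (f t, A (f t)) : X * X) &
      exists a b : R, 0 < a /\ forall t, f t != 0 -> a <= t <= b].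

Definition convolution (S : R -> X -> X) (f : R -> X) (t : R) : X :=
  bochner_integral `[0, t]%classic (fun s => S (t - s) (f s)).

Context {d : measure_display} {Omega : measurableType d}.
Context {P : probability Omega R} (g : nat -> {RV P >-> R}).

(* Used for [A] sectorial of angle < pi/2: then the semigroup [S] exists and,
   being determined by its generator, is unique. *)
Definition maximal_gamma_regularity (A : linop X) :=
  exists S, [/\ bounded_C0_semigroup S, generated_by_opp A S &
    exists C : R, forall f, test_function A f ->
      let u := convolution S f in
      [/\ forall t, 0 <= t -> dom A (u t),
          in_gamma g (A \o u) &
          forall r q, has_gamma_norm g f r -> has_gamma_norm g (A \o u) q ->
            q <= C * r]].

End MaximalRegularity.

(* Main.v *)
Require Import Defs.
From HB Require Import structures.
From mathcomp Require Import all_boot all_order all_algebra.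
From mathcomp Require Import complex ring lra.
From mathcomp Require Import all_classical all_reals all_analysis.
From mathcomp Require Import measurable_realfun.
Import Order.TTheory GRing.Theory Num.Theory.
Import numFieldNormedType.Exports.

(** Write R(z) = (z + A)^{-1}.  Since the angle of A is less than pi/2 and 0 is
    in the resolvent set, R is defined and bounded on the closed half plane
    Re z >= 0, together with z R(z) (halfplane_resolvent).  The operator is
    shown to be gamma-sectorial of type pi/2: the resolvents outside of a larger
    sector are - R(z) with Re z > 0, so it is enough that the operators
    A R(z) = I - z R(z), Re z >= 0, form a gamma-bounded family.

    On the imaginary axis this is read off from maximal regularity tested on
    oscillating functions.  Let x1 + i x2 be R(-i xi) w.  If p and q were an
    exact cosine and sine of frequency xi, then u = p x1 + q x2 would solve
    u' + A u = p w1 + q w2.  A smooth compactly supported pair can only do so up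
    to a residual, but relative to the frequency this residual can be made as
    small as desired, and orthogonal to p and q (wave_pair).  For finitely many
    vectors and frequencies, rescaled copies with disjoint supports form one
    orthonormal system of L^2(R_+), in which both f = u' + A u and A u have
    explicit coefficients; the norms of f and A u in gamma(R_+; X) are then
    Gaussian sums of these coefficients (has_gamma_norm_orthonormal).  Maximal
    regularity thus becomes an inequality between Gaussian sums, in which the
    residual is absorbed (apriori).  Since u vanishes at 0, it is the
    convolution of S with f (convolution_eq).

    From the axis one passes to the half plane one vector at a time.  With all
    other vectors frozen, the Gaussian mean square is a convex continuous
    function of the remaining vector A R(z) w, and a convex function of a bounded
    analytic function that tends to 0 at infinity is at most its supremum over the
    boundary.  Analyticity enters only through the mean of R(z) w over the four
    points z + r, z - r, z + ir, z - ir, which differs from R(z) w by O(r^3)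
    (resolvent_mean, max_principle, hull_principle, halfplane_bound).

    This requires A w to make sense.  The general case follows from the density
    of the domain of A, as I - z R(z) is uniformly bounded (K_gamma_bound). *)

Set Implicit Arguments.
Unset Strict Implicit.
Unset Printing Implicit Defensive.

Local Open Scope classical_set_scope.
Local Open Scope ring_scope.

(** * Laws of random vectors *)

Section MeasurableNorm.
Context {R : realType} {d : measure_display} {T : measurableType d}.
Context {V : normedModType R} {I : finType}.

(** As V need not be separable, the norm is written as the infimum, over the
    countably many rational vectors r, of |sum_i r_i x_i| + sum_i |u_i - r_i| |x_i|. *)
Lemma measurable_norm_sum (u : I -> T -> R) (x : I -> V) :
  (forall i, measurable_fun setT (u i)) ->
  measurable_fun setT (fun w => `|\sum_i u i w *: x i|).
Proof.
move=> mu; apply: (measurability _ (RGenInftyO.measurableE R)) => //.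
move=> _ [_ [a ->] <-]; rewrite setTI.
pose h (r : {ffun I -> rat}) w :=
  `|\sum_i (ratr (r i) : R) *: x i| + \sum_i `|u i w - ratr (r i)| * `|x i|.
have -> : (fun w => `|\sum_i u i w *: x i|) @^-1` `]-oo, a[%classic =
    \bigcup_(r : {ffun I -> rat}) (h r @^-1` `]-oo, a[%classic).
  apply/seteqP; split => [w|w [r _]] /=; rewrite !in_itv /=.
    move=> wa.
    set B := \sum_i `|x i|.
    have B0 : 0 <= B by apply: sumr_ge0.
    set e := (a - `|\sum_i u i w *: x i|) / (2 * (B + 1)).
    have e0 : 0 < e by rewrite divr_gt0 ?subr_gt0// mulr_gt0// ltr_wpDl.
    have ex i : exists q : rat, `|u i w - ratr q| < e.
      have [||y [/= hy [q _ qy]]] := @dense_rat R (ball (u i w) e).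
      - by exists (u i w); exact: ballxx.
      - exact: ball_open.
      - by exists q; rewrite qy.
    pose r := [ffun i => projT1 (cid (ex i))].
    have rE i : `|u i w - ratr (r i)| < e by rewrite ffunE; exact: (projT2 (cid (ex i))).
    exists r => //=; rewrite in_itv /= /h.
    have S0 : \sum_i `|u i w - ratr (r i)| * `|x i| <= e * B.
      rewrite mulr_sumr; apply: ler_sum => i _; apply: ler_wpM2r => //.
      exact: ltW.
    have S1 : `|\sum_i (ratr (r i) : R) *: x i| <= `|\sum_i u i w *: x i| + e * B.
      have -> : \sum_i (ratr (r i) : R) *: x i =
          \sum_i u i w *: x i - \sum_i (u i w - ratr (r i)) *: x i.
        by rewrite -sumrB; apply: eq_bigr => i _; rewrite scalerBl subKr.
      apply: le_trans (ler_normB _ _) _; rewrite lerD2l.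
      apply: le_trans (ler_norm_sum _ _ _) _; apply: le_trans S0.
      by apply: ler_sum => i _; rewrite normrZ.
    apply: (@le_lt_trans _ _ (`|\sum_i u i w *: x i| + e * B + e * B)); first exact: lerD.
    rewrite -addrA -ltrBrDl -mulr2n -mulr_natl.
    have -> : a - `|\sum_i u i w *: x i| = 2 * (e * (B + 1)).
      by rewrite /e; field; rewrite gt_eqF// ltr_wpDl.
    by rewrite ltr_pM2l// ltr_pM2l// ltrDl.
  apply: le_lt_trans; rewrite /h.
  have -> : \sum_i u i w *: x i =
      \sum_i (ratr (r i) : R) *: x i + \sum_i (u i w - ratr (r i)) *: x i.
    by rewrite -big_split; apply: eq_bigr => i _ /=; rewrite scalerBl addrC subrK.
  apply: le_trans (ler_normD _ _) _; rewrite lerD2l.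
  apply: le_trans (ler_norm_sum _ _ _) _.
  by apply: ler_sum => i _; rewrite normrZ.
apply: countable_bigcupT_measurable; first exact: countableP.
move=> r; rewrite -[_ @^-1` _]setTI.
suff mh : measurable_fun setT (h r) by apply: mh => //; exact: measurable_itv.
apply: measurable_funD => //.
apply: measurable_sum => i; apply: measurable_funM => //.
apply: measurableT_comp => //; exact: measurable_funB.
Qed.

End MeasurableNorm.

Section Law.
Context {R : realType} {d : measure_display} {Omega : measurableType d}.
Variable P : probability Omega R.
Variable n : nat.

Let vec (u : 'I_n -> Omega -> R) (w : Omega) : n.-tuple R := [tuple u i w | i < n].

Let mvec u : (forall i, measurable_fun setT (u i)) -> measurable_fun setT (vec u).
Proof.
move=> h; apply/measurable_fun_tnthP => i.
by rewrite (_ : _ \o _ = u i)//; apply/funext => w /=; rewrite tnth_mktuple.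
Qed.

Variables (u v : 'I_n -> Omega -> R).
Hypothesis mu : forall i, measurable_fun setT (u i).
Hypothesis mv : forall i, measurable_fun setT (v i).
Hypothesis huv : forall B : 'I_n -> set R, (forall i, measurable (B i)) ->
  P [set w | forall i, B i (u i w)] = P [set w | forall i, B i (v i w)].

(** Boxes form a pi-system that generates the product sigma-algebra, so random
    vectors which agree on boxes have the same law. *)
Lemma integral_law_eq (F : n.-tuple R -> \bar R) :
  measurable_fun setT F -> (forall t, 0 <= F t)%E ->
  (\int[P]_w F (vec u w) = \int[P]_w F (vec v w))%E.
Proof.
move=> mF F0.
have e (u' : 'I_n -> Omega -> R) (mu' : forall i, measurable_fun setT (u' i)) :
    (\int[P]_w F (vec u' w) = \int[pushforward P (vec u')]_t F t)%E.
  have := @ge0_integral_pushforward _ _ _ _ R _ (mvec mu') P setT F measurableT mF.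
  by move=> ->.
rewrite !e//.
pose MU : {mfun Omega >-> n.-tuple R} := HB.pack (vec u) (isMeasurableFun.Build _ _ _ _ _ (mvec mu)).
pose MV : {mfun Omega >-> n.-tuple R} := HB.pack (vec v) (isMeasurableFun.Build _ _ _ _ _ (mvec mv)).
apply: (eq_measure_integral (distribution P MV)); first exact: mvec.
move=> ? A mA _.
pose G : set (set (n.-tuple R)) :=
  [set A | exists2 B : 'I_n -> set R, (forall i, measurable (B i)) &
     A = [set t | forall i, B i (tnth t i)]].
move: A mA; suff: forall A, measurable A -> distribution P MU A = distribution P MV A.
  by move=> h A mA; exact: h.
apply: (measure_unique G (fun=> setT)) => //.
- apply/seteqP; split.
  + apply: smallest_sub; first exact: smallest_sigma_algebra.
    rewrite -bigcup_seq => _ [i _ [B mB <-]]; apply: sub_sigma_algebra.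
    exists (fun j => if j == i then B else setT); first by move=> j; case: ifP.
    rewrite setTI; apply/seteqP; split => [t Bt j|t /(_ i)] /=; last by rewrite eqxx.
    by case: eqP => // ->.
  + apply: smallest_sub; first exact: sigma_algebra_measurable.
    move=> _ [B mB ->]; rewrite [X in measurable X](_ : _ =
      \bigcap_(i in setT) ((fun t : n.-tuple R => tnth t i) @^-1` B i)); last first.
      by apply/seteqP; split => [t h i _|t h i]; [exact: h|exact: h].
    apply: fin_bigcap_measurable; first exact: finite_finset.
    by move=> i _; rewrite -[_ @^-1` _]setTI; exact: measurable_tnth.
- move=> _ _ [B mB ->] [B' mB' ->]; exists (fun i => B i `&` B' i).
    by move=> i; exact: measurableI.
  by apply/seteqP; split => [t [h h'] i|t h]; [split|split => i; have [] := h i].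
- by move=> _; exists (fun=> setT) => //; apply/seteqP; split.
- by apply/seteqP; split => // t _; exists 0%N.
- move=> _ [B mB ->]; rewrite /= /distribution /pushforward /=.
  have h u' : vec u' @^-1` [set t | forall i, B i (tnth t i)] =
      [set w | forall i, B i (u' i w)].
    by apply/seteqP; split => w /= h i; have := h i; rewrite tnth_mktuple.
  by rewrite !h; exact: huv.
- by move=> _; rewrite (le_lt_trans (probability_le1 _ _))// ltry.
Qed.

Lemma integral_norm_law (V : normedModType R) (x : 'I_n -> V) :
  (\int[P]_w (`|\sum_i u i w *: x i| ^+ 2)%:E =
   \int[P]_w (`|\sum_i v i w *: x i| ^+ 2)%:E)%E.
Proof.
pose F (t : n.-tuple R) := (`|\sum_i tnth t i *: x i| ^+ 2)%:E.
have e u' : (fun w => (`|\sum_i u' i w *: x i| ^+ 2)%:E) = F \o vec u'.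
  apply/funext => w; rewrite /F /=; congr (`| _ | ^+ 2)%:E.
  by apply: eq_bigr => i _; rewrite tnth_mktuple.
rewrite !e; apply: integral_law_eq => [|t]; last by rewrite lee_fin sqr_ge0.
apply/measurable_EFinP; apply: measurable_funX.
by apply: measurable_norm_sum => i; exact: measurable_tnth.
Qed.
End Law.

(** * The standard normal law *)

Section NormalMoment.
Context {R : realType}.
Local Notation leb := (@lebesgue_measure R).

Lemma normal_pdf0E (s x : R) : s != 0 ->
  normal_pdf 0 s x = normal_peak s * expR (- x ^+ 2 / (s ^+ 2 *+ 2)).
Proof. by move=> s0; rewrite /normal_pdf (negbTE s0) /normal_fun subr0. Qed.

Import HBNNSimple.

(** For the finiteness of moments an upper bound suffices, and it can be checked
    on the simple functions below f. *)
Lemma le_integral_normal (f : R -> \bar R) : measurable_fun setT f ->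
  (forall x, 0 <= f x)%E ->
  (\int[normal_prob 0 1]_x f x <=
   \int[leb]_x (f x * (normal_pdf 0 1 x)%:E))%E.
Proof.
move=> mf f0; rewrite ge0_integralTE//; apply: ge_ereal_sup => _ [h hf <-].
apply: (@le_trans _ _ (\int[leb]_x ((h x)%:E * (normal_pdf 0 1 x)%:E))%E); last first.
  apply: ge0_le_integral => //.
  - by move=> x _; rewrite mule_ge0 ?lee_fin ?normal_pdf_ge0.
  - apply: emeasurable_funM; apply/measurable_EFinP => //.
    exact: measurable_normal_pdf.
  - apply: emeasurable_funM => //; apply/measurable_EFinP.
    exact: measurable_normal_pdf.
  - by move=> x _; apply: lee_wpmul2r => //; rewrite lee_fin normal_pdf_ge0.
have mp : measurable_fun setT (fun x => (normal_pdf 0 1 x : R)%:E).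
  by apply/measurable_EFinP; exact: measurable_normal_pdf.
rewrite sintegralE.
under [X in (_ <= X)%E]eq_integral.
  move=> x _; rewrite fimfunE -fsumEFin// ge0_mule_fsuml; last first.
    by move=> r; rewrite EFinM nnfun_muleindic_ge0.
  over.
rewrite [X in (_ <= X)%E]ge0_integral_fsum//; last 2 first.
- move=> r; apply: emeasurable_funM => //; apply/measurable_EFinP.
  exact: measurable_funM.
- move=> r x _; rewrite mule_ge0 ?lee_fin ?normal_pdf_ge0//.
  by have := nnfun_muleindic_ge0 h r x; rewrite -EFinM lee_fin.
rewrite le_eqVlt; apply/orP; left; apply/eqP; apply: eq_fsbigr => r.
rewrite inE => -[x0 _ hr].
have r0 : 0 <= r by rewrite -hr.
have -> : (fun x => ((r * \1_(h @^-1` [set r]) x)%:E * (normal_pdf 0 1 x)%:E)%E) =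
    (fun x => (r%:E * ((fun x => (normal_pdf 0 1 x : R)%:E) \_ (h @^-1` [set r])) x)%E).
  apply/funext => x; rewrite EFinM -muleA; congr (_ * _)%E.
  by rewrite patchE indicE; case: ifPn => _; rewrite ?mul1e ?mul0e.
rewrite ge0_integralZl//.
- by rewrite -integral_mkcond.
- by apply/(measurable_restrictT _ _).1 => //; exact: measurable_funTS.
- by move=> x _; rewrite patchE; case: ifPn => // _; rewrite lee_fin normal_pdf_ge0.
Qed.

(** By x^2 <= 4 exp (x^2 / 4), x^2 times the standard density is at most a
    multiple of the normal density of variance 2. *)
Lemma normal_prob_moment2 : (\int[normal_prob 0 1]_x (x ^+ 2 : R)%:E < +oo)%E.
Proof.
set s : R := Num.sqrt 2.
have s2 : s ^+ 2 = 2 by rewrite sqr_sqrtr.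
have s0 : s != 0 by rewrite gt_eqF// sqrtr_gt0.
have m2 : measurable_fun setT (fun x : R => (x ^+ 2)%:E).
  by apply/measurable_EFinP; exact: measurable_funX.
apply: le_lt_trans (le_integral_normal m2 _) _.
  by move=> x; rewrite lee_fin sqr_ge0.
set C := 4 * normal_peak 1 / normal_peak s.
have pk := @normal_peak_gt0 R s s0.
have pk1 := @normal_peak_gt0 R 1 (oner_neq0 _).
apply: (@le_lt_trans _ _ (\int[leb]_x (C%:E * (normal_pdf 0 s x)%:E))%E).
  apply: ge0_le_integral => //.
  - by move=> x _; rewrite mule_ge0 ?lee_fin ?normal_pdf_ge0 ?sqr_ge0.
  - by apply: emeasurable_funM => //; apply/measurable_EFinP; exact: measurable_normal_pdf.
  - by apply: emeasurable_funM => //; apply/measurable_EFinP; exact: measurable_normal_pdf.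
  - move=> x _; rewrite -!EFinM lee_fin !normal_pdf0E ?oner_neq0// expr1n s2.
    have -> : - x ^+ 2 / (1 *+ 2) = - x ^+ 2 / (2 *+ 2) + - (x ^+ 2 / 4) :> R by field.
    rewrite expRD.
    have -> : C * (normal_peak s * expR (- x ^+ 2 / (2 *+ 2))) =
        4 * (normal_peak 1 * expR (- x ^+ 2 / (2 *+ 2))).
      by rewrite /C; field; rewrite gt_eqF.
    have -> : x ^+ 2 * (normal_peak 1 * (expR (- x ^+ 2 / (2 *+ 2)) * expR (- (x ^+ 2 / 4)))) =
        (x ^+ 2 * expR (- (x ^+ 2 / 4))) * (normal_peak 1 * expR (- x ^+ 2 / (2 *+ 2))) by ring.
    apply: ler_wpM2r; first by rewrite mulr_ge0 ?expR_ge0// ltW.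
    rewrite expRN ler_pdivrMr ?expR_gt0//.
    have := expR_ge1Dx (x ^+ 2 / 4); lra.
rewrite ge0_integralZl//.
- by rewrite integral_normal_pdf mule1 ltry.
- by apply/measurable_EFinP; exact: measurable_normal_pdf.
- by move=> x _; rewrite lee_fin normal_pdf_ge0.
- by rewrite lee_fin divr_ge0 ?mulr_ge0 // ltW.
Qed.

Lemma normal_prob_opp (B : set R) : measurable B ->
  normal_prob 0 1 (-%R @^-1` B) = normal_prob 0 1 B :> \bar R.
Proof.
move=> mB; rewrite /normal_prob.
have mp : measurable_fun setT (fun x => (normal_pdf 0 1 x : R)%:E).
  by apply/measurable_EFinP; exact: measurable_normal_pdf.
have mN : measurable_fun setT (-%R : R -> measurableTypeR R) by exact: oppr_measurable.
transitivity (\int[pushforward leb (-%R : R -> measurableTypeR R)]_(x in B)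
    (normal_pdf 0 1 x)%:E)%E; last first.
  by apply: eq_measure_integral => //= A mA AB; exact: lebesgue_measureN.
rewrite ge0_integral_pushforward//.
- by apply: eq_integral => x _ /=; rewrite !normal_pdf0E ?oner_neq0// sqrrN.
- exact: measurable_funTS.
- by move=> x _; rewrite lee_fin normal_pdf_ge0.
Qed.

End NormalMoment.

(** * Mean squares of Gaussian sums *)

Section GaussSums.
Context {R : realType} {d : measure_display} {Omega : measurableType d}.
Variables (P : probability Omega R) (g : nat -> {RV P >-> R}).
Hypothesis hg : gaussian_sequence g.

Lemma gauss_measurable (s : R) k : measurable_fun setT (fun w => s * g k w).
Proof. by apply: measurable_funM => //; exact: measurable_funP. Qed.

Lemma gauss_sign_preimage (e : bool) k (B : set R) : measurable B ->
  P (g k @^-1` ((fun t => (-1) ^+ e * t) @^-1` B)) = normal_prob 0 1 B.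
Proof.
move=> mB; case: e.
  rewrite -[RHS]normal_prob_opp// -(hg.2 k); last first.
    by rewrite -[_ @^-1` _]setTI; apply: oppr_measurable.
  rewrite /distribution /pushforward; congr (P _).
  by apply/seteqP; split => w /=; rewrite expr1 mulN1r.
rewrite -(hg.2 k)// /distribution /pushforward; congr (P _).
by apply/seteqP; split => w /=; rewrite expr0 mul1r.
Qed.

(** Independence and the symmetry of each Gaussian: neither the choice of the
    Gaussians nor their signs matter.  The sets B' are the translation of the box
    to a family of sets indexed by the numbers of the Gaussians. *)
Lemma gauss_box n (s : 'I_n -> nat) (e : 'I_n -> bool) (B : 'I_n -> set R) :
  injective s -> (forall i, measurable (B i)) ->
  P [set w | forall i, B i ((-1) ^+ e i * g (s i) w)] =
  (\prod_(i < n) normal_prob 0 1 (B i))%E.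
Proof.
move=> sI mB.
pose B' k := \bigcap_(i in [set i | s i = k]) ((fun t : R => (-1) ^+ e i * t) @^-1` B i).
have mC (i : 'I_n) : measurable ((fun t : R => (-1) ^+ e i * t) @^-1` B i).
  rewrite -[_ @^-1` _]setTI.
  suff : measurable_fun setT (fun t : R => (-1) ^+ e i * t) by apply.
  exact: measurable_funM.
have B'E i : B' (s i) = (fun t : R => (-1) ^+ e i * t) @^-1` B i.
  apply/seteqP; split => t; first by apply.
  by move=> h j /= /sI ->.
have mB' k : measurable (B' k).
  by apply: fin_bigcap_measurable => [|i _]; [exact: finite_finset|exact: mC].
have := hg.1 [seq s i | i <- index_enum 'I_n] B' _ mB'.
rewrite map_inj_uniq ?index_enum_uniq// => /(_ isT).
rewrite !big_map /=.
under [X in _ = X -> _]eq_bigr do rewrite B'E gauss_sign_preimage//.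
move=> <-; congr (P _); apply/seteqP; split => w.
  move=> h; rewrite -bigcap_seq => i _ /=; rewrite B'E; exact: h.
rewrite -bigcap_seq => h i; have := h i; rewrite /= mem_index_enum B'E; exact.
Qed.

Definition gsum (V : normedModType R) (I : finType) (x : I -> V) (w : Omega) : V :=
  \sum_i (g (enum_rank i) w : R) *: x i.

(** An arbitrary finite index type lets pairs (vector, component of its packet)
    serve as indices. *)
Definition gsq (V : normedModType R) (I : finType) (x : I -> V) : R :=
  \int[P]_w (`|gsum x w| ^+ 2).

Lemma integral_gauss_sign (V : normedModType R) (I : finType) (x : I -> V)
    (s s' : I -> nat) (e e' : I -> bool) : injective s -> injective s' ->
  (\int[P]_w (`|\sum_i ((-1) ^+ e i * g (s i) w) *: x i| ^+ 2)%:E =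
   \int[P]_w (`|\sum_i ((-1) ^+ e' i * g (s' i) w) *: x i| ^+ 2)%:E)%E.
Proof.
move=> sI s'I.
have E (t : I -> nat) (f : I -> bool) : injective t ->
    (\int[P]_w (`|\sum_i ((-1) ^+ f i * g (t i) w) *: x i| ^+ 2)%:E =
     \int[P]_w (`|\sum_(k < #|I|) ((-1) ^+ false * g k w) *: x (enum_val k)| ^+ 2)%:E)%E.
  move=> tI.
  transitivity (\int[P]_w (`|\sum_(k < #|I|) ((-1) ^+ f (enum_val k) * g (t (enum_val k)) w) *: x (enum_val k)| ^+ 2)%:E)%E.
    apply: eq_integral => w _; congr (`| _ | ^+ 2)%:E.
    by rewrite (reindex (@enum_val I I))//; apply: onW_bij; exact: enum_val_bij.
  apply: integral_norm_law => [i|i|B mB]; [exact: gauss_measurable..|].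
  rewrite (gauss_box (s := fun k => t (enum_val k)) (fun k => f (enum_val k)))//.
    by rewrite (gauss_box (s := fun k => k : nat) (fun=> false))//; exact: ord_inj.
  by move=> i j /tI /enum_val_inj.
by rewrite !E.
Qed.

Lemma gauss_moment2 k : P.-integrable setT (fun w => ((g k w : R) ^+ 2)%:E).
Proof.
apply/integrableP; split.
  by apply/measurable_EFinP; apply: measurable_funX; exact: measurable_funP.
under eq_integral do rewrite gee0_abs ?lee_fin ?sqr_ge0//.
have m2 : measurable_fun setT (fun x : R => (x ^+ 2)%:E).
  by apply/measurable_EFinP; exact: measurable_funX.
pose g' : Omega -> measurableTypeR R := g k.
have mg' : measurable_fun setT g' by move=> _ Y mY; apply: (measurable_funP (g k)).
have h := @ge0_integral_pushforward _ _ _ (measurableTypeR R) R g' mg' P setT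
  (fun x => (x ^+ 2)%:E) measurableT m2 _.
apply: le_lt_trans normal_prob_moment2; rewrite le_eqVlt; apply/orP; left; apply/eqP.
transitivity (\int[pushforward P g']_x ((x : R) ^+ 2)%:E)%E.
  by rewrite h// => y _; rewrite lee_fin sqr_ge0.
apply: eq_measure_integral => A mA _; exact: hg.2.
Qed.

Lemma sqr_sum_le (I : Type) (s : seq I) (a : I -> R) :
  (\sum_(i <- s) a i) ^+ 2 <= 2 ^+ size s * \sum_(i <- s) a i ^+ 2.
Proof.
elim: s => [|i s IH]; first by rewrite !big_nil expr0n mulr0.
rewrite !big_cons /= (exprS 2 (size s)).
set S := \sum_(j <- s) a j; set Q := \sum_(j <- s) a j ^+ 2 in IH *.
have : 1 <= 2 ^+ size s :> R by apply: exprn_ege1; rewrite ler1n.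
set K := 2 ^+ size s in IH * => K1.
have := mulr_ge0 (sqr_ge0 (a i)) (eq_ind_r (fun b : bool => b) K1 (subr_ge0 1 K)).
have := sqr_ge0 (a i - S).
by move: IH; rewrite -/S; nra.
Qed.

Section Values.
Variables (V : normedModType R) (I : finType).
Implicit Types x y : I -> V.

Lemma integrable_gsum x : P.-integrable setT (fun w => (`|gsum x w| ^+ 2)%:E).
Proof.
have m x' : measurable_fun setT (fun w => `|gsum x' w| ^+ 2 : R).
  by apply: measurable_funX; apply: measurable_norm_sum => i; exact: measurable_funP.
pose K : R := 2 ^+ size (index_enum I).
apply: (@le_integrable _ _ _ P _ measurableT _
  (fun w => (\sum_i (K * `|x i| ^+ 2)%:E * ((g (enum_rank i) w : R) ^+ 2)%:E)%E)).
- by apply/measurable_EFinP; exact: m.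
- move=> w _; under [in leRHS]eq_bigr do rewrite -EFinM.
  rewrite sumEFin !gee0_abs ?lee_fin ?sqr_ge0//; last first.
    by apply: sumr_ge0 => i _; rewrite mulr_ge0 ?sqr_ge0// mulr_ge0 ?sqr_ge0// exprn_ge0.
  apply: (@le_trans _ _ ((\sum_i `|(g (enum_rank i) w : R)| * `|x i|) ^+ 2)).
    rewrite ler_sqr ?nnegrE//; last by apply: sumr_ge0 => i _; rewrite mulr_ge0.
    by apply: le_trans (ler_norm_sum _ _ _) _; apply: ler_sum => i _; rewrite normrZ.
  apply: le_trans (sqr_sum_le _ _) _; rewrite mulr_sumr; apply: ler_sum => i _.
  by rewrite -/K exprMn real_normK ?num_real// (mulrC (_ ^+ 2)) mulrA.
- apply: (@integrable_sum _ _ _ P _ measurableT I (index_enum I) xpredT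
    (fun i w => ((K * `|x i| ^+ 2)%:E * ((g (enum_rank i) w : R) ^+ 2)%:E)%E)) => // i _.
  by apply: integrableZl => //; exact: gauss_moment2.
Qed.

Lemma gsqE x : (\int[P]_w (`|gsum x w| ^+ 2)%:E)%E = (gsq x)%:E.
Proof. by rewrite /gsq /Rintegral fineK//; apply: integrable_fin_num => //; exact: integrable_gsum. Qed.

Lemma gsq_ge0 x : 0 <= gsq x.
Proof. by apply: Rintegral_ge0 => w _; rewrite sqr_ge0. Qed.

End Values.

(** All the convexity and triangle inequalities for mean squares hold already
    before taking expectations. *)
Lemma gsq_le_comb (I J K : finType) (V W U : normedModType R) (a b : R)
    (x : I -> V) (y : J -> W) (z : K -> U) :
  (forall w, `|gsum x w| ^+ 2 <= a * `|gsum y w| ^+ 2 + b * `|gsum z w| ^+ 2) ->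
  gsq x <= a * gsq y + b * gsq z.
Proof.
move=> h; have I1 := integrableZl measurableT a (integrable_gsum y).
have I2 := integrableZl measurableT b (integrable_gsum z).
rewrite /gsq -!RintegralZl//; [|exact: integrable_gsum..].
rewrite -RintegralD//; apply: le_Rintegral => //; first exact: integrable_gsum. exact: (integrableD measurableT I1 I2).
Qed.

Section Values2.
Variables (V : normedModType R) (I : finType).
Implicit Types x y : I -> V.

Lemma gsumD x y w : gsum (fun i => x i + y i) w = gsum x w + gsum y w.
Proof. by rewrite /gsum -big_split; apply: eq_bigr => i _; rewrite scalerDr. Qed.

Lemma gsumZ (c : R) x w : gsum (fun i => c *: x i) w = c *: gsum x w.
Proof. by rewrite /gsum scaler_sumr; apply: eq_bigr => i _; rewrite !scalerA mulrC. Qed.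

Lemma gsqZ (c : R) x : gsq (fun i => c *: x i) = c ^+ 2 * gsq x.
Proof.
rewrite /gsq -RintegralZl//; last exact: integrable_gsum.
by apply: eq_Rintegral => w _; rewrite gsumZ normrZ exprMn real_normK ?num_real.
Qed.

Lemma sqr_normD_le (u v : V) (t : R) : 0 < t ->
  `|u + v| ^+ 2 <= (1 + t) * `|u| ^+ 2 + (1 + t^-1) * `|v| ^+ 2.
Proof.
move=> t0; apply: (@le_trans _ _ ((`|u| + `|v|) ^+ 2)).
  by rewrite ler_sqr ?nnegrE ?addr_ge0// ler_normD.
have := sqr_ge0 (t * `|u| - `|v|); move: (`|u|) (`|v|) => a b h.
rewrite -subr_ge0.
have -> : (1 + t) * a ^+ 2 + (1 + t^-1) * b ^+ 2 - (a + b) ^+ 2 = (t * a - b) ^+ 2 / t.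
  by field; rewrite gt_eqF.
by rewrite divr_ge0// ltW.
Qed.

(** With t of the size of a small y this is a continuity estimate. *)
Lemma gsqD_le x y (t : R) : 0 < t ->
  gsq (fun i => x i + y i) <= (1 + t) * gsq x + (1 + t^-1) * gsq y.
Proof. by move=> t0; apply: gsq_le_comb => w; rewrite gsumD sqr_normD_le. Qed.

Lemma gsqD2_le x y : gsq (fun i => x i + y i) <= 2 * gsq x + 2 * gsq y.
Proof. by have := gsqD_le x y (ltr01 : 0 < 1 :> R); rewrite invr1. Qed.

Lemma gsq_convex x y (t : R) : 0 <= t <= 1 ->
  gsq (fun i => (1 - t) *: x i + t *: y i) <= (1 - t) * gsq x + t * gsq y.
Proof.
move=> /andP[t0 t1]; apply: gsq_le_comb => w; rewrite gsumD !gsumZ.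
apply: (@le_trans _ _ (((1 - t) * `|gsum x w| + t * `|gsum y w|) ^+ 2)).
  rewrite ler_sqr ?nnegrE ?addr_ge0 ?mulr_ge0 ?subr_ge0//.
  apply: le_trans (ler_normD _ _) _.
  by rewrite !normrZ !ger0_norm ?subr_ge0.
move: (`|gsum x w|) (`|gsum y w|) => a b; rewrite -subr_ge0.
have -> : (1 - t) * a ^+ 2 + t * b ^+ 2 - ((1 - t) * a + t * b) ^+ 2 =
   t * (1 - t) * (a - b) ^+ 2 by ring.
by apply: mulr_ge0; [apply: mulr_ge0; rewrite ?subr_ge0|exact: sqr_ge0].
Qed.

Lemma gsq_sign (e : I -> bool) x : gsq (fun i => (-1) ^+ e i *: x i) = gsq x.
Proof.
apply: EFin_inj; rewrite -!gsqE.
have rI : injective (fun i : I => nat_of_ord (enum_rank i)).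
  by move=> i j /ord_inj /enum_rank_inj.
have := integral_gauss_sign x e (fun=> false) rI rI.
have E (f : I -> bool) w : \sum_i ((-1) ^+ f i * g (enum_rank i) w) *: x i =
    gsum (fun i => (-1) ^+ f i *: x i) w.
  by apply: eq_bigr => i _; rewrite scalerA mulrC.
under eq_integral do rewrite E; under [X in _ = X -> _]eq_integral do rewrite E.
move=> ->; apply: eq_integral => w _; congr (`| _ | ^+ 2)%:E.
by apply: eq_bigr => i _; rewrite expr0 scale1r.
Qed.

(** The masked family is the average of the family and of the family with
    opposite signs outside of the mask, which has the same mean square. *)
Lemma gsq_mask (A : pred I) x : gsq (fun i => if A i then x i else 0) <= gsq x.
Proof.
have <- : 1 / 2 * gsq x + 1 / 2 * gsq (fun i => (-1) ^+ (~~ A i) *: x i) = gsq x.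
  by rewrite gsq_sign; field.
apply: gsq_le_comb => w.
have -> : gsum (fun i => if A i then x i else 0) w =
   (1 - 1 / 2) *: gsum x w + (1 / 2) *: gsum (fun i => (-1) ^+ (~~ A i) *: x i) w.
  rewrite -!gsumZ -gsumD; apply: eq_bigr => i _; congr (_ *: _).
  case: (A i) => /=; rewrite ?expr0 ?expr1 ?scale1r ?scaleN1r ?scalerN -?scalerBl -?scalerDl.
    by rewrite subrK scale1r.
  by rewrite (_ : 1 - 1 / 2 - 1 / 2 = 0) ?scale0r//; field.
set u := gsum x w; set v := gsum _ w.
apply: le_trans (_ : ((1 / 2) * `|u| + (1 / 2) * `|v|) ^+ 2 <= _).
  rewrite ler_sqr ?nnegrE ?addr_ge0 ?mulr_ge0//.
  apply: le_trans (ler_normD _ _) _; rewrite !normrZ !ger0_norm//; lra.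
by have := sqr_ge0 (`|u| - `|v|); nra.
Qed.

Lemma gsq_norm_le : exists K : R, 0 <= K /\
  forall e (y : I -> V), (forall i, `|y i| <= e) -> gsq y <= K * e ^+ 2.
Proof.
pose H w : R := 2 ^+ size (index_enum I) * \sum_(i : I) (g (enum_rank i) w : R) ^+ 2.
have iH : P.-integrable setT (EFin \o H).
  rewrite (_ : EFin \o H = fun w => ((2 ^+ size (index_enum I))%:E *
      \sum_(i : I) ((g (enum_rank i) w : R) ^+ 2)%:E)%E); last first.
    by apply/funext => w /=; rewrite sumEFin.
  apply: integrableZl => //.
  apply: (@integrable_sum _ _ _ P _ measurableT I (index_enum I) xpredT
    (fun i w => ((g (enum_rank i) w : R) ^+ 2)%:E)) => // i _; exact: gauss_moment2.
exists (\int[P]_w H w); split.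
  by apply: Rintegral_ge0 => w _; rewrite mulr_ge0 ?exprn_ge0// sumr_ge0// => i _; rewrite sqr_ge0.
move=> e y ye; rewrite -RintegralZr//.
apply: le_Rintegral => //; [exact: integrable_gsum| |].
  rewrite (_ : EFin \o _ = fun w => ((EFin \o H) w * (e ^+ 2)%:E)%E)//.
  exact: integrableZr.
move=> w _; apply: (@le_trans _ _ ((\sum_i `|(g (enum_rank i) w : R)| * `|y i|) ^+ 2)).
  rewrite ler_sqr ?nnegrE//; last by apply: sumr_ge0 => i _; rewrite mulr_ge0.
  by apply: le_trans (ler_norm_sum _ _ _) _; apply: ler_sum => i _; rewrite normrZ.
apply: le_trans (sqr_sum_le _ _) _; rewrite /H -mulrA ler_wpM2l ?exprn_ge0// mulr_suml.
apply: ler_sum => i _; rewrite exprMn real_normK ?num_real// ler_wpM2l ?sqr_ge0//.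
by rewrite ler_sqr ?nnegrE//; apply: le_trans (ye i).
Qed.

Lemma gsq_supp (J : finType) (t : J -> I) x : injective t ->
  (forall i, (forall j, t j != i) -> x i = 0) -> gsq x = gsq (x \o t).
Proof.
move=> tI x0; apply: EFin_inj; rewrite -!gsqE.
have E w : gsum x w = \sum_j ((-1) ^+ false * g (enum_rank (t j)) w) *: (x \o t) j.
  rewrite /gsum (bigID (fun i => i \in t @: [set: J]%SET)) /= [X in _ + X]big1 ?addr0; last first.
    move=> i /imsetP ni; rewrite x0 ?scaler0// => j; apply/eqP => ji; apply: ni.
    by exists j; rewrite ?inE.
  rewrite big_imset /=; last by move=> i j _ _; exact: tI.
  by apply: eq_big => [j|j _]; rewrite ?inE// expr0 mul1r.
under eq_integral do rewrite E.
have tI' : injective (fun j => nat_of_ord (enum_rank (t j))).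
  by move=> i j /ord_inj /enum_rank_inj /tI.
have rI : injective (fun j : J => nat_of_ord (enum_rank j)).
  by move=> i j /ord_inj /enum_rank_inj.
rewrite (integral_gauss_sign (x \o t) (fun=> false) (fun=> false) tI' rI).
apply: eq_integral => w _; congr (`| _ | ^+ 2)%:E.
by apply: eq_bigr => i _; rewrite expr0 mul1r.
Qed.

Lemma gsq_inj (J : finType) (t : J -> I) x : injective t -> gsq (x \o t) <= gsq x.
Proof.
move=> tI; apply: le_trans (gsq_mask (fun i => [exists j, t j == i]) x).
rewrite (gsq_supp tI) => [|i h]; last first.
  by case: existsP => // -[j /eqP ji]; have := h j; rewrite ji eqxx.
have <- : x \o t = (fun i => if [exists j, t j == i] then x i else 0) \o t => //.
by apply/funext => j /=; case: existsP => // -[]; exists j.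
Qed.

End Values2.

End GaussSums.

(** * Bochner integrals *)

Section BochnerTheory.
Context {R : realType} {X : normedModType R}.
Local Notation mu := (@lebesgue_measure R).

Lemma measurable_step n (A : 'I_n -> set R) (c : 'I_n -> X) (v : X) :
  (forall i, measurable (A i)) ->
  measurable_fun setT (fun t : measurableTypeR R => `|v + \sum_i (\1_(A i) t : R) *: c i|).
Proof.
move=> mA.
pose c' (i : 'I_n.+1) := if unlift ord0 i is Some j then c j else v.
pose u (i : 'I_n.+1) (t : measurableTypeR R) : R := if unlift ord0 i is Some j then \1_(A j) t else 1.
have -> : (fun t : measurableTypeR R => `|v + \sum_i (\1_(A i) t : R) *: c i|) =
    (fun t => `|\sum_i u i t *: c' i|).
  apply/funext => t; congr (`| _ |); rewrite big_ord_recl /u /c' unlift_none scale1r.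
  by congr (_ + _); apply: eq_bigr => i _; rewrite liftK.
apply: measurable_norm_sum => i; rewrite /u; case: unliftP => [j _|_] //.
by apply: measurable_indic; exact: mA.
Qed.

(** Induction on the number of sets: the first set cuts F into two pieces, and
    on each of them its contribution is a constant, collected in v. *)
Lemma norm_step_integral_le n (A : 'I_n -> set R) (c : 'I_n -> X) (F : set R) (v : X) :
  (forall i, measurable (A i)) -> measurable F -> (mu F < +oo)%E ->
  ((`|fine (mu F) *: v + \sum_i fine (mu (F `&` A i)) *: c i|)%:E <=
   \int[mu]_(t in F) (`|v + \sum_i (\1_(A i) t : R) *: c i|)%:E)%E.
Proof.
elim: n A c F v => [|n IH] A c F v mA mF Foo.
  rewrite big_ord0 addr0.
  under eq_integral do rewrite big_ord0 addr0.
  rewrite integral_cst// normrZ ger0_norm ?fine_ge0// EFinM fineK ?ge0_fin_numE//.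
  by rewrite muleC.
have mA' i : measurable (A (lift ord0 i)) by [].
have mF1 : measurable (F `&` A ord0) by exact: measurableI.
have mF2 : measurable (F `\` A ord0) by exact: measurableD.
have F1oo : (mu (F `&` A ord0) < +oo)%E.
  by apply: le_lt_trans Foo; apply: le_measure; rewrite ?inE.
have F2oo : (mu (F `\` A ord0) < +oo)%E.
  by apply: le_lt_trans Foo; apply: le_measure; rewrite ?inE.
have split B : measurable B -> fine (mu (F `&` B)) =
    fine (mu ((F `&` A ord0) `&` B)) + fine (mu ((F `\` A ord0) `&` B)).
  move=> mB; rewrite -fineD; last 2 first.
  - rewrite ge0_fin_numE//; apply: le_lt_trans F1oo; apply: le_measure; rewrite ?inE//.
    exact: measurableI.
  - rewrite ge0_fin_numE//; apply: le_lt_trans F2oo; apply: le_measure; rewrite ?inE//.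
    exact: measurableI.
  congr fine; rewrite -measureU//; [|exact: measurableI|exact: measurableI|].
    by congr (mu _); rewrite -setIUl setUIDK.
  by rewrite -setIIl setIAC; apply/seteqP; split => // t [[[_ ?] _] [_]].
have -> : fine (mu F) *: v + \sum_i fine (mu (F `&` A i)) *: c i =
   (fine (mu (F `&` A ord0)) *: (v + c ord0) +
    \sum_i fine (mu ((F `&` A ord0) `&` A (lift ord0 i))) *: c (lift ord0 i)) +
   (fine (mu (F `\` A ord0)) *: v +
    \sum_i fine (mu ((F `\` A ord0) `&` A (lift ord0 i))) *: c (lift ord0 i)).
  rewrite big_ord_recl; under eq_bigr do rewrite split// scalerDl.
  rewrite big_split /= scalerDr.
  have := split _ measurableT; rewrite !setIT => ->.
  by rewrite scalerDl addrA (addrAC _ _ (_ *: c ord0)) addrACA.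
have tri (a b : X) J : ((`|a|)%:E + (`|b|)%:E <= J -> (`|a + b|)%:E <= J)%E.
  by apply: le_trans; rewrite -EFinD lee_fin ler_normD.
apply: tri.
set f := fun t : R => (`|v + \sum_i (\1_(A i) t : R) *: c i|)%:E.
have -> : (\int[mu]_(t in F) f t =
    \int[mu]_(t in (F `&` A ord0) `|` (F `\` A ord0)) f t)%E by rewrite setUIDK.
rewrite ge0_integral_setU//; last 3 first.
- rewrite /f; apply/measurable_EFinP; apply: measurable_funTS.
  exact: measurable_step.
- by move=> t _; rewrite lee_fin.
- by apply/disj_setPS => t [[_ ?] [_]].
apply: leeD.
- apply: le_trans (IH _ _ _ _ mA' mF1 F1oo) _.
  rewrite le_eqVlt; apply/orP; left; apply/eqP; apply: eq_integral => t.
  rewrite inE => -[_ At]; rewrite /f big_ord_recl indicE mem_set// scale1r addrA.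
  by [].
- apply: le_trans (IH _ _ _ _ mA' mF2 F2oo) _.
  rewrite le_eqVlt; apply/orP; left; apply/eqP; apply: eq_integral => t.
  by rewrite inE => -[_ At]; rewrite /f big_ord_recl indicE memNset// scale0r add0r.
Qed.

(** The values and the integrals of a step function are the same expression in
    the set function u, so one decomposition of the difference serves for both. *)
Lemma step_difference (s s' : stepfun (X := X)) :
  exists n (B : 'I_n -> set R) (b : 'I_n -> X), (forall i, measurable (B i)) /\
  forall u : set R -> R,
    \sum_i u (@step_set _ _ s i) *: @step_val _ _ s i -
    \sum_i u (@step_set _ _ s' i) *: @step_val _ _ s' i = 0 + \sum_i u (B i) *: b i.
Proof.
case: s => n A c mA Aoo; case: s' => m A' c' mA' A'oo /=.
exists (n + m)%N, (fun i => match fintype.split i with inl i => A i | inr j => A' j end),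
  (fun i => match fintype.split i with inl i => c i | inr j => - c' j end); split => [i|u].
  by case: fintype.split.
rewrite add0r big_split_ord /=; congr (_ + _).
  by apply: eq_bigr => i _; rewrite (unsplitK (inl _ i)).
by rewrite -sumrN; apply: eq_bigr => i _; rewrite (unsplitK (inr _ i)) scalerN.
Qed.

Lemma measurable_norm_stepB (s s' : stepfun (X := X)) :
  measurable_fun setT (fun t : measurableTypeR R => `|step_eval s t - step_eval s' t|).
Proof.
have [n [B [b [mB E]]]] := step_difference s s'.
under eq_fun do rewrite (E (fun S => \1_S _)).
exact: measurable_step.
Qed.

Lemma norm_step_integralB_le (F : set R) (s s' : stepfun (X := X)) :
  measurable F -> (mu F < +oo)%E ->
  ((`|step_integral F s - step_integral F s'|)%:E <=
   \int[mu]_(t in F) (`|step_eval s t - step_eval s' t|)%:E)%E.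
Proof.
move=> mF Foo; have [n [B [b [mB E]]]] := step_difference s s'.
rewrite /step_integral (E (fun S => fine (mu (F `&` S)))).
under eq_integral do rewrite /step_eval (E (fun S => \1_S _)).
have := norm_step_integral_le b 0 mB mF Foo.
by rewrite scaler0.
Qed.

Lemma measurable_norm_lim_step (F : set R) (f : R -> X) (s : nat -> stepfun (X := X))
    (s' : stepfun (X := X)) : measurable F ->
  (forall t, F t -> step_eval (s k) t @[k --> \oo] --> f t) ->
  measurable_fun (F : set (measurableTypeR R)) (fun t => `|f t - step_eval s' t|).
Proof.
move=> mF sf.
apply: (@measurable_fun_cvg _ _ _ _ (fun k t => `|step_eval (s k) t - step_eval s' t|)).
  by move=> k; apply: measurable_funTS; exact: measurable_norm_stepB.
move=> t Ft; apply: cvg_norm; apply: cvgB; [exact: sf|exact: cvg_cst].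
Qed.

(** The assumed everywhere limit makes the error t |-> |f t - step_eval (s' k) t|
    measurable, so that the two approximation errors can be added. *)
Lemma bochner_unique (F : set R) (f : R -> X) (s : nat -> stepfun (X := X)) (x x' : X) :
  measurable F -> (mu F < +oo)%E ->
  (forall t, F t -> step_eval (s k) t @[k --> \oo] --> f t) ->
  is_bochner_integral F f x -> is_bochner_integral F f x' -> x = x'.
Proof.
move=> mF Foo sf [u [_ fu ux]] [v [_ fv vx]].
have mf s' := measurable_norm_lim_step s' mF sf.
have d0 : (`|step_integral F (u k) - step_integral F (v k)|)%:E @[k --> \oo] --> (0 : \bar R).
  have h0 : ((\int[mu]_(t in F) (`|f t - step_eval (u k) t|)%:E) +
     (\int[mu]_(t in F) (`|f t - step_eval (v k) t|)%:E))%E @[k --> \oo] --> (0 : \bar R).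
    by rewrite -[X in _ --> X]adde0; apply: cvgeD.
  apply: squeeze_cvge (cvg_cst 0%E) h0; apply: nearW => k.
  rewrite lee_fin normr_ge0 /=.
  apply: le_trans (norm_step_integralB_le _ _ mF Foo) _.
  rewrite -ge0_integralD//.
  - apply: ge0_le_integral => //.
    + by apply/measurable_EFinP; apply: measurable_funTS; exact: measurable_norm_stepB.
    + by apply: emeasurable_funD; apply/measurable_EFinP.
    + move=> t _; rewrite -EFinD lee_fin (distrC (f t)).
      exact: ler_distD.
  - by apply/measurable_EFinP.
  - by apply/measurable_EFinP.
have d1 : `|step_integral F (u k) - step_integral F (v k)| @[k --> \oo] --> `|x - x'|.
  by apply: cvg_norm; apply: cvgB.
have d2 : `|step_integral F (u k) - step_integral F (v k)| @[k --> \oo] --> (0 : R).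
  exact: (fine_cvg d0).
have : `|x - x'| = 0 by apply: cvg_unique d1 d2; exact: Rhausdorff.
by move/eqP; rewrite normr_eq0 subr_eq0 => /eqP.
Qed.

Section Grid.
Variable f : R -> X.

Definition cell (k j : nat) : set R := `[j%:R / k.+1%:R, j.+1%:R / k.+1%:R[%classic.

Lemma cell_measurable k j : measurable (cell k j).
Proof. exact: measurable_itv. Qed.

Lemma cell_finite k j : (mu (cell k j) < +oo)%E.
Proof. by rewrite /cell lebesgue_measure_itv /=; case: ifP => _; rewrite -?EFinB ltry. Qed.

(** f is sampled at the mesh points of [0, k + 1[ with spacing 1 / (k + 1), so
    that every bounded interval is exhausted as the mesh is refined. *)
Definition grid (k : nat) : stepfun (X := X) :=
  @StepFun R X (k.+1 ^ 2) (fun j => cell k j) (fun j => f (j%:R / k.+1%:R))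
   (fun j => cell_measurable k j) (fun j => cell_finite k j).

Lemma cellP k j t : cell k j t <-> j%:R <= t * k.+1%:R < j.+1%:R.
Proof.
by rewrite /cell /= in_itv /= ler_pdivrMr ?ltr0n// ltr_pdivlMr ?ltr0n.
Qed.

Lemma cell_inj k j j' t : cell k j t -> cell k j' t -> j = j'.
Proof.
move=> /cellP /andP[a b] /cellP /andP[a' b'].
apply/eqP; rewrite eqn_leq; apply/andP; split.
  by have := le_lt_trans a b'; rewrite ltr_nat ltnS.
by have := le_lt_trans a' b; rewrite ltr_nat ltnS.
Qed.

Lemma grid_eval k t : 0 <= t < k.+1%:R ->
  exists2 j : nat, cell k j t & step_eval (grid k) t = f (j%:R / k.+1%:R).
Proof.
move=> /andP[t0 tk]; have tk0 : 0 <= t * k.+1%:R by rewrite mulr_ge0.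
have ct : cell k (Num.truncn (t * k.+1%:R)) t by apply/cellP; exact: truncn_itv.
exists (Num.truncn (t * k.+1%:R)) => //.
have jN : (Num.truncn (t * k.+1%:R) < k.+1 ^ 2)%N.
  have /andP[h1 _] := truncn_itv tk0.
  rewrite -(ltr_nat R); apply: (le_lt_trans h1).
  by rewrite natrX expr2 ltr_pM2r// ltr0n.
rewrite /step_eval /= (bigD1 (Ordinal jN))//= indicE mem_set// scale1r big1 ?addr0// => j jn.
rewrite indicE memNset ?scale0r// => cj; move/eqP: jn; apply; apply/val_inj => /=.
exact: cell_inj cj ct.
Qed.

Lemma grid_eval_out k t : ~ (0 <= t < k.+1%:R) -> step_eval (grid k) t = 0.
Proof.
move=> h; rewrite /step_eval big1// => j _.
rewrite indicE memNset ?scale0r// => /cellP /andP[a b]; apply: h.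
have k0 : 0 < k.+1%:R :> R by rewrite ltr0n.
apply/andP; split; first by rewrite -(pmulr_lge0 _ k0); apply: le_trans a.
rewrite -(ltr_pM2r k0); apply: lt_le_trans b _.
by rewrite -natrM ler_nat; exact: leq_trans (ltn_ord j) _.
Qed.

Lemma grid_uniform (F : set R) (b : R) :
  F `<=` [set t | 0 <= t] -> (forall t, F t -> t <= b \/ f t = 0) ->
  (forall e, 0 < e -> exists2 dl : R, 0 < dl & forall s t, 0 <= s -> F t -> s <= t ->
     t - s < dl -> `|f t - f s| <= e) ->
  forall e, 0 < e -> \forall k \near \oo, forall t, F t -> `|f t - step_eval (grid k) t| <= e.
Proof.
move=> F0 fb fc e e0; have [dl dl0 hdl] := fc e e0.
have N1 : \forall k \near \oo, b < k.+1%:R :> R.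
  by near=> k; apply: lt_trans (_ : k%:R < _); [near: k; exact: nbhs_infty_gtr|rewrite ltr_nat].
have N2 : \forall k \near \oo, k.+1%:R^-1 < dl.
  exact: near_infty_natSinv_lt (PosNum dl0).
near=> k => t Ft; have t0 := F0 _ Ft.
have kb : b < k.+1%:R by near: k.
have kd : k.+1%:R^-1 < dl by near: k.
case: (ltP t k.+1%:R) => tk; last first.
  rewrite grid_eval_out ?subr0; last by rewrite ltNge tk andbF.
  case: (fb _ Ft) => [tb|->]; last by rewrite normr0 ltW.
  by have := lt_le_trans kb tk; rewrite ltNge tb.
have [j cj ->] := @grid_eval k t (introT andP (conj t0 tk)).
have := cj; rewrite /cell /= in_itv /= => /andP[a c].
apply: hdl => //.
apply: lt_le_trans (ltW kd); rewrite ltrBlDr; apply: lt_le_trans c _.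
by rewrite -{2}(mul1r (k.+1%:R^-1)) -mulrDl -natr1 addrC.
Unshelve. all: by end_near. Qed.

Lemma bochner_of_uniform (F : set R) (x : X) :
  measurable F -> (mu F < +oo)%E ->
  (forall e, 0 < e -> \forall k \near \oo, forall t, F t -> `|f t - step_eval (grid k) t| <= e) ->
  step_integral F (grid k) @[k --> \oo] --> x ->
  is_bochner_integral F f x /\ bochner_integral F f = x.
Proof.
move=> mF Foo fu fx.
have sf t : F t -> step_eval (grid k) t @[k --> \oo] --> f t.
  move=> Ft; apply/cvgrPdist_le => e e0; have := fu _ e0; apply: filterS => k.
  exact.
have B : is_bochner_integral F f x.
  exists grid; split => //.
    by apply: aeW => t Ft; exact: sf.
  pose u k := (\int[mu]_(t in F) (`|f t - step_eval (grid k) t|)%:E)%E.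
  have u0 k : (0 <= u k)%E by apply: integral_ge0 => t _; rewrite lee_fin.
  pose m := fine (mu F).
  have mE : mu F = m%:E by rewrite /m fineK// ge0_fin_numE.
  have m0 : 0 <= m by rewrite /m fine_ge0.
  have ue e : 0 < e -> \forall k \near \oo, (u k <= (e * m)%:E)%E.
    move=> e0; have := fu _ e0; apply: filterS => k hk.
    rewrite EFinM -mE -integral_cst//; apply: ge0_le_integral => //.
    - by apply/measurable_EFinP; exact: measurable_norm_lim_step sf.
  have uf : \forall k \near \oo, u k \is a fin_num.
    have := ue 1 ltr01; apply: filterS => k hk.
    by rewrite ge0_fin_numE//; apply: le_lt_trans hk _; rewrite ltry.
  apply/fine_cvgP; split; first exact: uf.
  apply/cvgrPdist_le => e e0.
  have e'0 : 0 < e / (m + 1) by rewrite divr_gt0// ltr_wpDl.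
  near=> k; have ufk : u k \is a fin_num by near: k.
  have uk : (u k <= (e / (m + 1) * m)%:E)%E by near: k; exact: ue.
  rewrite sub0r normrN /= -/(u k) ger0_norm ?fine_ge0//.
  rewrite -lee_fin fineK//; apply: le_trans uk _; rewrite lee_fin.
  by rewrite mulrAC ler_pdivrMr ?ltr_wpDl// ler_pM2l// lerDl.
split => //; rewrite /bochner_integral.
by apply: (bochner_unique mF Foo sf) => //; apply: xgetPex; exists x.
Unshelve. all: by end_near. Qed.

End Grid.

End BochnerTheory.

(** * Explicit norms in gamma(R_+; X) *)

Section Tame.
Context {R : realType}.
Local Notation mu := (@lebesgue_measure R).
Local Notation Rplus := (`[0, +oo[%classic : set R).

(** Lipschitz continuity and bounded support in R_+ make the grid approximations
    converge uniformly. *)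
Definition tame (f : R -> R) := exists L b : R,
  [/\ 0 <= L, forall s t, `|f s - f t| <= L * `|s - t| & forall t, f t != 0 -> 0 <= t <= b].

Lemma tame_bounded f : tame f -> exists M, 0 <= M /\ forall t, `|f t| <= M.
Proof.
move=> [L [b [L0 fL fb]]].
have fm : f (-1) = 0.
  by apply/eqP/negPn/negP => /fb; lra.
exists (L * (`|b| + 1)); split; first by rewrite mulr_ge0// addr_ge0.
move=> t; case: (eqVneq (f t) 0) => [->|/fb /andP[t0 tb]].
  by rewrite normr0 mulr_ge0// addr_ge0.
have := fL t (-1); rewrite fm subr0 => /le_trans; apply; apply: ler_wpM2l => //.
by rewrite opprK ger0_norm ?addr_ge0// lerD2r; apply: le_trans (ler_norm _).
Qed.

Lemma tame_continuous f : tame f -> continuous f.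
Proof.
move=> [L [b [L0 fL _]]] x; apply/cvgrPdist_le => e e0.
have d0 : 0 < e / (L + 1) by rewrite divr_gt0// ltr_wpDl.
near=> t; apply: le_trans (fL _ _) _.
have xt : `|x - t| <= e / (L + 1) by near: t; apply: cvgr_dist_le.
apply: le_trans (ler_wpM2l L0 xt) _.
by rewrite mulrA ler_pdivrMr ?ltr_wpDl// mulrC ler_pM2l// lerDl.
Unshelve. all: by end_near. Qed.

Lemma tame_measurable f : tame f -> measurable_fun setT (f : measurableTypeR R -> R).
Proof. by move=> /tame_continuous/continuous_measurable_fun. Qed.

Lemma tame_integrable f D : tame f -> measurable D -> mu.-integrable D (EFin \o f).
Proof.
move=> tf mD; have [M [M0 fM]] := tame_bounded tf; have [L [b [_ _ fb]]] := tf.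
apply: (@integrableS _ _ _ mu setT) => //.
apply: (@le_integrable _ _ _ mu _ measurableT _ (fun x => (M%:E * (\1_(`[0, b]%classic) x : R)%:E)%E)).
- by apply/measurable_EFinP; exact: tame_measurable.
- move=> t _ /=; rewrite lee_fin indicE.
  have [tb|tb] := boolP (t \in _); first by rewrite mulr1 (ger0_norm M0).
  rewrite mulr0 normr0 normr_le0; apply/negPn/negP => /fb h.
  by move: tb; rewrite notin_setE /= in_itv /=.
- apply: integrableZl => //; apply: integrable_indic_itv.
Qed.

Lemma tameM f h : tame f -> tame h -> tame (f \* h).
Proof.
move=> tf th; have [M [M0 fM]] := tame_bounded tf; have [M' [M'0 hM]] := tame_bounded th.
have [L [b [L0 fL fb]]] := tf; have [L' [b' [L'0 hL hb]]] := th.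
exists (L * M' + M * L'), b; split.
- by rewrite addr_ge0 ?mulr_ge0.
- move=> s t /=.
  have -> : f s * h s - f t * h t = (f s - f t) * h s + f t * (h s - h t) by ring.
  apply: le_trans (ler_normD _ _) _; rewrite !normrM mulrDl.
  rewrite lerD//; first by rewrite mulrAC; apply: ler_pM.
  by rewrite -mulrA; apply: ler_pM.
- by move=> t; rewrite /= mulf_eq0 negb_or => /andP[/fb].
Qed.

Lemma tameZ c f : tame f -> tame (fun t => c * f t).
Proof.
move=> [L [b [L0 fL fb]]]; exists (`|c| * L), b; split.
- by rewrite mulr_ge0.
- by move=> s t; rewrite -mulrBr normrM -mulrA ler_wpM2l.
- by move=> t; rewrite mulf_eq0 negb_or => /andP[_ /fb].
Qed.

Lemma tame_square_integrable f : tame f -> square_integrable f.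
Proof.
move=> tf; split; first by apply: measurable_funTS; exact: tame_measurable.
have /integrableP[_] := tame_integrable (tameM tf tf) (measurable_itv `[0, +oo[).
apply: le_lt_trans; rewrite le_eqVlt; apply/orP; left; apply/eqP.
by apply: eq_integral => t _; rewrite gee0_abs /= ?lee_fin -?expr2 ?sqr_ge0.
Qed.

Lemma ip_indic (F : set R) f : measurable F -> F `<=` Rplus ->
  ip \1_F f = \int[mu]_(t in F) f t.
Proof.
move=> mF F0; rewrite /ip -[in RHS](setIidr F0) Rintegral_mkcondr.
apply: eq_Rintegral => t _; rewrite patchE indicE; case: ifP => _; by rewrite ?mul1r ?mul0r.
Qed.

Lemma tame_grid_uniform (X : normedModType R) (u : R -> X) (F : set R) (b C : R) :
  0 <= C -> (forall s t, `|u s - u t| <= C * `|s - t|) -> (forall t, u t != 0 -> 0 <= t <= b) ->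
  F `<=` [set t | 0 <= t] ->
  forall e, 0 < e -> \forall k \near \oo, forall t, F t -> `|u t - step_eval (grid u k) t| <= e.
Proof.
move=> C0 uC ub F0; apply: (grid_uniform (b := b)) => //.
  move=> t Ft; case: (eqVneq (u t) 0) => [->|/ub /andP[_ tb]]; [by right|by left].
move=> e e0; exists (e / (C + 1)); first by rewrite divr_gt0// ltr_wpDl.
move=> s t s0 Ft st d; apply: le_trans (uC _ _) _; rewrite ger0_norm ?subr_ge0//.
apply: le_trans (ler_wpM2l C0 (ltW d)) _.
by rewrite mulrA ler_pdivrMr ?ltr_wpDl// mulrC ler_pM2l// lerDl.
Qed.

Lemma integrable_indic_fin (A : set R) : measurable A -> (mu A < +oo)%E ->
  mu.-integrable setT (fun t => (\1_A t : R)%:E).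
Proof.
move=> mA Aoo; apply/integrableP; split.
  by apply/measurable_EFinP; apply: measurable_indic.
under eq_integral do rewrite gee0_abs ?lee_fin//.
by rewrite integral_indic// setIT.
Qed.

Lemma step_integral_scalar (F : set R) (s : stepfun (X := R^o)) :
  measurable F -> (mu F < +oo)%E ->
  mu.-integrable F (EFin \o step_eval s) /\
  step_integral F s = \int[mu]_(t in F) step_eval s t.
Proof.
move=> mF Foo; case: s => n A c mA Aoo; rewrite /step_eval /step_integral /=.
have iA i : mu.-integrable F (fun t => ((c i)%:E * (\1_(A i) t : R)%:E)%E).
  apply: integrableZl => //; apply: (@integrableS _ _ _ mu setT) => //.
  by apply: integrable_indic_fin => //; exact: Aoo.
have E : EFin \o (fun t => \sum_i (\1_(A i) t : R) *: c i) =
    (fun t => \sum_i ((c i)%:E * (\1_(A i) t : R)%:E))%E.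
  by apply/funext => t /=; rewrite -sumEFin; apply: eq_bigr => i _; rewrite -EFinM mulrC.
split.
  by rewrite E; apply: (@integrable_sum _ _ _ mu _ mF _ _ xpredT (fun i t => ((c i)%:E * (\1_(A i) t : R)%:E)%E)).
rewrite /Rintegral.
have -> : (\int[mu]_(t in F) (\sum_i (\1_(A i) t : R) *: c i)%:E =
    \int[mu]_(t in F) (\sum_i ((c i)%:E * (\1_(A i) t : R)%:E)))%E.
  exact: (congr1 (fun h => \int[mu]_(t in F) h t)%E E).
rewrite (@integral_sum _ _ _ mu _ mF _ (fun i t => ((c i)%:E * (\1_(A i) t : R)%:E)%E))//.
have fA i : mu (F `&` A i) \is a fin_num.
  have mFA : measurable (F `&` A i) by exact: measurableI.
  by rewrite ge0_fin_numE//; apply: le_lt_trans Foo; apply: le_measure; rewrite ?inE.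
have Ei i : (\int[mu]_(t in F) ((c i)%:E * (\1_(A i) t : R)%:E) =
    (fine (mu (F `&` A i)) *: c i)%:E)%E.
  rewrite integralZl//; last first.
    by apply: (@integrableS _ _ _ mu setT) => //; apply: integrable_indic_fin.
  rewrite integral_indic//; last exact: mA.
  rewrite -[X in (_ * X)%E]/(mu (A i `&` F)) (setIC (A i) F) -[mu _]fineK//.
  by rewrite -EFinM mulrC.
by rewrite (eq_bigr _ (fun i _ => Ei i)) sumEFin.
Qed.

Lemma tame_step_integral_cvg f (F : set R) : tame f ->
  measurable F -> F `<=` Rplus -> (mu F < +oo)%E ->
  step_integral F (grid (f : R -> R^o) k) @[k --> \oo] --> (\int[mu]_(t in F) f t : R^o).
Proof.
move=> tf mF F0 Foo; have [L [b [L0 fL fb]]] := tf.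
pose m := fine (mu F).
have mE : mu F = m%:E by rewrite /m fineK// ge0_fin_numE.
have m0 : 0 <= m by rewrite /m fine_ge0.
have U := @tame_grid_uniform R^o (f : R -> R^o) F b L L0 fL fb.
have F0' : F `<=` [set t | 0 <= t].
  by move=> t /F0; rewrite /= in_itv /= andbT.
apply/cvgrPdist_le => e e0.
have e'0 : 0 < e / (m + 1) by rewrite divr_gt0// ltr_wpDl.
have := U F0' _ e'0; apply: filterS => k hk.
have [ik ->] := step_integral_scalar (grid (f : R -> R^o) k) mF Foo.
have iff := tame_integrable tf mF.
have mF' : measurable (F : set (measurableTypeR R)) := mF.
rewrite -RintegralB//; have iB := integrableB mF' iff ik.
apply: le_trans (le_normr_Rintegral _ _) _ => //.
apply: (@le_trans _ _ (\int[mu]_(t in F) (e / (m + 1)))).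
  apply: le_Rintegral => //.
  - by have := integrable_norm iB.
  - apply/integrableP; split; first exact: measurable_cst.
    rewrite integral_cst//; suff : ((`|e / (m + 1)|)%:E * mu F < +oo)%E by [].
    by rewrite mE -EFinM ltry.
rewrite Rintegral_cst//; suff : e / (m + 1) * fine (mu F) <= e by [].
rewrite -/m.
by rewrite mulrAC ler_pdivrMr ?ltr_wpDl// ler_pM2l// lerDl.
Qed.

End Tame.

Section GammaNorm.
Context {R : realType} {d : measure_display} {Omega : measurableType d}.
Variables (P : probability Omega R) (g : nat -> {RV P >-> R}).
Hypothesis hg : gaussian_sequence g.
Variable X : normedModType R.
Local Notation mu := (@lebesgue_measure R).
Local Notation Rplus := (`[0, +oo[%classic : set R).

Lemma gauss_sqE (I : finType) (x : I -> X) :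
  gauss_sq g (fun y : X => `|y|) (fun k : 'I_#|I| => x (enum_val k)) = (gsq g x)%:E.
Proof.
rewrite -(gsqE hg) /gauss_sq unlock; apply: eq_integral => w _.
congr (`| _ | ^+ 2)%:E; rewrite /gsum [RHS](reindex (@enum_val I I)) /=.
  by apply: eq_bigr => i _; rewrite enum_valK.
by apply: onW_bij; exact: enum_val_bij.
Qed.

Section Family.
Variables (I : finType) (h : I -> R -> R) (x : I -> X).
Hypothesis th : forall i, tame (h i).
Let f t : X := \sum_i h i t *: x i.

Lemma tame_family_lip : exists C b : R, [/\ 0 <= C,
  forall s t, `|f s - f t| <= C * `|s - t| & forall t, f t != 0 -> 0 <= t <= b].
Proof.
have hL i : exists Lb : R * R, [/\ 0 <= Lb.1, forall s t, `|h i s - h i t| <= Lb.1 * `|s - t| &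
   forall t, h i t != 0 -> 0 <= t <= Lb.2].
  by have [L [b H]] := th i; exists (L, b).
have [Lb H] := choice hL.
exists (\sum_i (Lb i).1 * `|x i|), (\sum_i `|(Lb i).2|); split.
- by apply: sumr_ge0 => i _; rewrite mulr_ge0//; have [] := H i.
- move=> s t; rewrite /f -sumrB mulr_suml; apply: le_trans (ler_norm_sum _ _ _) _.
  apply: ler_sum => i _; rewrite -scalerBl normrZ mulrAC ler_wpM2r//.
  by have [_ + _] := H i; apply.
- move=> t f0; have [i hi] : exists i, h i t != 0.
    apply: contrapT => nh; move/eqP: f0; apply; rewrite /f big1// => i _.
    case: (eqVneq (h i t) 0) => [->|hi]; first by rewrite scale0r.
    by exfalso; apply: nh; exists i.
  have [_ _ /(_ _ hi) /andP[-> /=]] := H i => /le_trans; apply.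
  apply: le_trans (ler_norm _) _; rewrite (bigD1 i)//= lerDl.
  by apply: sumr_ge0.
Qed.

Lemma tame_family_strongly_measurable : strongly_measurable Rplus f.
Proof.
have [C [b [C0 fC fb]]] := tame_family_lip.
exists (grid f); apply: aeW => t; rewrite /= in_itv /= andbT => t0.
apply/cvgrPdist_le => e e0.
have := @tame_grid_uniform _ _ f [set t | 0 <= t] b C C0 fC fb (fun _ => id) e e0.
by apply: filterS => k; apply.
Qed.

Lemma tame_family_bochner (F : set R) : measurable F -> F `<=` Rplus -> (mu F < +oo)%E ->
  is_bochner_integral F f (\sum_i (\int[mu]_(t in F) h i t) *: x i) /\
  bochner_integral F f = \sum_i (\int[mu]_(t in F) h i t) *: x i.
Proof.
move=> mF F0 Foo; have [C [b [C0 fC fb]]] := tame_family_lip.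
have F0' : F `<=` [set t | 0 <= t].
  by move=> t /F0; rewrite /= in_itv /= andbT.
apply: bochner_of_uniform => //; first exact: (tame_grid_uniform C0 fC fb F0').
have -> : (fun k => step_integral F (grid f k)) =
    (fun k => \sum_i step_integral F (grid (h i : R -> R^o) k) *: x i).
  apply/funext => k; rewrite /step_integral /= /f.
  under eq_bigr do rewrite scaler_sumr.
  rewrite exchange_big /=; apply: eq_bigr => i _.
  by rewrite scaler_suml; apply: eq_bigr => j _; rewrite scalerA.
apply: cvg_big => [|i _]; first exact: add_continuous.
apply: cvgZr_tmp.
exact: tame_step_integral_cvg.
Qed.

(** The operator defined by f has finite rank, so that a constant sequence
    represents it in the completion. *)
Lemma has_gamma_norm_orthonormal :
  (forall i j, ip (h i) (h j) = (i == j)%:R) ->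
  has_gamma_norm g f (Num.sqrt (gsq g x)).
Proof.
move=> hO; split; first exact: tame_family_strongly_measurable.
  move=> F [mF F0 Foo]; exists (\sum_i (\int[mu]_(t in F) h i t) *: x i).
  exact: (tame_family_bochner mF F0 Foo).1.
pose T (k : R -> R) : X := \sum_i ip k (h i) *: x i.
have TF : finite_rank_gamma_norm g T (Num.sqrt (gsq g x)).
  exists #|I|, (fun k => h (enum_val k)), (fun k => x (enum_val k)); split.
  - split=> [i|i j]; first exact: tame_square_integrable.
    by rewrite hO (inj_eq enum_val_inj).
  - move=> k _; rewrite /T (reindex (@enum_val I I)) //=.
    by apply: onW_bij; exact: enum_val_bij.
  - by rewrite gauss_sqE.
exists T; last first.
  move=> F [mF F0 Foo]; rewrite (tame_family_bochner mF F0 Foo).2 /T.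
  by apply: eq_bigr => i _; rewrite ip_indic.
exists (fun=> T), (fun=> Num.sqrt (gsq g x)); split => //.
- move=> e e0; exists 0%N => j k _ _; exists 0 => //.
  exists 0%N, (fun=> fun=> 0), (fun=> 0); split.
  + by split => [[]|[]].
  + by move=> k' _; rewrite big_ord0 subrr.
  + rewrite /gauss_sq unlock.
    have -> : (fun w => (`|\sum_(i < 0) (g i w : R) *: (0 : X)| ^+ 2)%:E) = cst 0%E.
      by apply/funext => w; rewrite big_ord0 normr0 expr0n.
    by rewrite integral0 /= sqrtr0.
- by move=> k _; exact: cvg_cst.
- exact: cvg_cst.
Qed.

End Family.
End GammaNorm.

(** * Smooth scalar functions *)

Section Cinf.
Context {R : realType}.
Implicit Types (f g : R -> R) (C : set (R -> R)).

Definition derive_closed C :=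
  forall f, C f -> exists2 f', C f' & forall t : R, is_derive t 1 f (f' t).

(** Smoothness by coinduction: closure under an operation is proved by exhibiting
    a class of functions which is stable under derivation. *)
Definition cinf f := exists2 C, derive_closed C & C f.

Lemma cinf_derive f : cinf f -> exists2 f', cinf f' & forall t : R, is_derive t 1 f (f' t).
Proof.
by move=> [C hC Cf]; have [f' Cf' df] := hC f Cf; exists f' => //; exists C.
Qed.

Lemma cinfZ (c : R) f : cinf f -> cinf (fun t => c * f t).
Proof.
move=> [C hC Cf]; exists [set h | exists2 u, C u & h = (fun t => c * u t)]; last by exists f.
move=> _ [u Cu ->]; have [u' Cu' du] := hC u Cu.
by exists (fun t => c * u' t); [exists u'|move=> t; apply: is_deriveZ].
Qed.

Lemma cinfD f g : cinf f -> cinf g -> cinf (fun t => f t + g t).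
Proof.
move=> [C hC Cf] [D hD Dg].
exists [set h | exists u v, [/\ C u, D v & h = (fun t => u t + v t)]]; last by exists f, g.
move=> _ [u [v [Cu Dv ->]]]; have [u' Cu' du] := hC u Cu; have [v' Dv' dv] := hD v Dv.
by exists (fun t => u' t + v' t); [exists u', v'|move=> t; apply: is_deriveD].
Qed.

(** The derivative of a product is a sum of products, hence the closure under
    addition. *)
Inductive prod_closure C D : (R -> R) -> Prop :=
| prod_closure_mul u v : C u -> D v -> prod_closure C D (fun t => u t * v t)
| prod_closure_add u v : prod_closure C D u -> prod_closure C D v ->
    prod_closure C D (fun t => u t + v t).

Lemma cinfM f g : cinf f -> cinf g -> cinf (fun t => f t * g t).
Proof.
move=> [C hC Cf] [D hD Dg]; exists (prod_closure C D); last exact: prod_closure_mul.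
move=> w hw; elim: {w}hw => [u v Cu Dv|u v _ [u' pu' du] _ [v' pv' dv]].
  have [u' Cu' du] := hC u Cu; have [v' Dv' dv] := hD v Dv.
  exists (fun t => u t * v' t + u' t * v t).
    by apply: prod_closure_add; apply: prod_closure_mul.
  move=> t; apply: is_derive_eq (is_deriveM (du t) (dv t)) _.
  by rewrite /GRing.scale /= [v t * _]mulrC.
exists (fun t => u' t + v' t); first exact: prod_closure_add.
by move=> t; apply: is_deriveD.
Qed.

Lemma is_derive_affine (a b t : R) : is_derive t 1 (fun x : R => a * x + b) a.
Proof.
have h : is_derive t (1 : R) (a \*: (@id R)) (a *: 1) by apply: is_deriveZ.
have k : is_derive t (1 : R) (cst b : R -> R) 0 by apply: is_derive_cst.
apply: is_derive_eq (is_deriveD h k) _.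
by rewrite addr0 /GRing.scale /= mulr1.
Qed.

Lemma cinf_affine (a b : R) f : cinf f -> cinf (fun t => f (a * t + b)).
Proof.
move=> [C hC Cf].
exists [set h | exists c u, C u /\ h = (fun t => c * u (a * t + b))]; last first.
  by exists 1, f; split => //; apply/funext => t; rewrite mul1r.
move=> _ [c [u [Cu ->]]]; have [u' Cu' du] := hC u Cu.
exists (fun t => (c * a) * u' (a * t + b)); first by exists (c * a), u'.
move=> t; have h := is_derive1_comp (f := u) (g := fun x => a * x + b) (du _) (is_derive_affine a b t).
apply: is_derive_eq (is_deriveZ c h) _.
by rewrite /GRing.scale /=; ring.
Qed.

Lemma cinf_trig (a b : R) : cinf (fun t => a * cos t + b * sin t).
Proof.
exists [set h | exists a b, h = (fun t => a * cos t + b * sin t)]; last by exists a, b.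
move=> _ [c [e ->]]; exists (fun t => e * cos t + (- c) * sin t); first by exists e, (- c).
move=> t; apply: is_derive_eq (is_deriveD (is_deriveZ c (is_derive_cos t))
  (is_deriveZ e (is_derive_sin t))) _.
by rewrite /GRing.scale /= mulrN mulNr addrC.
Qed.

(** These functions span a space which is stable under derivation and contains
    exp (- 1 / t). *)
Definition flat (n : nat) (t : R) : R := if 0 < t then t^-1 ^+ n * expR (- t^-1) else 0.

(** From exp s >= s ^ (n + 2) / (n + 2)! at s = 1 / t; this gives the derivative
    0 at the origin. *)
Lemma flat_le n t : `|flat n t| <= (n.+2)`!%:R * t ^+ 2.
Proof.
rewrite /flat; case: ifP => t0; last by rewrite normr0 mulr_ge0 ?sqr_ge0.
have s0 : 0 < t^-1 by rewrite invr_gt0.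
rewrite ger0_norm ?mulr_ge0 ?expR_ge0 ?exprn_ge0 ?(ltW s0)//.
have := expR_ge1Dxn n.+1 (ltW s0); set s := t^-1 in s0 *.
have -> : t = s^-1 by rewrite /s invrK.
rewrite expRN => h; rewrite ler_pdivrMr ?expR_gt0//.
have F0 : 0 < (n.+2)`!%:R :> R by rewrite ltr0n fact_gt0.
have h2 : s ^+ n.+2 <= (n.+2)`!%:R * expR s.
  by rewrite -ler_pdivrMl// mulrC; apply: le_trans h; rewrite lerDr.
have -> : (n.+2)`!%:R * s^-1 ^+ 2 * expR s = ((n.+2)`!%:R * expR s) / s ^+ 2.
  by rewrite exprVn mulrAC.
by rewrite ler_pdivlMr ?exprn_gt0// -exprD addn2.
Qed.

Lemma is_derive0_quadratic f (K : R) : (forall t, `|f t| <= K * t ^+ 2) -> is_derive (0 : R) 1 f 0.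
Proof.
move=> fK; have f0 : f 0 = 0.
  by apply/eqP; rewrite -normr_le0; apply: le_trans (fK 0) _; rewrite expr0n mulr0.
have K0 : 0 <= K by have := fK 1; rewrite expr1n mulr1; apply: le_trans.
have h : h^-1 *: ((f \o shift 0) (h *: (1 : R)) - f 0) @[h --> 0^'] --> (0 : R).
  apply/cvgrPdist_le => e e0.
  have d0 : 0 < e / (K + 1) by rewrite divr_gt0// ltr_wpDl.
  near=> h; rewrite sub0r normrN /= f0 subr0 addr0 /GRing.scale /= mulr1.
  have h0 : h != 0 by near: h; exact: nbhs_dnbhs_neq.
  have hd : `|h| <= e / (K + 1).
    by near: h; apply: dnbhs0_le.
  rewrite normrM normfV ler_pdivrMl ?normr_gt0//.
  apply: le_trans (fK _) _; rewrite -real_normK ?num_real// expr2 mulrCA ler_wpM2l//.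
  apply: le_trans (ler_wpM2l K0 hd) _.
  by rewrite mulrA ler_pdivrMr ?ltr_wpDl// mulrC ler_pM2l// lerDl.
apply: DeriveDef; last exact/cvg_lim.
by apply/cvg_ex; exists 0.
Unshelve. all: by end_near. Qed.

Lemma is_derive_flat (n : nat) (t : R) : is_derive t (1 : R) (flat n) (flat n.+2 t - n%:R * flat n.+1 t).
Proof.
have [t0|t0|<-] := ltgtP 0 t.
- have -> : flat n.+2 t - n%:R * flat n.+1 t =
     t^-1 ^+ n *: (expR (- t^-1) * (t ^- 2)) + expR (- t^-1) *: (n%:R * t^-1 ^+ n.-1 * (- t ^- 2)).
    rewrite /flat t0 /GRing.scale /= -exprVn; set s := t^-1; set E := expR _.
    by case: n => [|n]; rewrite /= ?exprS; ring.
  apply: (@near_eq_is_derive R R^o R^o (fun x => x^-1 ^+ n * expR (- x^-1))).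
    by near=> x; rewrite /flat ifT//; near: x; exact: lt_nbhsr.
  have dV : is_derive t (1 : R) (fun x : R => x^-1) (- t ^- 2).
    have t1 : (@id R) t != 0 by rewrite gt_eqF.
    apply: is_derive_eq (is_deriveV t1 (is_derive_id t (1 : R))) _.
    by rewrite /GRing.scale /= mulr1.
  have dVN : is_derive t (1 : R) (fun x : R => - x^-1) (t ^- 2).
    by apply: is_derive_eq (is_deriveN dV) _; rewrite opprK.
  have dE : is_derive t (1 : R) (fun x : R => expR (- x^-1)) (expR (- t^-1) * t ^- 2).
    exact: (is_derive1_comp (is_derive_expR _) dVN).
  have dX : is_derive t (1 : R) (fun x : R => x^-1 ^+ n) (n%:R * t^-1 ^+ n.-1 * (- t ^- 2)).
    have -> : (fun x : R => x^-1 ^+ n) = (fun x : R => x^-1) ^+ n.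
      by apply/funext => x; rewrite exprfctE.
    by apply: is_derive_eq (is_deriveX n dV) _; rewrite /GRing.scale /= -mulr_natl.
  exact: (is_deriveM dX dE).
- have -> : flat n.+2 t - n%:R * flat n.+1 t = 0.
    by rewrite /flat ltNge (ltW t0) /= mulr0 subr0.
  apply: (@near_eq_is_derive R R^o R^o (cst 0)).
  near=> x; rewrite /flat ifF//; apply/negbTE; rewrite -leNgt; apply: ltW.
  by near: x; exact: lt_nbhsl.
- have -> : flat n.+2 0 - n%:R * flat n.+1 0 = 0.
    by rewrite /flat ltxx mulr0 subr0.
  exact: is_derive0_quadratic (@flat_le n).
Unshelve. all: by end_near. Qed.

Lemma cinf_flat : cinf (flat 0).
Proof.
exists [set h | exists s : seq (R * nat), h = (fun t => \sum_(p <- s) p.1 * flat p.2 t)]; last first.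
  by exists [:: (1, 0%N)]; apply/funext => t; rewrite big_seq1 mul1r.
move=> _ [s ->].
exists (fun t => \sum_(p <- s) p.1 * (flat p.2.+2 t - p.2%:R * flat p.2.+1 t)).
  exists (flatten [seq [:: (p.1, p.2.+2); (- (p.1 * p.2%:R), p.2.+1)] | p <- s]).
  apply/funext => t; elim: s => [|p s IH]; first by rewrite !big_nil.
  by rewrite /= !big_cons IH addrA; congr (_ + _) => /=; ring.
move=> t; elim: s => [|p s IH].
  by under eq_fun do rewrite big_nil; rewrite big_nil; exact: is_derive_cst.
under eq_fun do rewrite big_cons; rewrite big_cons.
apply: is_deriveD; apply: is_deriveZ; exact: is_derive_flat.
Qed.

End Cinf.

(** * Integrals over [-1, 1] *)

Section IntegralJ.
Context {R : realType}.
Local Notation mu := (@lebesgue_measure R).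
Local Notation Rplus := (`[0, +oo[%classic : set R).
Implicit Types f h : R -> R.

Definition int11 f : R := \int[mu]_(t in `[-1, 1]) f t.

Lemma is_derive_continuous f (x df : R) : is_derive x 1 f df -> {for x, continuous f}.
Proof. by move=> [d _]; apply: differentiable_continuous; exact/derivable1_diffP. Qed.

Lemma cinf_continuous f : cinf f -> continuous f.
Proof. by move=> /cinf_derive[f' _ df] x; exact: is_derive_continuous (df x). Qed.

Lemma integral_derive f F (a b : R) : a < b -> continuous f ->
  (forall x : R, a <= x <= b -> is_derive x (1 : R) F (f x)) ->
  \int[mu]_(t in `[a, b]) f t = F b - F a.
Proof.
move=> ab cf dF.
have cF x : a <= x <= b -> {for x, continuous F} by move=> /dF; exact: is_derive_continuous.
rewrite /Rintegral (@continuous_FTC2 _ f F a b ab) //.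
- by apply: continuous_subspaceT => x; exact: cf.
- split.
  + by move=> x /[!in_itv] /= /andP[/ltW ax /ltW xb]; have [] := dF x (introT andP (conj ax xb)).
  + by apply: cvg_at_right_filter; apply: cF; rewrite lexx ltW.
  + by apply: cvg_at_left_filter; apply: cF; rewrite lexx ltW.
- move=> x /[!in_itv] /= /andP[/ltW ax /ltW xb]; rewrite derive1E.
  by have [_ ->] := dF x (introT andP (conj ax xb)).
Qed.

Lemma continuous_integrable f (a b : R) : continuous f ->
  mu.-integrable `[a, b] (EFin \o f).
Proof.
move=> cf; apply: continuous_compact_integrable; first exact: segment_compact.
by apply: continuous_subspaceT => x; exact: cf.
Qed.

Lemma primitive f : continuous f ->
  exists F : R -> R, forall x : R, -1 <= x <= 1 -> is_derive x (1 : R) F (f x).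
Proof.
move=> cf; exists (fun x => \int[mu]_(t in `[-2, x]) f t) => x /andP[x1 x2].
have x3 : x < 2 by lra.
have x4 : -2 < x by lra.
have [d e] := continuous_FTC1_closed x3 (continuous_integrable (-2) 2 cf) x4 (cf x).
by apply: DeriveDef; [exact: d|rewrite -derive1E; exact: e].
Qed.

Lemma int11_D f h : continuous f -> continuous h -> int11 (fun t => f t + h t) = int11 f + int11 h.
Proof. by move=> cf ch; rewrite /int11 RintegralD//; exact: continuous_integrable. Qed.

Lemma int11_Z c f : continuous f -> int11 (fun t => c * f t) = c * int11 f.
Proof. by move=> cf; rewrite /int11 RintegralZl//; exact: continuous_integrable. Qed.

Lemma int11_ge0 f : (forall t, 0 <= f t) -> 0 <= int11 f.
Proof. by move=> f0; apply: Rintegral_ge0 => t _. Qed.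

Lemma int11_derive f f' : continuous f' -> (forall t : R, is_derive t 1 f (f' t)) ->
  f 1 = 0 -> f (-1) = 0 -> int11 f' = 0.
Proof.
move=> cf df f1 fm; have l : -1 < 1 :> R by apply: lt_trans (ltrN10 R) ltr01.
by rewrite /int11 (integral_derive l cf (fun x _ => df x)) f1 fm subrr.
Qed.

(** The condition on tau places the support of the integrand in R_+. *)
Lemma int11_subst f (s tau : R) : continuous f -> (forall t, f t != 0 -> -1 < t < 1) ->
  s != 0 -> `|s|^-1 <= tau ->
  \int[mu]_(t in Rplus) f (s * t + (- (s * tau))) = `|s|^-1 * int11 f.
Proof.
move=> cf sf s0 st.
have [F dF] := primitive cf.
have sp : 0 < `|s|^-1 by rewrite invr_gt0 normr_gt0.
set a := tau - `|s|^-1; set b := tau + `|s|^-1.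
pose G t := s^-1 * F (s * t + (- (s * tau))).
have bound t : (a <= t <= b) = (-1 <= s * t + - (s * tau) <= 1).
  rewrite -ler_norml -mulrBr normrM -ler_pdivlMl ?normr_gt0// mulr1 ler_norml /a /b.
  by apply/idP/idP => /andP[h1 h2]; apply/andP; split; lra.
have dG (t : R) : a <= t <= b -> is_derive t (1 : R) G (f (s * t + - (s * tau))).
  rewrite bound => /dF d.
  have d' := is_derive1_comp (g := fun x => s * x + - (s * tau)) d
    (is_derive_affine s (- (s * tau)) t).
  apply: is_derive_eq (is_deriveZ s^-1 d') _.
  by rewrite /GRing.scale /= mulrCA mulVf// mulr1.
have cc : continuous (fun t => f (s * t + - (s * tau))).
  move=> t; apply: (continuous_comp (f := fun t => s * t + - (s * tau))); last exact: cf.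
  exact: is_derive_continuous (is_derive_affine s (- (s * tau)) t).
have ab : a < b by rewrite /a /b; lra.
have -> : \int[mu]_(t in Rplus) f (s * t + - (s * tau)) =
    \int[mu]_(t in `[a, b]) f (s * t + - (s * tau)).
  rewrite Rintegral_mkcond [RHS]Rintegral_mkcond; apply: eq_Rintegral => t _.
  rewrite !patchE !mem_setE !in_itv /= andbT.
  case: (eqVneq (f (s * t + - (s * tau))) 0) => [->|f0]; first by rewrite !if_same.
  have h := sf _ f0.
  have ht : a <= t <= b by rewrite bound; case/andP: h => /ltW -> /ltW ->.
  rewrite ht (_ : 0 <= t)//; case/andP: ht => + _; apply: le_trans.
  by rewrite /a subr_ge0.
have l : -1 < 1 :> R by apply: lt_trans (ltrN10 R) ltr01.
rewrite (integral_derive ab cc dG) /int11 (integral_derive l cf dF).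
rewrite /G /a /b -mulrBr.
have ns : `|s| != 0 by rewrite normr_eq0.
have -> : s * (tau + `|s|^-1) + - (s * tau) = s / `|s| by rewrite mulrDr addrAC subrr add0r.
have -> : s * (tau - `|s|^-1) + - (s * tau) = - (s / `|s|) by rewrite mulrBr addrAC subrr add0r.
have [s1|s1|s1] := ltgtP s 0; last by rewrite s1 eqxx in s0.
  by rewrite ltr0_norm// invrN mulrN divff// opprK mulNr -mulrN opprB.
by rewrite gtr0_norm// divff.
Qed.

Lemma int11_odd f : continuous f -> (forall t, f (- t) = - f t) -> int11 f = 0.
Proof.
move=> cf fo; have [F dF] := primitive cf.
have d (t : R) : -1 <= t <= 1 -> is_derive t (1 : R) (fun t => F (- t)) (f t).
  move=> t1; have t1' : -1 <= - t <= 1 by clear -t1; lra.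
  have d' := is_derive1_comp (g := fun x => - x) (dF _ t1') (is_deriveNid t (1 : R)).
  by apply: is_derive_eq d' _; rewrite mulrN1 fo opprK.
have e1 := @integral_derive f F (-1) 1 _ cf dF.
have e2 := @integral_derive f _ (-1) 1 _ cf d.
rewrite /int11; rewrite opprK in e2.
have l : -1 < 1 :> R by apply: lt_trans (ltrN10 R) ltr01.
by move: (e1 l) (e2 l) => {e1 e2 d dF cf fo l}; lra.
Qed.

Lemma int11_gt0 f (t0 : R) : continuous f -> (forall t, 0 <= f t) -> -1 < t0 < 1 -> 0 < f t0 ->
  0 < int11 f.
Proof.
move=> cf f0 t01 ft0; rewrite lt_neqAle int11_ge0// andbT; apply/eqP => J0.
have [F dF] := primitive cf.
have Fc x : -1 < x < 1 -> F x = F (-1).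
  move=> /andP[x1 x2].
  have e1 : \int[mu]_(t in `[-1, x]) f t = F x - F (-1).
    by apply: integral_derive => // y /andP[y1 y2]; apply: dF; clear -y1 y2 x1 x2; lra.
  have e2 : \int[mu]_(t in `[x, 1]) f t = F 1 - F x.
    by apply: integral_derive => // y /andP[y1 y2]; apply: dF; clear -y1 y2 x1 x2; lra.
  have e3 : int11 f = F 1 - F (-1) by apply: integral_derive => //; apply: lt_trans (ltrN10 R) ltr01.
  have p1 : 0 <= \int[mu]_(t in `[-1, x]) f t by apply: Rintegral_ge0.
  have p2 : 0 <= \int[mu]_(t in `[x, 1]) f t by apply: Rintegral_ge0.
  by move: J0 e1 e2 e3 p1 p2; clear; lra.
have d1 : is_derive t0 (1 : R) F (f t0) by apply: dF; case/andP: t01 => /ltW -> /ltW ->.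
have d2 : is_derive t0 (1 : R) F 0.
  apply: (@near_eq_is_derive R R^o R^o (cst (F (-1)))).
  case/andP: t01 => a b; near=> x; rewrite Fc//; apply/andP; split; near: x.
    exact: lt_nbhsr.
  exact: lt_nbhsl.
by move: ft0; rewrite -(@derive_val _ _ _ _ _ _ _ d1) (@derive_val _ _ _ _ _ _ _ d2) ltxx.
Unshelve. all: by end_near. Qed.

End IntegralJ.

(** * Truncated cosines and sines *)

Section Wave.
Context {R : realType}.
Implicit Types f h : R -> R.

Lemma cinf_of_derive f f' : cinf f -> (forall t : R, is_derive t (1 : R) f (f' t)) -> cinf f'.
Proof.
move=> /cinf_derive[u cu du] df; rewrite (_ : f' = u)//; apply/funext => t.
by rewrite -(@derive_val _ _ _ _ _ _ _ (df t)) (@derive_val _ _ _ _ _ _ _ (du t)).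
Qed.

Definition dot f h := int11 (fun t => f t * h t).

Lemma continuousMR f h : continuous f -> continuous h -> continuous (fun t => f t * h t).
Proof. by move=> cf ch t; apply: continuousM; [exact: cf|exact: ch]. Qed.

Lemma dotC f h : dot f h = dot h f.
Proof. by rewrite /dot; congr int11; apply/funext => t; rewrite mulrC. Qed.

Lemma dot_combl (a b : R) f h u : continuous f -> continuous h -> continuous u ->
  dot (fun t => a * f t + b * h t) u = a * dot f u + b * dot h u.
Proof.
move=> cf ch cu; rewrite /dot -!int11_Z; [|exact: continuousMR..].
rewrite -int11_D.
- by congr int11; apply/funext => t; ring.
- by apply: continuousMR; [exact: cst_continuous|exact: continuousMR].
- by apply: continuousMR; [exact: cst_continuous|exact: continuousMR].
Qed.

Lemma dot_comb2 (a b a' b' : R) f h u v :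
  continuous f -> continuous h -> continuous u -> continuous v ->
  dot (fun t => a * f t + b * h t) (fun t => a' * u t + b' * v t) =
  a * a' * dot f u + a * b' * dot f v + b * a' * dot h u + b * b' * dot h v.
Proof.
move=> cf ch cu cv.
have cuv : continuous (fun t => a' * u t + b' * v t).
  by move=> t; apply: cvgD; apply: cvgM; [exact: cvg_cst|exact: cu|exact: cvg_cst|exact: cv].
rewrite dot_combl// !(dotC _ (fun t => a' * u t + b' * v t)) !dot_combl//.
rewrite !(dotC _ f) !(dotC _ h); ring.
Qed.

Lemma dot_ge0 f : 0 <= dot f f.
Proof. by apply: int11_ge0 => t; rewrite -expr2 sqr_ge0. Qed.

Lemma dot_le f h : continuous f -> continuous h -> `|dot f h| <= (dot f f + dot h h) / 2.
Proof.
move=> cf ch.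
have h1 := dot_comb2 1 1 1 1 cf ch cf ch.
have h2 := dot_comb2 1 (-1) 1 (-1) cf ch cf ch.
have p1 := dot_ge0 (fun t => 1 * f t + 1 * h t).
have p2 := dot_ge0 (fun t => 1 * f t + -1 * h t).
rewrite h1 in p1; rewrite h2 in p2; rewrite (dotC h f) in p1 p2.
by rewrite ler_norml; clear h1 h2; apply/andP; split; lra.
Qed.

Definition chi (t : R) : R := flat 0 (-1 * t + 1) * flat 0 (1 * t + 1).
Definition chi' (t : R) : R :=
  flat 0 (-1 * t + 1) * flat 2 (1 * t + 1) - flat 2 (-1 * t + 1) * flat 0 (1 * t + 1).

Lemma cinf_chi : cinf chi.
Proof. by apply: cinfM; apply: cinf_affine; exact: cinf_flat. Qed.

Lemma is_derive_chi t : is_derive t (1 : R) chi (chi' t).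
Proof.
have h (a b : R) : is_derive t (1 : R) (fun t => flat 0 (a * t + b)) (a * flat 2 (a * t + b)).
  have d := is_derive1_comp (g := fun x => a * x + b) (is_derive_flat 0 _) (is_derive_affine a b t).
  by apply: is_derive_eq d _; rewrite mul0r subr0 mulrC.
apply: is_derive_eq (is_deriveM (h (-1) 1) (h 1 1)) _.
by rewrite /GRing.scale /= /chi'; ring.
Qed.

Lemma cinf_chi' : cinf chi'.
Proof. exact: cinf_of_derive cinf_chi is_derive_chi. Qed.

Lemma flat_gt0 n (t : R) : 0 < t -> 0 < flat n t.
Proof. by move=> t0; rewrite /flat t0 mulr_gt0 ?expR_gt0// exprn_gt0// invr_gt0. Qed.

Lemma flat_eq0 n (t : R) : t <= 0 -> flat n t = 0.
Proof. by move=> t0; rewrite /flat ltNge t0. Qed.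

Lemma chi_gt0 t : -1 < t < 1 -> 0 < chi t.
Proof. by move=> /andP[a b]; apply: mulr_gt0; apply: flat_gt0; lra. Qed.

Lemma chi_supp t : chi t != 0 -> -1 < t < 1.
Proof.
rewrite /chi mulf_eq0 negb_or => /andP[a b]; apply/andP; split; rewrite ltNge; apply/negP => h.
  by move: b; rewrite flat_eq0 ?eqxx//; lra.
by move: a; rewrite flat_eq0 ?eqxx//; lra.
Qed.

Lemma chi'_supp t : chi' t != 0 -> -1 < t < 1.
Proof.
move=> h; apply/andP; split; rewrite ltNge; apply/negP => k; move: h; rewrite /chi'.
  by rewrite !(@flat_eq0 _ (1 * t + 1)) ?mulr0 ?subr0 ?eqxx//; lra.
by rewrite !(@flat_eq0 _ (-1 * t + 1)) ?mul0r ?subr0 ?eqxx//; lra.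
Qed.

Lemma chi_even t : chi (- t) = chi t.
Proof. by rewrite /chi mulrC; congr (flat 0 _ * flat 0 _); ring. Qed.

Lemma chi'_odd t : chi' (- t) = - chi' t.
Proof. by rewrite /chi' !mulN1r !mul1r opprK; ring. Qed.

Lemma chi'_neq0 t : 0 < t < 1 -> chi' t != 0.
Proof.
move=> /andP[a b].
have u : 0 < -1 * t + 1 by lra.
have v : 0 < 1 * t + 1 by lra.
have -> : chi' t = chi t * ((1 * t + 1)^-1 ^+ 2 - (-1 * t + 1)^-1 ^+ 2).
  by rewrite /chi' /chi /flat u v !expr0; ring.
rewrite mulf_neq0//; first by rewrite gt_eqF// chi_gt0//; lra.
rewrite subr_eq0 lt_eqF// ltr_sqr ?nnegrE ?invr_ge0 ?(ltW u) ?(ltW v)//.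
by rewrite ltf_pV2 ?posrE//; lra.
Qed.

Section Modulated.
Variable k : R.
Definition w_p t : R := chi t * cos (k * t).
Definition w_q t : R := chi t * sin (k * t).
Definition w_e1 t : R := chi' t * cos (k * t).
Definition w_e2 t : R := chi' t * sin (k * t).

Lemma cinf_cosk : cinf (fun t => cos (k * t)).
Proof.
have := cinf_affine k 0 (cinf_trig 1 0).
by rewrite (_ : (fun t => _) = (fun t => cos (k * t)))//; apply/funext => t; rewrite addr0 mul1r mul0r addr0.
Qed.

Lemma cinf_sink : cinf (fun t => sin (k * t)).
Proof.
have := cinf_affine k 0 (cinf_trig 0 1).
by rewrite (_ : (fun t => _) = (fun t => sin (k * t)))//; apply/funext => t; rewrite addr0 mul1r mul0r add0r.
Qed.

Lemma cinf_w_p : cinf w_p. Proof. exact: cinfM cinf_chi cinf_cosk. Qed.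
Lemma cinf_w_q : cinf w_q. Proof. exact: cinfM cinf_chi cinf_sink. Qed.
Lemma cinf_w_e1 : cinf w_e1. Proof. exact: cinfM cinf_chi' cinf_cosk. Qed.
Lemma cinf_w_e2 : cinf w_e2. Proof. exact: cinfM cinf_chi' cinf_sink. Qed.

Lemma is_derive_scaled (t : R) : is_derive t (1 : R) (fun t : R => k * t) k.
Proof.
have := is_derive_affine k 0 t.
by rewrite (_ : (fun x : R => k * x + 0) = (fun t => k * t))//; apply/funext => x; rewrite addr0.
Qed.

Lemma is_derive_w_p (t : R) : is_derive t (1 : R) w_p (w_e1 t - k * w_q t).
Proof.
have d := is_derive1_comp (g := fun t => k * t) (is_derive_cos _) (is_derive_scaled t).
apply: is_derive_eq (is_deriveM (is_derive_chi t) d) _.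
by rewrite /GRing.scale /= /w_e1 /w_q; ring.
Qed.

Lemma is_derive_w_q (t : R) : is_derive t (1 : R) w_q (w_e2 t + k * w_p t).
Proof.
have d := is_derive1_comp (g := fun t => k * t) (is_derive_sin _) (is_derive_scaled t).
apply: is_derive_eq (is_deriveM (is_derive_chi t) d) _.
by rewrite /GRing.scale /= /w_e2 /w_p; ring.
Qed.

Let cp := cinf_continuous cinf_w_p.
Let cq := cinf_continuous cinf_w_q.
Let ce1 := cinf_continuous cinf_w_e1.
Let ce2 := cinf_continuous cinf_w_e2.

Let odd_dot f h : continuous f -> continuous h ->
  (forall t, f (- t) * h (- t) = - (f t * h t)) -> dot f h = 0.
Proof. by move=> cf ch e; apply: int11_odd => //; exact: continuousMR. Qed.

Let par := (@mulrN R, chi_even, chi'_odd, @cosN R, @sinN R).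

Lemma dot_pq : dot w_p w_q = 0.
Proof. by apply: odd_dot => // t; rewrite /w_p /w_q !par; ring. Qed.
Lemma dot_pe1 : dot w_p w_e1 = 0.
Proof. by apply: odd_dot => // t; rewrite /w_p /w_e1 !par; ring. Qed.
Lemma dot_qe2 : dot w_q w_e2 = 0.
Proof. by apply: odd_dot => // t; rewrite /w_q /w_e2 !par; ring. Qed.
Lemma dot_e1e2 : dot w_e1 w_e2 = 0.
Proof. by apply: odd_dot => // t; rewrite /w_e1 /w_e2 !par; ring. Qed.

Lemma w_p1 (t : R) : t = 1 \/ t = -1 -> w_p t = 0.
Proof.
move=> ht; rewrite /w_p; have -> : chi t = 0; last by rewrite mul0r.
apply/eqP/negPn/negP => /chi_supp; case: ht => ->; rewrite ltxx ?andbF//.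
Qed.

(** Integration by parts for w_p * w_q.  It implies that w_p and w_q, once
    normalised, have the same frequency in the expansion of their derivatives. *)
Lemma dot_ibp : dot w_e1 w_q + dot w_e2 w_p = k * dot w_q w_q - k * dot w_p w_p.
Proof.
have d t : is_derive t (1 : R) (fun t => w_p t * w_q t)
    ((w_e1 t * w_q t + w_e2 t * w_p t) + k * (w_p t * w_p t - w_q t * w_q t)).
  apply: is_derive_eq (is_deriveM (is_derive_w_p t) (is_derive_w_q t)) _.
  by rewrite /GRing.scale /=; ring.
have c : continuous (fun t => (w_e1 t * w_q t + w_e2 t * w_p t) + k * (w_p t * w_p t - w_q t * w_q t)).
  apply: cinf_continuous; apply: cinf_of_derive d; exact: cinfM cinf_w_p cinf_w_q.
have := int11_derive c d; rewrite !w_p1 ?mul0r; [|by right|by left]; move=> /(_ erefl erefl).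
rewrite int11_D; last 2 first.
- by move=> t; apply: cvgD; apply: cvgM; [exact: ce1|exact: cq|exact: ce2|exact: cp].
- move=> t; apply: cvgM; [exact: cvg_cst|apply: cvgB; apply: cvgM]; [exact: cp|exact: cp|exact: cq|exact: cq].
rewrite int11_D; [|exact: continuousMR..].
rewrite int11_Z; last by move=> t; apply: cvgB; apply: cvgM; [exact: cp|exact: cp|exact: cq|exact: cq].
have -> : (fun t => w_p t * w_p t - w_q t * w_q t) = (fun t => w_p t * w_p t + -1 * (w_q t * w_q t)).
  by apply/funext => t; ring.
rewrite int11_D; [|exact: continuousMR|by apply: continuousMR; [exact: cst_continuous|exact: continuousMR]].
rewrite int11_Z; last exact: continuousMR.
rewrite -![int11 (fun t => _ * _)]/(dot _ _); lra.
Qed.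

Lemma dot_sum f (u v : R -> R) : continuous f -> continuous u -> continuous v ->
  (forall t, u t = f t * cos (k * t)) -> (forall t, v t = f t * sin (k * t)) ->
  dot u u + dot v v = dot f f.
Proof.
move=> cf cu cv hu hv; rewrite /dot -int11_D; [|exact: continuousMR..].
congr int11; apply/funext => t; rewrite hu hv.
have := cos2Dsin2 (k * t); set C := cos _; set S := sin _ => h.
have -> : f t * C * (f t * C) + f t * S * (f t * S) = f t * f t * (C ^+ 2 + S ^+ 2) by ring.
by rewrite h mulr1.
Qed.

End Modulated.

Definition I0 : R := dot chi chi.
Definition I1 : R := dot chi' chi'.

Lemma I0_gt0 : 0 < I0.
Proof.
have c := cinf_continuous cinf_chi.
apply: (@int11_gt0 _ _ 0); first exact: continuousMR.
- by move=> t; rewrite -expr2 sqr_ge0.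
- by lra.
- by rewrite mulr_gt0// chi_gt0//; lra.
Qed.

(** The first component of an index distinguishes the residuals (true) from the
    waves (false), the second the sine (true) from the cosine (false).

    The waves are p = chi cos (k .) / P and q = chi sin (k .) / Q.  Let c be the
    coefficient of p in q'; by dot_ibp, - c is the one of q in p'.  So the
    residuals p' + c q and q' - c p are orthogonal to q and p respectively, and
    parity gives all the other orthogonality relations.  The norms rho of the
    residuals stay bounded when k grows, whereas c grows like k.  The residuals do
    not vanish identically, as their values at pi / k and pi / (2 k) show, and can
    be normalised. *)
Lemma wave_pair (e : R) : 0 < e ->
  exists (w : bool * bool -> R -> R) (c : R) (rho : bool -> R),
  [/\ 0 < c, forall b, 0 < rho b <= e * c,
      forall i, cinf (w i) /\ forall t, w i t != 0 -> -1 < t < 1,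
      forall i j, dot (w i) (w j) = (i == j)%:R &
      forall t : R,
        is_derive t (1 : R) (w (false, false)) (- c * w (false, true) t + rho false * w (true, false) t) /\
        is_derive t (1 : R) (w (false, true)) (c * w (false, false) t + rho true * w (true, true) t)].
Proof.
move=> e0.
have I00 := I0_gt0; have I10 : 0 <= I1 := dot_ge0 chi'.
set M := I0 + I1; have M0 : 0 <= M by apply: addr_ge0 => //; exact: ltW.
have Ie : 0 < I0 * e ^+ 2 by rewrite mulr_gt0// exprn_gt0.
(* The three lower bounds on k give, in this order, norms of the waves bounded
   away from 0, residuals of size at most e * c, and points pi / k and
   pi / (2 k) inside the support. *)
have [k [k1 kM kI kpi]] : exists k : R, [/\ 0 < k, 4 * M <= k * I0, 16 * I1 <= k * (I0 * e ^+ 2) & pi < k].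
  exists (pi + 1 + 4 * M / I0 + 16 * I1 / (I0 * e ^+ 2)).
  have x0 : 0 <= 4 * M / I0 by rewrite divr_ge0 ?mulr_ge0// ltW.
  have y0 : 0 <= 16 * I1 / (I0 * e ^+ 2) by rewrite divr_ge0 ?mulr_ge0// ltW.
  have p0 := pi_gt0 R.
  have xE : 4 * M / I0 * I0 = 4 * M by rewrite divfK// gt_eqF.
  have yE : 16 * I1 / (I0 * e ^+ 2) * (I0 * e ^+ 2) = 16 * I1 by rewrite divfK// gt_eqF.
  set x := 4 * M / I0 in x0 xE *; set y := 16 * I1 / _ in y0 yE *.
  split; [lra| | |lra].
    by rewrite -xE ler_pM2r//; lra.
  by rewrite -yE ler_pM2r//; lra.
have cchi := cinf_continuous cinf_chi; have cchi' := cinf_continuous cinf_chi'.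
have cp := cinf_continuous (cinf_w_p k); have cq := cinf_continuous (cinf_w_q k).
have ce1 := cinf_continuous (cinf_w_e1 k); have ce2 := cinf_continuous (cinf_w_e2 k).
have AB : dot (w_p k) (w_p k) + dot (w_q k) (w_q k) = I0 by apply: dot_sum.
have EE : dot (w_e1 k) (w_e1 k) + dot (w_e2 k) (w_e2 k) = I1 by apply: dot_sum.
have ibp := dot_ibp k.
have := dot_le ce1 cq; have := dot_le ce2 cp; rewrite !ler_norml.
have A0 := dot_ge0 (w_p k); have B0 := dot_ge0 (w_q k).
have E10 := dot_ge0 (w_e1 k); have E20 := dot_ge0 (w_e2 k).
move: ibp; set A := dot (w_p k) (w_p k) in AB A0 *; set B := dot (w_q k) (w_q k) in AB B0 *.
set E1 := dot (w_e1 k) (w_e1 k) in EE E10 *; set E2 := dot (w_e2 k) (w_e2 k) in EE E20 *.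
set u := dot (w_e1 k) (w_q k); set v := dot (w_e2 k) (w_p k) => ibp /andP[v1 v2] /andP[u1 u2].
have k0 : 1 < k by have := pi_ge2 R; lra.
have ME : M = I0 + I1 by [].
have dAB : k * (A - B) >= - (k * (I0 / 8)) by rewrite mulrBr; lra.
have dBA : k * (B - A) >= - (k * (I0 / 8)) by rewrite mulrBr; lra.
have hA : I0 / 4 <= A by move: dAB; rewrite -mulrN ler_pM2l//; lra.
have hB : I0 / 4 <= B by move: dBA; rewrite -mulrN ler_pM2l//; lra.
have {}A0 : 0 < A by lra.
have {}B0 : 0 < B by lra.
set P := Num.sqrt A; set Q := Num.sqrt B.
have P0 : 0 < P by rewrite sqrtr_gt0.
have Q0 : 0 < Q by rewrite sqrtr_gt0.
have PA : A = P * P by rewrite -expr2 sqr_sqrtr// ltW.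
have QB : B = Q * Q by rewrite -expr2 sqr_sqrtr// ltW.
set c0 := k * A + v; have c0E : c0 = k * A + v by [].
have c0B : c0 = k * B - u by rewrite /c0; lra.
have hc0 : k * (I0 / 4) <= c0.
  have h1 : k * (I0 / 4) <= k * A by rewrite ler_pM2l.
  have h2 : k * (I0 / 4) <= k * B by rewrite ler_pM2l.
  have : 2 * c0 = k * I0 + v - u by rewrite -AB; lra.
  lra.
pose c := c0 / (P * Q).
have PQ : 0 < P * Q by rewrite mulr_gt0.
have hc : k / 2 <= c.
  rewrite /c ler_pdivlMr//; apply: le_trans hc0.
  have : P * Q <= I0 / 2 by have := sqr_ge0 (P - Q); rewrite -AB PA QB; lra.
  move=> h; apply: (@le_trans _ _ (k / 2 * (I0 / 2))); last lra.
  by rewrite ler_wpM2l// divr_ge0// ltW.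
have {}c1 : 0 < c by lra.
(* The coefficients of w_q in p' + c q and of w_p in q' - c p; H1 and H2 express
   the orthogonality of these residuals to q and p. *)
pose al := c / Q - k / P; pose be := k / Q - c / P.
have Pn : P != 0 by rewrite gt_eqF.
have Qn : Q != 0 by rewrite gt_eqF.
have H1 : P^-1 * u + al * B = 0.
  have -> : u = k * B - c0 by lra.
  by rewrite /al /c QB; field; rewrite Pn Qn.
have H2 : Q^-1 * v + be * A = 0.
  have -> : v = c0 - k * A by rewrite /c0; lra.
  by rewrite /be /c PA; field; rewrite Pn Qn.
pose f (i : bool * bool) := match i with
  (false, false) => w_p k | (false, true) => w_q k
  | (true, false) => w_e1 k | (true, true) => w_e2 k end.
pose h (i : bool * bool) := match i with
  (false, false) => w_q k | (false, true) => w_p k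
  | (true, false) => w_q k | (true, true) => w_p k end.
pose X (i : bool * bool) := match i with
  (false, false) => P^-1 | (false, true) => Q^-1
  | (true, false) => P^-1 | (true, true) => Q^-1 end.
pose Y (i : bool * bool) := match i with
  (false, _) => 0 | (true, false) => al | (true, true) => be end.
pose W i t := X i * f i t + Y i * h i t.
have cif i : cinf (f i) by case: i => [[] []]; [exact: cinf_w_e2|exact: cinf_w_e1|exact: cinf_w_q|exact: cinf_w_p].
have cih i : cinf (h i) by case: i => [[] []]; [exact: cinf_w_p|exact: cinf_w_q|exact: cinf_w_p|exact: cinf_w_q].
have ciW i : cinf (W i) by apply: cinfD; exact: cinfZ.
have suppW i t : W i t != 0 -> -1 < t < 1.
  move=> Wn; apply/negPn/negP => tn; move/negP: Wn; apply; apply/eqP.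
  have x0 : chi t = 0 by apply/eqP/negPn/negP => /chi_supp; exact/negP.
  have x1 : chi' t = 0 by apply/eqP/negPn/negP => /chi'_supp; exact/negP.
  by rewrite /W; case: i => [[] []]; rewrite /= /w_p /w_q /w_e1 /w_e2 x0 ?x1 !mul0r !mulr0 addr0.
have dW i j : dot (W i) (W j) = X i * X j * dot (f i) (f j) + X i * Y j * dot (f i) (h j) +
   Y i * X j * dot (h i) (f j) + Y i * Y j * dot (h i) (h j).
  by apply: dot_comb2; exact: cinf_continuous.
have tab := (dot_pq k, dot_pe1 k, dot_qe2 k, dot_e1e2 k, etrans (dotC _ _) (dot_pq k),
  etrans (dotC _ _) (dot_pe1 k), etrans (dotC _ _) (dot_qe2 k), etrans (dotC _ _) (dot_e1e2 k),
  dotC (w_q k) (w_e1 k), dotC (w_p k) (w_e2 k)).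
pose N1 := dot (W (true, false)) (W (true, false)).
pose N2 := dot (W (true, true)) (W (true, true)).
have N1E : N1 = E1 / A + P^-1 * al * u.
  rewrite /N1 dW /= !tab -/u -/E1 -/B.
  have -> : P^-1 * P^-1 * E1 + P^-1 * al * u + al * P^-1 * u + al * al * B =
    P^-1 * P^-1 * E1 + P^-1 * al * u + al * (P^-1 * u + al * B) by ring.
  by rewrite H1 mulr0 addr0 PA; congr (_ + _); field.
have N2E : N2 = E2 / B + Q^-1 * be * v.
  rewrite /N2 dW /= !tab -/v -/E2 -/A.
  have -> : Q^-1 * Q^-1 * E2 + Q^-1 * be * v + be * Q^-1 * v + be * be * A =
    Q^-1 * Q^-1 * E2 + Q^-1 * be * v + be * (Q^-1 * v + be * A) by ring.
  by rewrite H2 mulr0 addr0 QB; congr (_ + _); field.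
(* Orthogonality makes the contribution of al and be to the norms negative. *)
have bnd E G x (E0 : 0 <= E) (EI : E <= I1) (G0 : 0 < G) (GI : I0 / 4 <= G) (x0 : x <= 0) :
    E / G + x <= (e * c) ^+ 2.
  apply: (@le_trans _ _ (E / G)); first by rewrite gerDl.
  apply: (@le_trans _ _ (I1 / (I0 / 4))).
    apply: ler_pM => //; first by rewrite invr_ge0 ltW.
    by rewrite lef_pV2// posrE// divr_gt0.
  rewrite ler_pdivrMr ?divr_gt0// exprMn.
  have kc : k <= 4 * c ^+ 2.
    have h3 : 0 <= (c - k / 2) * (c + k / 2) by apply: mulr_ge0; lra.
    have h4 : k <= k * k by rewrite ler_pMl// ltW.
    have e4 : (c - k / 2) * (c + k / 2) * 4 = 4 * c ^+ 2 - k * k by field.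
    lra.
  have := ler_wpM2r (ltW Ie) kc => h3.
  suff : 16 * I1 <= e ^+ 2 * c ^+ 2 * (I0 / 4) * 16 by lra.
  apply: le_trans kI _; apply: le_trans h3 _; rewrite le_eqVlt; apply/orP; left; apply/eqP.
  by field.
have N1le : N1 <= (e * c) ^+ 2.
  rewrite N1E; apply: bnd => //; first by lra.
  have -> : P^-1 * al * u = - (al ^+ 2 * B).
    have -> : P^-1 * al * u = al * (P^-1 * u + al * B) - al ^+ 2 * B by ring.
    by rewrite H1 mulr0 sub0r.
  by rewrite oppr_le0 mulr_ge0 ?sqr_ge0// ltW.
have N2le : N2 <= (e * c) ^+ 2.
  rewrite N2E; apply: bnd => //; first by lra.
  have -> : Q^-1 * be * v = - (be ^+ 2 * A).
    have -> : Q^-1 * be * v = be * (Q^-1 * v + be * A) - be ^+ 2 * A by ring.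
    by rewrite H2 mulr0 sub0r.
  by rewrite oppr_le0 mulr_ge0 ?sqr_ge0// ltW.
have Npos i t0 : 0 < t0 < 1 -> W i t0 != 0 -> 0 < dot (W i) (W i).
  move=> /andP[t0a t0b] Wn; apply: (@int11_gt0 _ _ t0).
  - by apply: continuousMR; exact: cinf_continuous.
  - by move=> t; rewrite -expr2 sqr_ge0.
  - by rewrite t0b andbT; lra.
  - by rewrite -expr2 exprn_even_gt0.
have pik : 0 < pi / k < 1 by rewrite divr_gt0 ?pi_gt0// ltr_pdivrMr// mul1r.
have N10 : 0 < N1.
  apply: (Npos _ (pi / k)) => //; rewrite /W /= /w_q /w_e1.
  have -> : k * (pi / k) = pi by rewrite mulrC divfK// gt_eqF.
  rewrite sinpi cospi !mulr0 addr0 mulf_neq0 ?invr_eq0// mulrN1 oppr_eq0.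
  exact: chi'_neq0.
have pik2 : 0 < pi / 2 / k < 1.
  by rewrite !divr_gt0 ?pi_gt0//= ltr_pdivrMr// mul1r; have := pi_gt0 R; lra.
have N20 : 0 < N2.
  apply: (Npos _ (pi / 2 / k)) => //; rewrite /W /= /w_p /w_e2.
  have -> : k * (pi / 2 / k) = pi / 2 by rewrite mulrC divfK// gt_eqF.
  rewrite sin_pihalf cos_pihalf !mulr0 addr0 mulr1 mulf_neq0 ?invr_eq0//.
  exact: chi'_neq0.
pose rho (b : bool) := Num.sqrt (if b then N2 else N1).
have rho0 b : 0 < rho b by rewrite sqrtr_gt0; case: b.
have rhoN b : rho b * rho b = if b then N2 else N1.
  by rewrite -expr2 sqr_sqrtr//; case: b; rewrite ltW.
pose Z (i : bool * bool) := if i.1 then (rho i.2)^-1 else 1.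
exists (fun i t => Z i * W i t), c, rho; split; first exact: c1.
- move=> b; rewrite rho0 /=.
  have ec : 0 <= e * c by apply: mulr_ge0; exact: ltW.
  rewrite -(ger0_norm ec) -sqrtr_sqr; apply: ler_wsqrtr.
  by case: b.
- move=> i; split; first exact: cinfZ.
  by move=> t; rewrite mulf_eq0 negb_or => /andP[_]; exact: suppW.
- have ZE i j : dot (fun t => Z i * W i t) (fun t => Z j * W j t) = Z i * Z j * dot (W i) (W j).
    have := dot_comb2 (Z i) 0 (Z j) 0 (cinf_continuous (ciW i)) (cinf_continuous (ciW i))
      (cinf_continuous (ciW j)) (cinf_continuous (ciW j)).
    rewrite !mulr0 !mul0r !addr0 => <-; congr dot; apply/funext => t; by rewrite mul0r addr0.
  have W00 : dot (W (false, false)) (W (false, false)) = 1.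
    by rewrite dW /= -/A PA; field.
  have W11 : dot (W (false, true)) (W (false, true)) = 1.
    by rewrite dW /= -/B QB; field.
  have W01 : dot (W (false, false)) (W (false, true)) = 0.
    by rewrite dW /= !tab !(mulr0, mul0r, addr0).
  have W02 : dot (W (false, false)) (W (true, false)) = 0.
    by rewrite dW /= !tab !(mulr0, mul0r, addr0).
  have W13 : dot (W (false, true)) (W (true, true)) = 0.
    by rewrite dW /= !tab !(mulr0, mul0r, addr0).
  have W12 : dot (W (false, true)) (W (true, false)) = 0.
    rewrite dW /= !tab -/u -/B !(mulr0, mul0r, addr0) -mulrA -mulrA -mulrDr.
    by rewrite H1 mulr0.
  have W03 : dot (W (false, false)) (W (true, true)) = 0.
    rewrite dW /= !tab -/v -/A !(mulr0, mul0r, addr0) -mulrA -mulrA -mulrDr.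
    by rewrite H2 mulr0.
  have W23 : dot (W (true, false)) (W (true, true)) = 0.
    by rewrite dW /= !tab !(mulr0, mul0r, addr0).
  have S i j : dot (W i) (W j) = 0 -> dot (W j) (W i) = 0 by rewrite dotC.
  move=> [[] []] [[] []]; rewrite ZE /Z /= ?W00 ?W11 ?W01 ?W02 ?W13 ?W12 ?W03 ?W23
    ?(S _ _ W01) ?(S _ _ W02) ?(S _ _ W13) ?(S _ _ W12) ?(S _ _ W03) ?(S _ _ W23) ?mulr0 ?mulr1 //.
  + by rewrite -/N2 -(rhoN true); field; rewrite gt_eqF.
  + by rewrite -/N1 -(rhoN false); field; rewrite gt_eqF.
- move=> t; rewrite /Z /=; split.
  + have -> : (fun t => 1 * W (false, false) t) = (fun t => P^-1 * w_p k t).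
      by apply/funext => x; rewrite /W /= mul0r addr0 mul1r.
    apply: is_derive_eq (is_deriveZ P^-1 (is_derive_w_p k t)) _.
    rewrite mulVKf ?gt_eqF// /W /= /al /GRing.scale /=; ring.
  + have -> : (fun t => 1 * W (false, true) t) = (fun t => Q^-1 * w_q k t).
      by apply/funext => x; rewrite /W /= mul0r addr0 mul1r.
    apply: is_derive_eq (is_deriveZ Q^-1 (is_derive_w_q k t)) _.
    rewrite mulVKf ?gt_eqF// /W /= /be /GRing.scale /=; ring.
Qed.

End Wave.

(** * Wave packets *)

Section Packet.
Context {R : realType}.
Local Notation mu := (@lebesgue_measure R).
Implicit Types f h : R -> R.

Lemma derive_lipschitz f f' (a b : R) : a <= b -> (forall t : R, is_derive t (1 : R) f (f' t)) ->
  continuous f' -> exists2 L, 0 <= L &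
  forall s t, a <= s <= b -> a <= t <= b -> `|f s - f t| <= L * `|s - t|.
Proof.
move=> ab df cf'.
have [c _ hc] : exists2 c, c \in `[a, b] & forall t, t \in `[a, b] -> `|f' t| <= `|f' c|.
  apply: (@EVT_max _ (fun t => `|f' t|)) => //.
  by apply: continuous_subspaceT => t; apply: cvg_norm; exact: cf'.
exists `|f' c| => //.
have cf : continuous f by move=> t; exact: is_derive_continuous (df t).
have le s t : a <= s <= b -> a <= t <= b -> s <= t -> `|f s - f t| <= `|f' c| * `|s - t|.
  move=> /andP[as_ sb] /andP[at_ tb] st.
  have [|d] := @MVT_segment _ f f' s t st (fun x _ => df x).
    by apply: continuous_subspaceT => x; exact: cf.
  rewrite in_itv /= => /andP[ds dt] e.
  rewrite distrC (distrC s) e normrM ler_wpM2r//; apply: hc.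
  by rewrite in_itv /= (le_trans as_ ds) (le_trans dt tb).
move=> s t hs ht; case: (leP s t) => st; first exact: le.
by rewrite distrC (distrC s); apply: le => //; exact: ltW.
Qed.

Lemma cinf_tame f (a b : R) : 0 <= a -> cinf f -> (forall t, f t != 0 -> a < t < b) -> tame f.
Proof.
move=> a0 cf sf; have [f' cf' df] := cinf_derive cf.
have [ab|ba] := leP a b; last first.
  exists 0, 0; split => // [s t|t]; last by move/sf; lra.
  suff f0 u : f u = 0 by rewrite !f0 subrr normr0 mul0r.
  by apply/eqP/negPn/negP => /sf; lra.
have [L L0 hL] := derive_lipschitz ab df (cinf_continuous cf').
have fa : f a = 0 by apply/eqP/negPn/negP => /sf; rewrite ltxx.
have fb : f b = 0 by apply/eqP/negPn/negP => /sf; rewrite ltxx andbF.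
have le s t : s <= t -> `|f s - f t| <= L * `|s - t|.
  move=> st.
  have [fs|/sf /andP[as_ sb]] := eqVneq (f s) 0.
    have [->|/sf /andP[at_ tb]] := eqVneq (f t) 0.
      by rewrite fs subrr normr0 mulr_ge0.
    have [sa|sa] := leP a s.
      by apply: hL; [rewrite sa (le_trans st (ltW tb))|rewrite !ltW].
    rewrite fs -fa; apply: le_trans (hL _ _ _ _) _; [by rewrite lexx|by rewrite !ltW|].
    rewrite ler_wpM2l// !ler0_norm ?subr_le0 ?(ltW at_)//.
    by rewrite lerN2 lerD2r ltW.
  have [tb|tb] := leP t b.
    by apply: hL; [rewrite !ltW|rewrite tb (le_trans (ltW as_) st)].
  have -> : f t = 0 by apply/eqP/negPn/negP => /sf; rewrite [t < b]ltNge (ltW tb) andbF.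
  rewrite -fb; apply: le_trans (hL _ _ _ _) _; [by rewrite !ltW|by rewrite lexx andbT|].
  rewrite ler_wpM2l// !ler0_norm ?subr_le0 ?(ltW sb)//.
  by rewrite lerN2 lerD2l lerN2 ltW.
exists L, b; split => // [s t|t].
  by case: (leP s t) => st; [exact: le|rewrite distrC (distrC s); apply: le; exact: ltW].
by move/sf => /andP[u v]; apply/andP; split; [apply: le_trans a0 _|]; exact: ltW.
Qed.

Variables (w : bool * bool -> R -> R) (c : R) (rho : bool -> R).
Hypothesis cw : forall i, cinf (w i).
Hypothesis sw : forall i t, w i t != 0 -> -1 < t < 1.
Hypothesis dw : forall i j, dot (w i) (w j) = (i == j)%:R.
Hypothesis derw : forall t : R,
  is_derive t (1 : R) (w (false, false)) (- c * w (false, true) t + rho false * w (true, false) t) /\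
  is_derive t (1 : R) (w (false, true)) (c * w (false, false) t + rho true * w (true, true) t).

Variables (s tau : R).
Hypothesis s0 : s != 0.
Hypothesis stau : `|s|^-1 <= tau.

(** The wave pair at frequency s, centred at tau and normalised in L^2; a negative
    frequency reverses time. *)
Definition packet i t := Num.sqrt `|s| * w i (s * t + - (s * tau)).

Lemma packet_supp i t : packet i t != 0 -> tau - `|s|^-1 < t < tau + `|s|^-1.
Proof.
rewrite mulf_eq0 negb_or => /andP[_ /sw].
have ns : 0 < `|s| by rewrite normr_gt0.
rewrite -mulrBr -ltr_norml normrM -ltr_pdivlMl// mulr1 ltr_norml => /andP[u v].
by apply/andP; split; lra.
Qed.

Lemma packet_cinf i : cinf (packet i).
Proof. by apply: cinfZ; apply: cinf_affine. Qed.

Lemma packet_tame i : tame (packet i).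
Proof.
apply: (cinf_tame (a := tau - `|s|^-1) (b := tau + `|s|^-1)).
- by rewrite subr_ge0.
- exact: packet_cinf.
- exact: packet_supp.
Qed.

Lemma packet_ip i j : ip (packet i) (packet j) = (i == j)%:R.
Proof.
have cc : continuous (fun t => w i t * w j t).
  by apply: continuousMR; exact: cinf_continuous.
rewrite /ip -dw /dot.
have := @int11_subst _ (fun t => w i t * w j t) s tau cc _ s0 stau.
have ns : `|s| != 0 by rewrite normr_eq0.
have -> : (fun t => packet i t * packet j t) =
    (fun t => `|s| * (w i (s * t + - (s * tau)) * w j (s * t + - (s * tau)))).
  by apply/funext => t; rewrite /packet mulrACA -expr2 sqr_sqrtr.
rewrite RintegralZl//; last first.
  have := tame_integrable (tameZ `|s|^-1 (tameM (packet_tame i) (packet_tame j))) (measurable_itv `[0, +oo[).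
  rewrite (_ : EFin \o _ = EFin \o (fun t => w i (s * t + - (s * tau)) * w j (s * t + - (s * tau))))//.
  apply/funext => t /=; congr EFin; rewrite /packet mulrACA -expr2 sqr_sqrtr//.
  by rewrite mulKf.
move=> ->; first by rewrite mulrA divff// mul1r.
by move=> t; rewrite mulf_eq0 negb_or => /andP[/sw].
Qed.

Lemma packet_derive (t : R) :
  is_derive t (1 : R) (packet (false, false))
    (- (c * s) * packet (false, true) t + (s * rho false) * packet (true, false) t) /\
  is_derive t (1 : R) (packet (false, true))
    ((c * s) * packet (false, false) t + (s * rho true) * packet (true, true) t).
Proof.
have [d1 d2] := derw (s * t + - (s * tau)); split.
- have d := is_derive1_comp (g := fun x => s * x + - (s * tau)) d1 (is_derive_affine s (- (s * tau)) t).
  by apply: is_derive_eq (is_deriveZ (Num.sqrt `|s|) d) _; rewrite /GRing.scale /= /packet; ring.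
- have d := is_derive1_comp (g := fun x => s * x + - (s * tau)) d2 (is_derive_affine s (- (s * tau)) t).
  by apply: is_derive_eq (is_deriveZ (Num.sqrt `|s|) d) _; rewrite /GRing.scale /= /packet; ring.
Qed.

End Packet.

(** * Explicit solutions of u' + A u = f *)

Section BochnerFTC.
Context {R : realType} {X : normedModType R}.
Local Notation mu := (@lebesgue_measure R).

Lemma measure_itv_cell (t : R) k j : 0 <= t ->
  fine (mu (`[0, t]%classic `&` cell (R := R) k j)) =
  Num.min t (j.+1%:R / k.+1%:R) - Num.min t (j%:R / k.+1%:R).
Proof.
move=> t0; set h := j%:R / k.+1%:R; set h' := j.+1%:R / k.+1%:R.
have h0 : 0 <= h by rewrite divr_ge0.
have hh : h < h' by rewrite /h /h' ltr_pM2r ?invr_gt0 ?ltr0n// ltr_nat.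
have [th'|th'] := leP h' t.
  have -> : `[0, t]%classic `&` cell k j = `[h, h'[%classic.
    apply/seteqP; split => [x [] //|x hx]; split => //.
    move: hx; rewrite /= !in_itv /= => /andP[a b]; rewrite (le_trans h0 a) /=.
    by rewrite ltW// (lt_le_trans b).
  rewrite lebesgue_measure_itv /= lte_fin hh /=.
  by rewrite (min_idPr (ltW (lt_le_trans hh th'))).
have [th|th] := leP h t.
  have -> : `[0, t]%classic `&` cell k j = `[h, t]%classic.
    apply/seteqP; split => x; rewrite /cell /= !in_itv /=.
      by move=> [/andP[_ xt] /andP[hx _]]; rewrite hx xt.
    by move=> /andP[a b]; rewrite (le_trans h0 a) b a (le_lt_trans b th').
  rewrite lebesgue_measure_itv /= lte_fin.
  by case: ltgtP th => // [-> _]; rewrite subrr.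
have -> : `[0, t]%classic `&` cell k j = set0.
  apply/seteqP; split => x //; rewrite /cell /= !in_itv /= => -[/andP[_ a] /andP[b _]].
  by have := lt_le_trans (le_lt_trans a th) b; rewrite ltxx.
by rewrite measure0 subrr.
Qed.

(** The hypotheses say that v has the derivative w, uniformly and from the right
    only, because the semigroup is defined for nonnegative times. *)
Lemma bochner_FTC (v w : R -> X) (t : R) : 0 <= t ->
  (forall e, 0 < e -> exists2 dl : R, 0 < dl & forall a b, 0 <= a -> a <= b -> b <= t ->
     b - a < dl -> `|v b - v a - (b - a) *: w a| <= e * (b - a)) ->
  (forall e, 0 < e -> exists2 dl : R, 0 < dl & forall a b, 0 <= a -> a <= b -> b <= t ->
     b - a < dl -> `|w b - w a| <= e) ->
  bochner_integral `[0, t]%classic w = v t - v 0.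
Proof.
move=> t0 hv hw.
have F0 : `[0, t]%classic `<=` [set s : R | 0 <= s].
  by move=> s; rewrite /= in_itv /= => /andP[].
have Ft s : `[0, t]%classic s -> s <= t by rewrite /= in_itv /= => /andP[].
pose F : set R := `[0, t]%classic.
have Foo : (mu F < +oo)%E.
  by rewrite lebesgue_measure_itv /=; case: ifP => _; rewrite -?EFinB ltry.
have mF : measurable F by exact: measurable_itv.
apply: (bochner_of_uniform mF Foo _ _).2.
  apply: (grid_uniform (b := t)) => // [s /Ft st|e e0]; first by left.
  have [dl dl0 h] := hw e e0; exists dl => // s s' s0 /Ft s't ss' d; exact: h.
apply/cvgrPdist_le => e e0.
have e'0 : 0 < e / (t + 1) by rewrite divr_gt0// ltr_wpDl.
have [dl dl0 hd] := hv _ e'0.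
near=> k.
have kt : t < k.+1%:R.
  by near: k; near=> k; apply: lt_trans (_ : k%:R < _); [near: k; exact: nbhs_infty_gtr|rewrite ltr_nat].
have kd : k.+1%:R^-1 < dl by near: k; exact: near_infty_natSinv_lt (PosNum dl0).
pose a j := Num.min t (j%:R / k.+1%:R).
pose N := (k.+1 ^ 2)%N.
have a0 : a 0%N = 0 by rewrite /a mul0r; apply/min_idPr.
have aN : a N = t.
  rewrite /a; apply/min_idPl; rewrite /N natrX expr2 mulfK ?pnatr_eq0//.
  exact: ltW.
have aS j : a j <= a j.+1.
  rewrite /a le_min ge_min lexx /= ge_min; apply/orP; right.
  by rewrite ler_pM2r ?invr_gt0 ?ltr0n// ler_nat.
have -> : v t - v 0 = \sum_(j < N) (v (a j.+1) - v (a j)).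
  rewrite -(big_mkord xpredT (fun j => v (a j.+1) - v (a j))) telescope_sumr//.
  by rewrite aN a0.
rewrite /step_integral -sumrB.
apply: (@le_trans _ _ (\sum_(j < N) e / (t + 1) * (a j.+1 - a j))).
  apply: le_trans (ler_norm_sum _ _ _) _; apply: ler_sum => j _.
  rewrite measure_itv_cell// -/(a j) -/(a j.+1).
  have [jt|jt] := leP (j%:R / k.+1%:R) t.
    have aj : a j = j%:R / k.+1%:R by rewrite /a; apply/min_idPr.
    rewrite /= -aj; apply: hd => //.
    - by rewrite aj divr_ge0.
    - by rewrite /a ge_min lexx.
    - apply: le_lt_trans kd; rewrite aj lerBlDr /a ge_min; apply/orP; right.
      by rewrite -{2}(mul1r (k.+1%:R^-1)) -mulrDl -natr1 addrC.
  have aj : a j = t by rewrite /a; apply/min_idPl/ltW.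
  have aj1 : a j.+1 = t.
    by apply/eqP; rewrite eq_le {1}/a ge_min lexx /= -{1}aj.
  by rewrite aj aj1 !subrr scale0r subr0 normr0 mulr0.
rewrite -mulr_sumr -(big_mkord xpredT (fun j => a j.+1 - a j)) telescope_sumr// aN a0 subr0.
by rewrite mulrAC ler_pdivrMr ?ltr_wpDl// ler_pM2l// lerDl.
Unshelve. all: by end_near. Qed.

End BochnerFTC.

(** The bookkeeping behind the product rule for phi(s) S(t - s) x. *)
Lemma defect_split (R : pzRingType) (V : lmodType R) (a b h c : R) (x y z q : V) :
  b * h = h * b ->
  a *: x - b *: y - h *: (c *: y + b *: q) =
  (a - b - h * c) *: x + b *: (x - y - h *: z) + (h * c) *: (x - y) + (h * b) *: (z - q).
Proof.
move=> bh; rewrite !scalerBl !scalerBr scalerDr !scalerA bh.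
move: (a *: x) (b *: x) (b *: y) (h * c *: y) (h * b *: q) (h * c *: x) (h * b *: z) => U P Y W V' Q Z.
have cancel (u v t : V) : u - v + (v + t) = u + t by rewrite addrA subrK.
rewrite [U - P - Q]addrAC -(addrA P) cancel.
have -> : U - Q + (- Y - Z) = U - Y - Z - Q by rewrite !addrA -!(addrAC _ (- Q)).
by rewrite cancel [X in _ = X + _]addrAC cancel opprD addrA.
Qed.

Lemma increment_split (R : pzRingType) (V : lmodType R) (a b a' b' : R) (x y z q : V) :
  (a *: x + b *: z) - (a' *: y + b' *: q) =
  (a - a') *: x + (b - b') *: z + a' *: (x - y) + b' *: (z - q).
Proof.
rewrite !scalerBl !scalerBr.
move: (a *: x) (a' *: x) (b *: z) (b' *: z) (a' *: y) (b' *: q) => U P Y Q W V'.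
have cancel (u v t : V) : u - v + (v + t) = u + t by rewrite addrA subrK.
by rewrite [X in _ = X + _]addrAC (cancel U P (- W)) -[RHS]addrA (cancel Y Q (- V')) addrACA opprD.
Qed.

Lemma norm_sum4 (R : numDomainType) (V : normedZmodType R) (a b c e : V) (p q r s : R) :
  `|a| <= p -> `|b| <= q -> `|c| <= r -> `|e| <= s -> `|a + b + c + e| <= p + q + r + s.
Proof.
move=> ap bq cr es; apply: (le_trans (ler_normD _ _)); rewrite lerD//.
by apply: (le_trans (ler_normD _ _)); rewrite lerD//; apply: (le_trans (ler_normD _ _)); rewrite lerD.
Qed.

Section Convolution.
Context {R : realType} {X : normedModType R}.
Variables (A : linop X) (S : R -> X -> X).
Hypothesis hS : bounded_C0_semigroup S.
Hypothesis hAS : generated_by_opp A S.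
Variables (I : finType) (phi phi' : I -> R -> R) (x : I -> X).
Hypothesis tphi : forall i, tame (phi i).
Hypothesis tphi' : forall i, tame (phi' i).
Hypothesis dphi : forall i (t : R), is_derive t (1 : R) (phi i) (phi' i t).
Hypothesis phi0 : forall i, phi i 0 = 0.
Hypothesis dx : forall i, dom A (x i).

Lemma generator_near y : dom A y -> forall e, 0 < e ->
  \forall h \near 0^'+, `|y - S h y - h *: A y| <= e * h.
Proof.
move=> dy e e0; have [+ _] := hAS y (- A y) => /(_ (conj dy erefl)).
move=> /cvgrPdist_le /(_ e e0) H; near=> h.
have h0 : 0 < h by near: h; exact: nbhs_right_gt.
have Hh : `|- A y - h^-1 *: (S h y - y)| <= e by near: h.
have -> : y - S h y - h *: A y = h *: (- A y - h^-1 *: (S h y - y)).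
  rewrite scalerBr scalerA divff ?gt_eqF// scale1r opprB scalerN addrC.
  by [].
by rewrite normrZ gtr0_norm// mulrC ler_wpM2r// ltW.
Unshelve. all: by end_near. Qed.

Lemma strong_continuity_near y e : 0 < e -> \forall h \near 0^'+, `|y - S h y| <= e.
Proof. by have [_ _ _ _ c] := hS; have /cvgrPdist_le := c y; apply. Qed.

Let defect i (a h : R) : X := phi i (a + h) *: x i - phi i a *: S h (x i) -
  h *: (phi' i a *: S h (x i) + phi i a *: S h (A (x i))).

Lemma defect_near i e : 0 < e -> \forall h \near 0^'+, forall a, `|defect i a h| <= e * h.
Proof.
move=> e0.
have [K [K0 hK]] := tame_bounded (tphi i); have [K' [K'0 hK']] := tame_bounded (tphi' i).
have [L [_ [L0 hL _]]] := tphi' i.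
pose c := L * `|x i| + K + K + K' + 1.
have c0 : 0 < c by rewrite ltr_wpDl// !addr_ge0// mulr_ge0.
have ec : 0 < e / c by rewrite divr_gt0.
near=> h => a.
have h0 : 0 < h by near: h; exact: nbhs_right_gt.
have hec : h <= e / c by near: h; exact: nbhs_right_le.
have g1 : `|x i - S h (x i) - h *: A (x i)| <= e / c * h.
  by near: h; exact: generator_near.
have g2 : `|x i - S h (x i)| <= e / c by near: h; exact: strong_continuity_near.
have g3 : `|A (x i) - S h (A (x i))| <= e / c by near: h; exact: strong_continuity_near.
have d1 : `|phi i (a + h) - phi i a - h * phi' i a| <= L * (e / c) * h.
  have ah : a < a + h by rewrite ltrDl.
  have [|m] := @MVT _ (phi i) (phi' i) a (a + h) ah (fun u _ => dphi i u).
    by apply: continuous_subspaceT; exact: tame_continuous.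
  rewrite in_itv /= => /andP[am mb] ->; rewrite [a + h]addrC addrK.
  rewrite mulrC -mulrBr normrM (gtr0_norm h0) mulrC ler_wpM2r ?(ltW h0)//.
  apply: (le_trans (hL _ _)); apply: ler_wpM2l => //; rewrite gtr0_norm ?subr_gt0//.
  by apply: le_trans hec; rewrite lerBlDr addrC ltW.
have -> : defect i a h = (phi i (a + h) - phi i a - h * phi' i a) *: x i
    + phi i a *: (x i - S h (x i) - h *: A (x i))
    + (h * phi' i a) *: (x i - S h (x i))
    + (h * phi i a) *: (A (x i) - S h (A (x i))).
  by apply: defect_split; rewrite mulrC.
apply: (@le_trans _ _ (L * (e / c) * h * `|x i| + K * (e / c * h) + h * K' * (e / c) + h * K * (e / c))).
apply: norm_sum4.
  - by rewrite normrZ ler_wpM2r.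
  - by rewrite normrZ; apply: ler_pM.
  - rewrite normrZ normrM (gtr0_norm h0); apply: ler_pM => //; first by rewrite mulr_ge0// ltW.
    by rewrite ler_wpM2l// ltW.
  - rewrite normrZ normrM (gtr0_norm h0); apply: ler_pM => //; first by rewrite mulr_ge0// ltW.
    by rewrite ler_wpM2l// ltW.
have -> : L * (e / c) * h * `|x i| + K * (e / c * h) + h * K' * (e / c) + h * K * (e / c) =
   (L * `|x i| + K + K' + K) * (e / c * h) by ring.
have -> : e * h = c * (e / c * h) by rewrite mulrA [c * _]mulrC divfK// gt_eqF.
apply: ler_wpM2r; first by apply: mulr_ge0; exact: ltW.
rewrite /c; lra.
Unshelve. all: by end_near. Qed.

Let f (s : R) : X := \sum_i (phi' i s *: x i + phi i s *: A (x i)).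
Let u (s : R) : X := \sum_i phi i s *: x i.

Lemma f_increment_near i e : 0 < e -> \forall h \near 0^'+, forall a,
  `|(phi' i (a + h) *: x i + phi i (a + h) *: A (x i)) -
    (phi' i a *: S h (x i) + phi i a *: S h (A (x i)))| <= e.
Proof.
move=> e0.
have [K [K0 hK]] := tame_bounded (tphi i); have [K' [K'0 hK']] := tame_bounded (tphi' i).
have [L [_ [L0 hL _]]] := tphi i; have [L' [_ [L'0 hL' _]]] := tphi' i.
pose c := L' * `|x i| + L * `|A (x i)| + K' + K + 1.
have c0 : 0 < c by rewrite ltr_wpDl// !addr_ge0// mulr_ge0.
have ec : 0 < e / c by rewrite divr_gt0.
near=> h => a.
have h0 : 0 < h by near: h; exact: nbhs_right_gt.
have hec : h <= e / c by near: h; exact: nbhs_right_le.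
have g2 : `|x i - S h (x i)| <= e / c by near: h; exact: strong_continuity_near.
have g3 : `|A (x i) - S h (A (x i))| <= e / c by near: h; exact: strong_continuity_near.
have -> : (phi' i (a + h) *: x i + phi i (a + h) *: A (x i)) -
    (phi' i a *: S h (x i) + phi i a *: S h (A (x i))) =
   (phi' i (a + h) - phi' i a) *: x i + (phi i (a + h) - phi i a) *: A (x i)
   + phi' i a *: (x i - S h (x i)) + phi i a *: (A (x i) - S h (A (x i))).
  exact: increment_split.
apply: (@le_trans _ _ (L' * (e / c) * `|x i| + L * (e / c) * `|A (x i)| + K' * (e / c) + K * (e / c))).
  apply: norm_sum4; rewrite normrZ.
  - rewrite ler_wpM2r//; apply: (le_trans (hL' _ _)).
    by rewrite [a + h]addrC addrK gtr0_norm// ler_wpM2l.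
  - rewrite ler_wpM2r//; apply: (le_trans (hL _ _)).
    by rewrite [a + h]addrC addrK gtr0_norm// ler_wpM2l.
  - by apply: ler_pM.
  - by apply: ler_pM.
have -> : L' * (e / c) * `|x i| + L * (e / c) * `|A (x i)| + K' * (e / c) + K * (e / c) =
   (L' * `|x i| + L * `|A (x i)| + K' + K) * (e / c) by ring.
apply: (@le_trans _ _ (c * (e / c))); last by rewrite mulrC divfK// gt_eqF.
apply: ler_wpM2r; first exact: ltW.
rewrite /c; lra.
Unshelve. all: by end_near. Qed.

Lemma near0_exists (Q : R -> Prop) : (\forall h \near 0^'+, Q h) -> exists2 dl : R, 0 < dl &
  forall h, 0 < h -> h < dl -> Q h.
Proof.
move=> [dl /= dl0 H]; exists dl => // h h0 hd; apply: H => //=.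
by rewrite sub0r normrN gtr0_norm.
Qed.

(** S(t - s) u(s) is a primitive of S(t - s) (u'(s) + A u(s)), and u vanishes
    at 0. *)
Lemma convolution_eq t : 0 <= t -> convolution S f t = u t.
Proof.
move=> t0; have [linS [M MS] S0 SD _] := hS.
pose M' := `|M| + 1.
have M'0 : 0 < M' by rewrite ltr_wpDl.
have hM s y : 0 <= s -> `|S s y| <= M' * `|y|.
  move=> s0; apply: (le_trans (MS s y s0)); rewrite ler_wpM2r//.
  by rewrite /M' ler_wpDr// ler_norm.
pose SL s (s0 : 0 <= s) : {linear X -> X} := HB.pack (S s) (GRing.isLinear.Build R X X *:%R (S s) (linS s s0)).
have Ssum s (s0 : 0 <= s) J (y : J -> X) (r : seq J) : S s (\sum_(j <- r) y j) = \sum_(j <- r) S s (y j).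
  exact: (raddf_sum (SL s s0)).
have SB s (s0 : 0 <= s) y z : S s (y - z) = S s y - S s z by exact: (raddfB (SL s s0)).
have SZ s (s0 : 0 <= s) c y : S s (c *: y) = c *: S s y by exact: (linearZ_LR (SL s s0)).
have SDl s (s0 : 0 <= s) y z : S s (y + z) = S s y + S s z by exact: (raddfD (SL s s0)).
have u0 : u 0 = 0 by rewrite /u big1// => i _; rewrite phi0 scale0r.
have St y : S (t - t) y = y by rewrite subrr S0.
have -> : u t = S (t - t) (u t) - S (t - 0) (u 0).
  by rewrite St u0 -[X in S _ X](scale0r 0) SZ ?subr0// scale0r subr0.
pose n : R := #|I|%:R + 1.
have n0 : 0 < n by rewrite ltr_wpDl.
apply: (@bochner_FTC _ _ (fun s => S (t - s) (u s))) => // e e0.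
- have e'0 : 0 < e / M' / n by rewrite !divr_gt0.
  have H : \forall h \near 0^'+, forall i, forall a, `|defect i a h| <= e / M' / n * h.
    by apply: filter_forall => i; exact: defect_near.
  have [dl dl0 hd] := near0_exists H; exists dl => // a b a0 ab bt bad.
  have [<-|ab'] := eqVneq a b; first by rewrite !subrr scale0r subr0 normr0 mulr0.
  have h0 : 0 < b - a by rewrite subr_gt0 lt_neqAle ab'.
  have tb : 0 <= t - b by rewrite subr_ge0.
  have Sa y : S (t - a) y = S (t - b) (S (b - a) y).
    by rewrite -SD ?(ltW h0)// addrA subrK.
  rewrite !Sa -SZ// -!SB//.
  apply: (le_trans (hM _ _ tb)).
  have -> : u b - S (b - a) (u a) - (b - a) *: S (b - a) (f a) = \sum_i defect i a (b - a).
    rewrite /u /f !Ssum ?(ltW h0)// scaler_sumr -!sumrB; apply: eq_bigr => i _.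
    by rewrite /defect [a + _]addrC subrK SZ ?(ltW h0)// SDl ?(ltW h0)// !SZ ?(ltW h0).
  apply: (@le_trans _ _ (M' * \sum_(i : I) (e / M' / n * (b - a)))).
    rewrite ler_wpM2l ?(ltW M'0)//; apply: (le_trans (ler_norm_sum _ _ _)).
    by apply: ler_sum => i _; exact: hd.
  rewrite sumr_const -mulr_natl.
  have -> : M' * (#|I|%:R * (e / M' / n * (b - a))) = #|I|%:R / n * (e * (b - a)).
    by field; rewrite !gt_eqF.
  rewrite ler_piMl//; first by rewrite mulr_ge0 ?(ltW e0) ?(ltW h0).
  by rewrite ler_pdivrMr// mul1r lerDl.
- have e'0 : 0 < e / M' / n by rewrite !divr_gt0.
  have H : \forall h \near 0^'+, forall i, forall a,
    `|(phi' i (a + h) *: x i + phi i (a + h) *: A (x i)) -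
    (phi' i a *: S h (x i) + phi i a *: S h (A (x i)))| <= e / M' / n.
    by apply: filter_forall => i; exact: f_increment_near.
  have [dl dl0 hd] := near0_exists H; exists dl => // a b a0 ab bt bad.
  have [<-|ab'] := eqVneq a b; first by rewrite subrr normr0 ltW.
  have h0 : 0 < b - a by rewrite subr_gt0 lt_neqAle ab'.
  have tb : 0 <= t - b by rewrite subr_ge0.
  have -> : S (t - a) (f a) = S (t - b) (S (b - a) (f a)).
    by rewrite -SD ?(ltW h0)// addrA subrK.
  rewrite -!SB//; apply: (le_trans (hM _ _ tb)).
  have -> : f b - S (b - a) (f a) = \sum_i
    ((phi' i (a + (b - a)) *: x i + phi i (a + (b - a)) *: A (x i)) -
    (phi' i a *: S (b - a) (x i) + phi i a *: S (b - a) (A (x i)))).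
    rewrite /f Ssum ?(ltW h0)// -sumrB; apply: eq_bigr => i _.
    by rewrite [a + _]addrC subrK SDl ?(ltW h0)// !SZ ?(ltW h0).
  apply: (@le_trans _ _ (M' * \sum_(i : I) (e / M' / n))).
    rewrite ler_wpM2l ?(ltW M'0)//; apply: (le_trans (ler_norm_sum _ _ _)).
    by apply: ler_sum => i _; exact: hd.
  rewrite sumr_const -mulr_natl.
  have -> : M' * (#|I|%:R * (e / M' / n)) = #|I|%:R / n * e.
    by field; rewrite !gt_eqF.
  rewrite ler_piMl//; first exact: ltW.
  by rewrite ler_pdivrMr// mul1r lerDl.
Qed.

End Convolution.

(** * Finite sums of smooth functions times vectors *)

Section SmoothSums.
Context {R : realType} {V : normedModType R} {I : finType}.

Lemma is_derive_scale_const (h : R -> R) (h' t : R) (z : V) :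
  is_derive t (1 : R) h h' -> is_derive t (1 : R) (fun t => h t *: z) (h' *: z).
Proof.
move=> [dh <-]; have c : (fun r : R => r^-1 *: ((fun t => h t *: z) (r *: 1 + t) - h t *: z)) @ 0^' --> 'D_1 h t *: z.
  rewrite (_ : (fun r => _) = (fun r => (r^-1 *: (h (r *: 1 + t) - h t)) *: z)).
    exact: (cvgZr_tmp dh).
  by apply/funext => r; rewrite -scalerBl scalerA.
apply: DeriveDef; first by apply/cvg_ex; exists ('D_1 h t *: z).
exact: (cvg_lim (@norm_hausdorff _ _) c).
Qed.

Lemma is_derive_cinf_sum (h h' : I -> R -> R) (z : I -> V) (t : R) :
  (forall i, is_derive t (1 : R) (h i) (h' i t)) ->
  is_derive t (1 : R) (fun t => \sum_i h i t *: z i) (\sum_i h' i t *: z i).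
Proof.
move=> dh.
have H (r : seq I) : is_derive t (1 : R) (fun t => \sum_(i <- r) h i t *: z i) (\sum_(i <- r) h' i t *: z i).
  elim: r => [|i r IH].
    by under eq_fun do rewrite big_nil; rewrite big_nil; exact: is_derive_cst.
  under eq_fun do rewrite big_cons; rewrite big_cons.
  apply: is_deriveD.
  exact: is_derive_scale_const.
exact: H.
Qed.

Lemma smooth_cinf_sum (h : I -> R -> R) (z : I -> V) : (forall i, cinf (h i)) ->
  smooth (fun t => \sum_i h i t *: z i).
Proof.
move=> ch n; have : exists2 h', (forall i, cinf (h' i)) &
    derive1n n (fun t => \sum_i h i t *: z i) = (fun t => \sum_i h' i t *: z i).
  elim: n => [|n [h' ch' e]]; first by exists h.
  have [h'' H] := choice (fun i => let: ex_intro2 f a b := cinf_derive (ch' i) in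
    ex_intro (fun f' => cinf f' /\ forall t : R, is_derive t (1 : R) (h' i) (f' t)) f (conj a b)).
  exists h'' => [i|]; first by case: (H i).
  rewrite derive1nS e; apply/funext => t; rewrite derive1E.
  apply: derive_val; apply: is_derive_cinf_sum => i; by case: (H i).
move=> [h' ch' ->] t.
have [h'' H] := choice (fun i => let: ex_intro2 f a b := cinf_derive (ch' i) in
    ex_intro (fun f' => cinf f' /\ forall t : R, is_derive t (1 : R) (h' i) (f' t)) f (conj a b)).
suff d : is_derive t (1 : R) (fun t => \sum_i h' i t *: z i) (\sum_i h'' i t *: z i) by case: d.
by apply: is_derive_cinf_sum => i; case: (H i).
Qed.

End SmoothSums.

Section LinopSums.
Context {R : realType} {X : normedModType R} (A : linop X).

Lemma linop_sum (J : Type) (r : seq J) (c : J -> R) (x : J -> X) : (forall j, dom A (x j)) ->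
  dom A (\sum_(j <- r) c j *: x j) /\ A (\sum_(j <- r) c j *: x j) = \sum_(j <- r) c j *: A (x j).
Proof.
move=> dx; elim: r => [|j r [d e]].
  rewrite !big_nil; split; first exact: dom0.
  have := app_lin 1 (dom0 A) (dom0 A); rewrite !scale1r addr0 => /eqP.
  by rewrite -subr_eq0 opprD addrA subrr sub0r oppr_eq0 => /eqP.
by rewrite !big_cons; split; [exact: dom_lin|rewrite app_lin// e].
Qed.

End LinopSums.

Section GammaCongr.
Context {R : realType} {d : measure_display} {Omega : measurableType d}.
Context {P : probability Omega R} (g : nat -> {RV P >-> R}).
Context {X : normedModType R}.
Local Notation Rplus := (`[0, +oo[%classic : set R).

Lemma ae_step_limit_congr (F : set R) (f h : R -> X) s : (forall t, F t -> f t = h t) ->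
  ae_step_limit F f s = ae_step_limit F h s.
Proof.
suff H (f1 h1 : R -> X) : (forall t, F t -> f1 t = h1 t) ->
    ae_step_limit F f1 s -> ae_step_limit F h1 s.
  by move=> fh; rewrite propeqE; split; apply: H => // t Ft; rewrite fh.
move=> fh [N [mN N0 H]]; exists N; split => // t /= nt; apply: H => /= Ht.
by apply: nt => Ft; rewrite -fh//; exact: Ht.
Qed.

Lemma is_bochner_integral_congr (F : set R) (f h : R -> X) : (forall t, F t -> f t = h t) ->
  is_bochner_integral F f = is_bochner_integral F h.
Proof.
move=> fh; apply/funext => x; rewrite propeqE.
have H (f1 h1 : R -> X) : (forall t, F t -> f1 t = h1 t) ->
    is_bochner_integral F f1 x -> is_bochner_integral F h1 x.
  move=> e [s [s1 s2 s3]]; exists s; split => //.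
    by rewrite -(ae_step_limit_congr s e).
  rewrite (_ : (fun k => _) = (fun k => (\int[lebesgue_measure]_(t in F) (`|f1 t - step_eval (s k) t|)%:E)%E))//.
  by apply/funext => k; apply: eq_integral => t /[!inE] Ft; rewrite e.
by split; apply: H => // t Ft; rewrite fh.
Qed.

(** Convolutions are only controlled at nonnegative times. *)
Lemma has_gamma_norm_congr (f h : R -> X) r : (forall t, 0 <= t -> f t = h t) ->
  has_gamma_norm g f r -> has_gamma_norm g h r.
Proof.
move=> fh; have e F : F `<=` Rplus -> is_bochner_integral F f = is_bochner_integral F h.
  move=> F0; apply: is_bochner_integral_congr => t /F0; rewrite /= in_itv /= andbT; exact: fh.
move=> [[s hs] bi [T hT TF]]; split.
- exists s; rewrite -(ae_step_limit_congr (f := f))// => t.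
  rewrite /= in_itv /= andbT; exact: fh.
- by move=> F HF; have := bi F HF; rewrite /bochner_integrable; case: HF => _ F0 _; rewrite (e F F0).
- exists T => // F HF; rewrite TF// /bochner_integral; case: HF => _ F0 _; by rewrite (e F F0).
Qed.

End GammaCongr.

(** * The inequality on the imaginary axis *)

Lemma pair_scale_sum (R : realType) (X : normedModType R) (I : Type) (r : seq I) (c : I -> R) (x y : I -> X) :
  \sum_(i <- r) c i *: ((x i, y i) : X * X) = (\sum_(i <- r) c i *: x i, \sum_(i <- r) c i *: y i).
Proof.
by elim: r => [|i r IH]; rewrite ?big_nil// !big_cons IH.
Qed.

Lemma sum_pair_bool2 (V : nmodType) (J : finType) (F : J * (bool * bool) -> V) :
  \sum_i F i = \sum_j (F (j, (false, false)) + F (j, (false, true)) +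
                        F (j, (true, false)) + F (j, (true, true))).
Proof.
rewrite (eq_bigr (fun i => F (i.1, i.2))); last by case.
rewrite -(pair_bigA _ (fun j e => F (j, e))) /=; apply: eq_bigr => j _.
rewrite (eq_bigr (fun e => F (j, (e.1, e.2)))); last by case.
rewrite -(pair_bigA _ (fun e e' => F (j, (e, e')))) /= !big_bool.
by rewrite (AC (2*2) ((4*3)*2*1)).
Qed.

Lemma sum_pair_bool (V : nmodType) (J : finType) (F : J * bool -> V) :
  \sum_i F i = \sum_j (F (j, false) + F (j, true)).
Proof.
rewrite (eq_bigr (fun i => F (i.1, i.2))); last by case.
rewrite -(pair_bigA _ (fun j e => F (j, e))) /=; apply: eq_bigr => j _.
by rewrite big_bool addrC.
Qed.

Section PacketFamily.
Context {R : realType}.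
Variables (w : bool * bool -> R -> R) (c : R) (rho : bool -> R).
Hypothesis c0 : 0 < c.
Hypothesis cw : forall i, cinf (w i).
Hypothesis sw : forall i t, w i t != 0 -> -1 < t < 1.
Hypothesis dw : forall i j, dot (w i) (w j) = (i == j)%:R.
Hypothesis derw : forall t : R,
  is_derive t (1 : R) (w (false, false)) (- c * w (false, true) t + rho false * w (true, false) t) /\
  is_derive t (1 : R) (w (false, true)) (c * w (false, false) t + rho true * w (true, true) t).
Variables (J : finType) (s : J -> R).
Hypothesis s0 : forall j, s j != 0.

Definition width : R := \sum_j `|s j|^-1 + 1.
(** The centres are twice the common width apart, so that packets with different
    centres have disjoint supports. *)
Definition centre (j : J) : R := (2 * (enum_rank j)%:R + 2) * width.
Definition train (i : J * (bool * bool)) : R -> R := packet w (s i.1) (centre i.1) i.2.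

Lemma width_ge1 : 1 <= width.
Proof. by rewrite /width lerDr sumr_ge0// => j _; rewrite invr_ge0. Qed.

Lemma inv_le_width j : `|s j|^-1 <= width.
Proof.
rewrite /width (bigD1 j)//= -addrA lerDl addr_ge0// sumr_ge0//.
Qed.

Lemma inv_le_centre j : `|s j|^-1 <= centre j.
Proof.
apply: le_trans (inv_le_width j) _; have := width_ge1; rewrite /centre.
have : 0 <= (enum_rank j)%:R :> R by []. move: (_%:R) width => r l; nra.
Qed.

Lemma train_supp i t : train i t != 0 -> centre i.1 - width < t < centre i.1 + width.
Proof.
move=> /(packet_supp sw (s0 i.1)) /andP[a b]; have := inv_le_width i.1.
by move: (`| _ |^-1) a b => v a b vl; apply/andP; split; lra.
Qed.

Lemma train_range i t : train i t != 0 -> width <= t <= (2 * #|J|%:R + 3) * width.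
Proof.
move=> /train_supp; have := width_ge1; rewrite /centre.
have : 0 <= (enum_rank i.1)%:R :> R by [].
have : (enum_rank i.1)%:R <= #|J|%:R :> R by rewrite ler_nat ltnW.
move: (enum_rank _)%:R #|J|%:R width => r n l rn r0 l1 /andP[a b]; apply/andP; split; nra.
Qed.

Lemma train_cinf i : cinf (train i).
Proof. exact: packet_cinf. Qed.

Lemma train_tame i : tame (train i).
Proof. apply: packet_tame => //; exact: inv_le_centre. Qed.

Lemma train_ip i j : ip (train i) (train j) = (i == j)%:R.
Proof.
case: i j => [j i] [k l]; rewrite xpair_eqE; have [<-|jk] := eqVneq j k.
  by rewrite /train /= packet_ip//; exact: inv_le_centre.
rewrite /ip (_ : (fun t => _) = fun=> 0) ?Rintegral_cst ?mul0r//.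
apply/funext => t; apply/eqP; rewrite mulf_eq0; apply/negPn; rewrite negb_or.
apply/negP => /andP[/train_supp a /train_supp b]; move: a b; rewrite /centre /=.
have w0 : 0 < width by apply: lt_le_trans width_ge1.
have jk' : enum_rank j != enum_rank k :> nat.
  by apply: contra jk => /eqP/ord_inj/enum_rank_inj ->.
have : (enum_rank j)%:R + 1 <= (enum_rank k)%:R :> R \/ (enum_rank k)%:R + 1 <= (enum_rank j)%:R :> R.
  by move: jk'; rewrite neq_ltn !natr1 !ler_nat => /orP[h|h]; [left|right].
move: (enum_rank j)%:R (enum_rank k)%:R width w0 => p q m m0 h /andP[a b] /andP[a' b'].
case: h => h; nra.
Qed.

Lemma train_derive j (t : R) :
  is_derive t (1 : R) (train (j, (false, false)))
    (- (c * s j) * train (j, (false, true)) t + (s j * rho false) * train (j, (true, false)) t) /\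
  is_derive t (1 : R) (train (j, (false, true)))
    ((c * s j) * train (j, (false, false)) t + (s j * rho true) * train (j, (true, true)) t).
Proof. exact: packet_derive. Qed.

End PacketFamily.

(** Here m1 and m2 stand for the mean squares of xi x1 = A x2 - b and
    xi x2 = a - A x1, so that the residuals are estimated by the left-hand side
    itself, with a factor less than 1. *)
Lemma absorb (R : realFieldType) (p1 p2 a b z y m1 m2 K e rt rf : R) :
  p1 <= z -> p2 <= z -> m1 <= 2 * p2 + 2 * b -> m2 <= 2 * p1 + 2 * a ->
  K * e <= 64^-1 -> e <= 64^-1 -> z <= K * y -> 0 <= K ->
  0 <= rf <= e -> 0 <= rt <= e -> 0 <= b -> 0 <= a -> 0 <= p2 -> 0 <= p1 ->
  y <= 4 * (a + b + rf * m1 + rt * m2) -> p1 + p2 <= 16 * K * (a + b).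
Proof.
move=> p1z p2z m1p m2p Ke e64 zy K0 /andP[rf0 rfe] /andP[rt0 rte] b0 a0 p20 p10 ym.
have half (r m p q : R) : 0 <= r -> r <= e -> 0 <= p -> 0 <= q -> m <= 2 * p + 2 * q ->
    K * (r * m) <= 32^-1 * p + 32^-1 * (K * q).
  move=> r0 re p0 q0 mp.
  have Kr : K * r <= 64^-1 by apply: le_trans Ke; exact: ler_wpM2l.
  have h1 : K * r * p <= 64^-1 * p by exact: ler_wpM2r.
  have h2 : r * (K * q) <= 64^-1 * (K * q) by apply: ler_wpM2r; [exact: mulr_ge0|exact: le_trans re _].
  have h3 : K * r * m <= K * r * (2 * p + 2 * q) by apply: ler_wpM2l => //; exact: mulr_ge0.
  rewrite mulrA; apply: (le_trans h3); lra.
have t1 := half _ _ _ _ rf0 rfe p20 b0 m1p; have t2 := half _ _ _ _ rt0 rte p10 a0 m2p.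
have t3 : K * y <= K * (4 * (a + b + rf * m1 + rt * m2)) by exact: ler_wpM2l.
have Ka : 0 <= K * a by exact: mulr_ge0.
have Kb : 0 <= K * b by exact: mulr_ge0.
lra.
Qed.

Section APriori.
Context {R : realType} {d : measure_display} {Omega : measurableType d}.
Context {P : probability Omega R} {g : nat -> {RV P >-> R}}.
Hypothesis hg : gaussian_sequence g.
Context {X : normedModType R}.
Variables (A : linop X) (S : R -> X -> X) (C : R).
Hypothesis hS : bounded_C0_semigroup S.
Hypothesis hAS : generated_by_opp A S.
Hypothesis hC : forall f, test_function A f ->
  let u := convolution S f in
  [/\ forall t, 0 <= t -> dom A (u t), in_gamma g (A \o u) &
    forall r q, has_gamma_norm g f r -> has_gamma_norm g (A \o u) q -> q <= C * r].

Lemma gsq_four (J : finType) (y : J * (bool * bool) -> X) :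
  gsq g y <= 4 * (gsq g (fun j => y (j, (false, false))) + gsq g (fun j => y (j, (false, true))) +
    gsq g (fun j => y (j, (true, false))) + gsq g (fun j => y (j, (true, true)))).
Proof.
pose m e (i : J * (bool * bool)) := if i.2 == e then y i else 0.
have mE e : gsq g (m e) = gsq g (fun j => y (j, e)).
  rewrite (gsq_supp hg (t := fun j => (j, e))).
  - by congr gsq; apply/funext => j; rewrite /m /= eqxx.
  - by move=> j k [].
  - move=> [j e'] h; rewrite /m /=; case: eqP => // ee; by have := h j; rewrite ee eqxx.
have yE : y = (fun i => (m (false, false) i + m (false, true) i) + (m (true, false) i + m (true, true) i)).
  by apply/funext => -[j [[] []]]; rewrite /m /= ?addr0 ?add0r.
rewrite [X in gsq g X <= _]yE -!mE.
have h1 := gsqD2_le hg (fun i => m (false, false) i + m (false, true) i) (fun i => m (true, false) i + m (true, true) i).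
have h2 := gsqD2_le hg (m (false, false)) (m (false, true)).
have h3 := gsqD2_le hg (m (true, false)) (m (true, true)).
move: h1 h2 h3; lra.
Qed.

Section Family.
Variables (J : finType) (xi : J -> R) (x1 x2 : J -> X).
Hypothesis xi0 : forall j, xi j != 0.
Hypothesis dx1 : forall j, dom A (x1 j).
Hypothesis dx2 : forall j, dom A (x2 j).
Hypothesis dAx1 : forall j, dom A (A (x1 j)).
Hypothesis dAx2 : forall j, dom A (A (x2 j)).

Let a j := A (x1 j) + xi j *: x2 j.
Let b j := A (x2 j) - xi j *: x1 j.

Let z (i : J * (bool * bool)) : X :=
  match i.2 with (false, false) => A (x1 i.1) | (false, true) => A (x2 i.1) | _ => 0 end.
Let y (c : R) (rho : bool -> R) (i : J * (bool * bool)) : X :=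
  match i.2 with
  | (false, false) => a i.1
  | (false, true) => b i.1
  | (true, false) => (rho false / c) *: (xi i.1 *: x1 i.1)
  | (true, true) => (rho true / c) *: (xi i.1 *: x2 i.1)
  end.

(** The function u = sum_j p_j x1_j + q_j x2_j is the convolution of S with
    f = u' + A u.  In the orthonormal system of all packets and residuals, f has
    the coefficients y and A u has the coefficients z. *)
Lemma train_regularity (w : bool * bool -> R -> R) (c : R) (rho : bool -> R) :
  0 < c -> (forall i, cinf (w i)) -> (forall i t, w i t != 0 -> -1 < t < 1) ->
  (forall i j, dot (w i) (w j) = (i == j)%:R) ->
  (forall t : R,
  is_derive t (1 : R) (w (false, false)) (- c * w (false, true) t + rho false * w (true, false) t) /\
  is_derive t (1 : R) (w (false, true)) (c * w (false, false) t + rho true * w (true, true) t)) ->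
  gsq g z <= C ^+ 2 * gsq g (y c rho).
Proof.
move=> c0 cw sw dw derw; pose yy := y c rho.
pose s j := xi j / c.
have s0 j : s j != 0 by rewrite mulf_neq0// invr_eq0 gt_eqF.
have cs j : c * s j = xi j by rewrite mulrC divfK// gt_eqF.
pose h := train w s.
have th : forall i, tame (h i) by move=> i; exact: train_tame.
have ch : forall i, cinf (h i) by move=> i; exact: train_cinf.
have dZ k u : dom A u -> dom A (k *: u).
  by move=> du; rewrite -[_ *: _]addr0; apply: dom_lin => //; exact: dom0.
have dD u v : dom A u -> dom A v -> dom A (u + v).
  by move=> du dv; rewrite -[u]scale1r; exact: dom_lin.
have dy i : dom A (yy i).
  case: i => j [[] []]; rewrite /yy /y /=; [exact: dZ (dZ _ _ _)|exact: dZ (dZ _ _ _)| |].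
  - by rewrite /b -scaleNr; apply: dD => //; exact: dZ.
  - by apply: dD => //; exact: dZ.
pose f t := \sum_i h i t *: yy i.
have tf : test_function A f.
  split.
  - by move=> t; have [] := linop_sum (index_enum (J * (bool * bool))%type) (fun i => h i t) dy.
  - rewrite (_ : (fun t => _) = (fun t => \sum_i h i t *: ((yy i, A (yy i)) : X * X))).
      exact: smooth_cinf_sum.
    apply/funext => t; rewrite pair_scale_sum; congr pair.
    by have [] := linop_sum (index_enum (J * (bool * bool))%type) (fun i => h i t) dy.
  - exists (width s), ((2 * #|J|%:R + 3) * width s); split.
      by apply: lt_le_trans (width_ge1 s).
    move=> t; have [/existsP[i hi] _|/existsPn h0] := boolP [exists i, h i t != 0].
      exact: (train_range sw s0 hi).
    rewrite /f big1 ?eqxx// => i _; have := h0 i; rewrite negbK => /eqP ->.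
    exact: scale0r.
have [du _ reg] := hC tf.
pose phi (k : J * bool) := h (k.1, (false, k.2)).
pose phi' (k : J * bool) t := if k.2
  then (c * s k.1) * h (k.1, (false, false)) t + (s k.1 * rho true) * h (k.1, (true, true)) t
  else - (c * s k.1) * h (k.1, (false, true)) t + (s k.1 * rho false) * h (k.1, (true, false)) t.
pose x (k : J * bool) := if k.2 then x2 k.1 else x1 k.1.
have uE t : 0 <= t -> convolution S f t = \sum_k phi k t *: x k.
  move=> t0.
  have -> : f = (fun s => \sum_k (phi' k s *: x k + phi k s *: A (x k))).
    apply/funext => u; rewrite /f sum_pair_bool2 sum_pair_bool; apply: eq_bigr => j _.
    rewrite /yy /y /phi /phi' /x /= !cs /a /b !scalerDr !scalerN !scalerA.
    rewrite !scalerDl mulNr scaleNr.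
    rewrite [RHS](AC (3*3) ((3*4)*(6*1)*2*5))/= /s.
    congr (_ + _ + (_ - _) + _ + _); congr (_ *: _); first exact: mulrC.
    - exact: mulrC.
    - by ring.
    - by ring.
  apply: convolution_eq => //.
  - by move=> k; exact: th.
  - move=> [j e].
    have w1 := width_ge1 s.
    apply: (cinf_tame (a := centre s j - width s) (b := centre s j + width s)).
    + have : 0 <= (enum_rank j)%:R :> R by [].
      by move: w1; rewrite /centre; move: (enum_rank j)%:R (width s) => r m; nra.
    + by rewrite /phi' /=; case: e; apply: cinfD; apply: cinfZ; exact: ch.
    + move=> u; rewrite /phi' /=; have H i := @train_supp _ _ sw _ s s0 (j, i) u.
      have [/H//|h1] := boolP (h (j, (false, false)) u != 0).
      have [/H//|h2] := boolP (h (j, (false, true)) u != 0).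
      have [/H//|h3] := boolP (h (j, (true, false)) u != 0).
      have [/H//|h4] := boolP (h (j, (true, true)) u != 0).
      move: h1 h2 h3 h4; rewrite !negbK => /eqP -> /eqP -> /eqP -> /eqP ->.
      by rewrite !mulr0 addr0; case: e; rewrite eqxx.
  - move=> [j []] u /=; rewrite /phi /phi' /=; by have [] := train_derive derw s j u.
  - move=> k; apply/eqP/negPn/negP => /(train_range sw s0) /andP[] H _.
    by have := le_trans (width_ge1 s) H; rewrite ler10.
  - by move=> [j []]; [exact: dx2|exact: dx1].
have dx k : dom A (x k) by case: k => j []; [exact: dx2|exact: dx1].
have nf : has_gamma_norm g f (Num.sqrt (gsq g yy)).
  by apply: has_gamma_norm_orthonormal => // i j; exact: train_ip.
have nz : has_gamma_norm g (A \o convolution S f) (Num.sqrt (gsq g z)).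
  apply: (has_gamma_norm_congr (f := fun t => \sum_i h i t *: z i)).
    move=> t t0 /=; rewrite uE//.
    have [_ ->] := linop_sum (index_enum (J * bool)%type) (fun k => phi k t) dx.
    rewrite sum_pair_bool2 sum_pair_bool; apply: eq_bigr => j _.
    by rewrite /z /= !scaler0 !addr0.
  by apply: has_gamma_norm_orthonormal => // i j; exact: train_ip.
have := reg _ _ nf nz => H.
rewrite -/yy -(sqr_sqrtr (gsq_ge0 g z)) -(sqr_sqrtr (gsq_ge0 g yy)) -exprMn.
have H' : Num.sqrt (gsq g z) <= `|C| * Num.sqrt (gsq g yy).
  by apply: le_trans H _; rewrite ler_wpM2r ?sqrtr_ge0// ler_norm.
rewrite exprMn -[C ^+ 2]real_normK ?num_real// -exprMn ler_sqr ?nnegrE ?sqrtr_ge0//.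
Qed.

(** The residuals of the wave pair carry the factor e, which is chosen small
    compared with 1 / C. *)
Lemma apriori :
  gsq g (fun j => A (x1 j)) + gsq g (fun j => A (x2 j)) <= 16 * C ^+ 2 * (gsq g a + gsq g b).
Proof.
(* With this e, C^2 e^2 <= 1 / 64. *)
pose e : R := (8 * (`|C| + 1))^-1.
have e0 : 0 < e by rewrite invr_gt0 mulr_gt0// ltr_wpDl.
have [w [c [rho [c0 rho0 cw dw derw]]]] := wave_pair e0.
have := @train_regularity w c rho c0 (fun i => (cw i).1) (fun i => (cw i).2) dw derw.
set y' := y c rho => H.
have z1 : gsq g (fun j => A (x1 j)) <= gsq g z.
  by apply: (gsq_inj hg (t := fun j => (j, (false, false)))) => j k [].
have z2 : gsq g (fun j => A (x2 j)) <= gsq g z.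
  by apply: (gsq_inj hg (t := fun j => (j, (false, true)))) => j k [].
have yE k : (fun j => y' (j, k)) = (fun j => y c rho (j, k)) by [].
have := gsq_four y'; rewrite !yE /y /= !gsqZ//.
have r f : 0 <= (rho f / c) ^+ 2 <= e ^+ 2.
  have /andP[r0 r1] := rho0 f; rewrite sqr_ge0 /= ler_sqr ?nnegrE ?divr_ge0 ?(ltW r0) ?(ltW c0) ?(ltW e0)//.
  by rewrite ler_pdivrMr.
have c1 := gsqD2_le hg (fun j => A (x2 j)) (fun j => (-1) *: b j).
have c2 := gsqD2_le hg a (fun j => (-1) *: A (x1 j)).
have e1 : gsq g (fun j => xi j *: x1 j) <= 2 * gsq g (fun j => A (x2 j)) + 2 * gsq g b.
  apply: le_trans (le_trans _ c1) _; last by rewrite gsqZ// sqrrN expr1n mul1r.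
  by rewrite le_eqVlt; apply/orP; left; apply/eqP; congr gsq; apply/funext => j; rewrite /b scaleN1r opprB addrC subrK.
have e2 : gsq g (fun j => xi j *: x2 j) <= 2 * gsq g (fun j => A (x1 j)) + 2 * gsq g a.
  apply: le_trans (le_trans _ c2) _; last by rewrite gsqZ// sqrrN expr1n mul1r addrC.
  by rewrite le_eqVlt; apply/orP; left; apply/eqP; congr gsq; apply/funext => j; rewrite /a scaleN1r addrAC subrr add0r.
have Ce : C ^+ 2 * e ^+ 2 <= 64^-1.
  rewrite -exprMn -real_normK ?num_real// normrM (gtr0_norm e0) /e.
  have -> : 64^-1 = (8^-1) ^+ 2 :> R by rewrite exprVn -natrX.
  rewrite ler_sqr ?nnegrE ?invr_ge0 ?mulr_ge0 ?addr_ge0//.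
  by rewrite ler_pdivrMr ?mulr_gt0 ?ltr_wpDl// mulrA mulVf ?pnatr_eq0// mul1r lerDl.
have e64 : e ^+ 2 <= 64^-1.
  have -> : 64^-1 = (8^-1) ^+ 2 :> R by rewrite exprVn -natrX.
  rewrite ler_sqr ?nnegrE ?invr_ge0 ?mulr_ge0 ?addr_ge0//.
  by rewrite lef_pV2 ?posrE ?mulr_gt0 ?ltr_wpDl// ler_peMr// lerDr.
have := gsq_ge0 g (fun j => A (x1 j)); have := gsq_ge0 g (fun j => A (x2 j)).
have := gsq_ge0 g a; have := gsq_ge0 g b.
have := r true; have := r false; have K0 := sqr_ge0 C.
move: z1 z2 e1 e2 Ce e64 H K0.
move: (gsq g (fun j => A (x1 j))) (gsq g (fun j => A (x2 j))) (gsq g a) (gsq g b) (gsq g z) (gsq g y')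
  (gsq g (fun j => xi j *: x1 j)) (gsq g (fun j => xi j *: x2 j)) (C ^+ 2) (e ^+ 2)
  ((rho true / c) ^+ 2) ((rho false / c) ^+ 2).
exact: absorb.
Qed.

End Family.
End APriori.

(** * A maximum principle in the half plane *)

(** The mean of eps a^2 over the four points exceeds its value at the centre by
    eps r^2 / 2, which beats C r^3 for small r.  So F + eps a^2 cannot come
    within eps r^2 / 4 of its supremum over a large box at a point further than r
    from the axis, while near the axis and far away F is controlled by hypothesis. *)
Lemma max_principle (R : realType) (F : R -> R -> R) (B L C : R) : 0 <= C -> 0 <= L ->
  (forall a b r : R, 0 < r -> r < a -> F a b <=
     4^-1 * (F (a + r) b + F (a - r) b + F a (b + r) + F a (b - r)) + C * r ^+ 3) ->
  (forall a b a' b' : R, 0 <= a -> 0 <= a' -> F a b - F a' b' <= L * (`|a - a'| + `|b - b'|)) ->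
  (forall b : R, F 0 b <= B) ->
  (forall e : R, 0 < e -> exists rho : R, forall a b : R, 0 <= a -> rho < a \/ rho < `|b| -> F a b <= B + e) ->
  forall a b : R, 0 <= a -> F a b <= B.
Proof.
move=> C0 L0 mean lip bd far a0 b0 a00; rewrite leNgt; apply/negP => FB.
pose eta := (F a0 b0 - B) / 4.
have eta0 : 0 < eta by rewrite divr_gt0// subr_gt0.
have Feta : F a0 b0 = B + 4 * eta by rewrite /eta; field.
have [rho' far'] := far _ eta0.
pose rho : R := `|rho'| + 1.
have rho1 : 1 <= rho by rewrite /rho lerDr.
have farr (a b : R) : 0 <= a -> rho < a \/ rho < `|b| -> F a b <= B + eta.
  move=> a1 h; apply: far' => //.
  have : rho' < rho by rewrite /rho (le_lt_trans (ler_norm _))// ltrDl.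
  by move=> rr; case: h => h; [left|right]; exact: lt_trans h.
(* Then eps a^2 <= eta for a <= 2 rho, which covers the neighbours of the box. *)
pose eps : R := eta / (4 * rho ^+ 2).
have r2 : 0 < 4 * rho ^+ 2 by rewrite mulr_gt0// exprn_gt0// (lt_le_trans ltr01).
have eps0 : 0 < eps by rewrite divr_gt0.
have epsE : eps * (4 * rho ^+ 2) = eta by rewrite /eps divfK// gt_eqF.
pose G a b := F a b + eps * a ^+ 2.
pose box (a b : R) : Prop := [/\ 0 <= a, a <= rho & `|b| <= rho].
pose E : set R := [set x | exists a b : R, box a b /\ x = G a b].
have Eub : ubound E (B + L * rho + eta).
  move=> _ [a [b [[a1 a2 _] ->]]]; rewrite /G.
  have := lip a b 0 b a1 (lexx 0); rewrite subrr normr0 addr0 subr0 ger0_norm// => h.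
  have h2 : L * a <= L * rho by exact: ler_wpM2l.
  have h3 : eps * a ^+ 2 <= eta.
    by rewrite -epsE ler_wpM2l ?(ltW eps0)//; nra.
  by have := bd b; lra.
have box0 : box a0 b0.
  have h : ~ (rho < a0 \/ rho < `|b0|) by move=> /farr; rewrite Feta => /(_ a00); lra.
  split=> //; rewrite leNgt; apply/negP => H; apply: h; [by left|by right].
have supE : has_sup E by split; [exists (G a0 b0), a0, b0|exists (B + L * rho + eta)].
pose M : R := sup E.
have GM (a b : R) : box a b -> G a b <= M by move=> bx; apply: sup_upper_bound => //; exists a, b.
have M0 : B + 4 * eta <= M.
  by apply: le_trans (GM _ _ box0); rewrite /G Feta lerDl mulr_ge0 ?sqr_ge0// ltW.
pose r : R := Num.min 1 (Num.min (eta / (L + 1)) (eps / (4 * (C + 1)))).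
have L1 : 0 < L + 1 by rewrite ltr_wpDl.
have C1 : 0 < C + 1 by rewrite ltr_wpDl.
have C4 : 0 < 4 * (C + 1) by exact: mulr_gt0.
have r0 : 0 < r by rewrite /r !lt_min ltr01 (divr_gt0 eta0 L1) (divr_gt0 eps0 C4).
have r1 : r <= 1 by rewrite /r ge_min lexx.
have rL : L * r <= eta.
  apply: (@le_trans _ _ ((L + 1) * (eta / (L + 1)))); last by rewrite mulrC divfK// gt_eqF.
  by apply: ler_pM => //; [exact: ltW|rewrite lerDl|rewrite /r !ge_min lexx /= orbT].
have rC : 4 * (C + 1) * r <= eps.
  rewrite mulrC -ler_pdivlMr ?mulr_gt0// /r !ge_min lexx /=.
  by rewrite !orbT.
have rr0 : 0 < eps * r ^+ 2 / 4 by rewrite divr_gt0// mulr_gt0// exprn_gt0.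
have [_ [a [b [[a1 a2 b1] ->]]] hG] := sup_adherent rr0 supE; rewrite -/M in hG.
have ea : eps * a ^+ 2 <= eta / 4.
  rewrite -epsE.
  have -> : eps * (4 * rho ^+ 2) / 4 = eps * rho ^+ 2 by field.
  by rewrite ler_wpM2l ?(ltW eps0)//; nra.
have er : eps * r ^+ 2 <= eta / 4.
  rewrite -epsE.
  have -> : eps * (4 * rho ^+ 2) / 4 = eps * rho ^+ 2 by field.
  by rewrite ler_wpM2l ?(ltW eps0)//; nra.
have ra : r < a.
  rewrite ltNge; apply/negP => ar.
  have := lip a b 0 b a1 (lexx 0); rewrite subrr normr0 addr0 subr0 ger0_norm// => h.
  have h2 : L * a <= L * r by exact: ler_wpM2l.
  have := bd b; move: hG; rewrite /G; lra.
(* Outside of the box the neighbours are still below the supremum M. *)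
have nb (a' b' : R) : 0 <= a' -> a' <= 2 * rho -> G a' b' <= M.
  move=> a'0 a'r.
  have [h1|h1] := leP a' rho; last first.
    have := farr a' b' a'0 (or_introl h1).
    have : eps * a' ^+ 2 <= eta by rewrite -epsE ler_wpM2l ?(ltW eps0)//; nra.
    by rewrite /G; lra.
  have [h2|h2] := leP `|b'| rho; first exact: GM.
  have := farr a' b' a'0 (or_intror h2).
  have : eps * a' ^+ 2 <= eta by rewrite -epsE ler_wpM2l ?(ltW eps0)//; nra.
  by rewrite /G; lra.
have n1 : G (a + r) b <= M by apply: nb; lra.
have n2 : G (a - r) b <= M by apply: nb; lra.
have n3 : G a (b + r) <= M by apply: nb; lra.
have n4 : G a (b - r) <= M by apply: nb; lra.
have := mean a b r r0 ra.
have : C * r ^+ 3 < eps * r ^+ 2 / 4.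
  have -> : C * r ^+ 3 = C * r * r ^+ 2 by ring.
  have -> : eps * r ^+ 2 / 4 = (eps / 4) * r ^+ 2 by field.
  by rewrite ltr_pM2r ?exprn_gt0//; lra.
move: n1 n2 n3 n4 hG; rewrite /G.
have -> : eps * (a + r) ^+ 2 = eps * a ^+ 2 + 2 * eps * a * r + eps * r ^+ 2 by ring.
have -> : eps * (a - r) ^+ 2 = eps * a ^+ 2 - 2 * eps * a * r + eps * r ^+ 2 by ring.
move: (eps * a ^+ 2) (2 * eps * a * r) (eps * r ^+ 2) (C * r ^+ 3) => u v w x.
move: (F (a + r) b) (F (a - r) b) (F a (b + r)) (F a (b - r)) (F a b) => f1 f2 f3 f4 f.
clear; lra.
Qed.

(** * Resolvents in the half plane *)

Section ComplexScaling.
Context {R : realType} {X : normedModType R}.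
Implicit Types (a b c d : R) (w u v : X * X).

(** Multiplication by a + i b in the complexification, with real arguments
    because the half plane is described by pairs of reals. *)
Definition cmul a b w : X * X := (a *: w.1 - b *: w.2, b *: w.1 + a *: w.2).

Lemma cmulD a b u v : cmul a b (u + v) = cmul a b u + cmul a b v.
Proof.
rewrite /cmul /=; congr pair; rewrite /= !scalerDr ?opprD; exact: addrACA.
Qed.

Lemma cmulN a b u : cmul a b (- u) = - cmul a b u.
Proof. by rewrite /cmul /=; congr pair; rewrite /= !scalerN -opprD ?opprK. Qed.

Lemma cmulB a b u v : cmul a b (u - v) = cmul a b u - cmul a b v.
Proof. by rewrite cmulD cmulN. Qed.

Lemma cmulDl a b c d w : cmul (a + c) (b + d) w = cmul a b w + cmul c d w.
Proof.
rewrite /cmul; congr pair; rewrite /= !scalerDl ?opprD; exact: addrACA.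
Qed.

Lemma cmulNl a b w : cmul (- a) (- b) w = - cmul a b w.
Proof. by rewrite /cmul; congr pair; rewrite /= !scaleNr -opprD. Qed.

Lemma cmulBl a b c d w : cmul (a - c) (b - d) w = cmul a b w - cmul c d w.
Proof. by rewrite cmulDl cmulNl. Qed.

Lemma cmul0l w : cmul 0 0 w = 0.
Proof. by rewrite /cmul !scale0r subr0 addr0. Qed.

Lemma cmul_real a w : cmul a 0 w = a *: w.
Proof. by rewrite /cmul !scale0r subr0 add0r; case: w. Qed.

Lemma cmulA a b c d w : cmul a b (cmul c d w) = cmul (a * c - b * d) (a * d + b * c) w.
Proof.
rewrite /cmul /=; congr pair; rewrite /= !scalerDr !scalerN !scalerA !scalerDl !scaleNr ?opprD.
  by rewrite (AC (2*2) ((1*3)*(2*4))).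
by rewrite (AC (2*2) ((3*1)*(4*2))).
Qed.

Lemma cmulC a b c d w : cmul a b (cmul c d w) = cmul c d (cmul a b w).
Proof. by rewrite !cmulA; congr cmul; ring. Qed.

Lemma norm_cmul_le a b w : `|cmul a b w| <= (`|a| + `|b|) * `|w|.
Proof.
have w1 : `|w.1| <= `|w| by rewrite prod_normE le_max lexx.
have w2 : `|w.2| <= `|w| by rewrite prod_normE le_max lexx orbT.
rewrite [X in X <= _]prod_normE ge_max mulrDl; apply/andP; split.
  apply: le_trans (ler_normB _ _) _; rewrite !normrZ.
  by rewrite lerD// ler_wpM2l.
by rewrite addrC; apply: le_trans (ler_normD _ _) _; rewrite !normrZ lerD// ler_wpM2l.
Qed.

End ComplexScaling.

Section ResolventFamily.
Context {R : realType} {X : normedModType R}.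
Variable A : linop X.

Lemma dom_scale (k : R) (u : X) : dom A u -> dom A (k *: u).
Proof. by move=> du; rewrite -[_ *: _]addr0; apply: dom_lin => //; exact: dom0. Qed.

Lemma dom_add (u v : X) : dom A u -> dom A v -> dom A (u + v).
Proof. by move=> du dv; rewrite -[u]scale1r; exact: dom_lin. Qed.

Lemma app_add (u v : X) : dom A u -> dom A v -> A (u + v) = A u + A v.
Proof. by move=> du dv; rewrite -[u in LHS]scale1r app_lin// scale1r. Qed.

Lemma app0 : A 0 = 0.
Proof.
have := app_add (dom0 A) (dom0 A); rewrite addr0 => /eqP.
by rewrite -subr_eq0 opprD addrA subrr sub0r oppr_eq0 => /eqP.
Qed.

Lemma app_scale (k : R) (u : X) : dom A u -> A (k *: u) = k *: A u.
Proof. by move=> du; rewrite -[k *: u]addr0 app_lin ?app0 ?addr0//; exact: dom0. Qed.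

Lemma cdom_add u v : cdom A u -> cdom A v -> cdom A (u + v).
Proof. by move=> [u1 u2] [v1 v2]; split; exact: dom_add. Qed.

Lemma cdom_cmul a b u : cdom A u -> cdom A (cmul a b u).
Proof.
move=> [u1 u2]; split => /=; apply: dom_add; rewrite -?scaleNr; exact: dom_scale.
Qed.

Lemma capp_add u v : cdom A u -> cdom A v -> capp A (u + v) = capp A u + capp A v.
Proof. by move=> [u1 u2] [v1 v2]; rewrite /capp /= !app_add. Qed.

Lemma capp_cmul a b u : cdom A u -> capp A (cmul a b u) = cmul a b (capp A u).
Proof.
move=> [u1 u2]; rewrite /capp /cmul /= -!scaleNr.
by rewrite !app_add ?app_scale//; exact: dom_scale.
Qed.

Lemma cdom_opp u : cdom A u -> cdom A (- u).
Proof.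
move=> du; rewrite (_ : - u = cmul (-1) 0 u); first exact: cdom_cmul.
by rewrite cmul_real scaleN1r.
Qed.

Lemma capp_opp u : cdom A u -> capp A (- u) = - capp A u.
Proof.
move=> du; rewrite (_ : - u = cmul (-1) 0 u) ?capp_cmul// ?cmul_real ?scaleN1r//.
Qed.

Definition opshift a b u := cmul a b u + capp A u.

Lemma opshift_add a b u v : cdom A u -> cdom A v -> opshift a b (u + v) = opshift a b u + opshift a b v.
Proof. by move=> du dv; rewrite /opshift cmulD capp_add// addrACA. Qed.

Lemma opshift_cmul a b c d u : cdom A u -> opshift a b (cmul c d u) = cmul c d (opshift a b u).
Proof. by move=> du; rewrite /opshift cmulD capp_cmul// cmulC. Qed.

Variables (Rz : R -> R -> X * X -> X * X) (M : R).
Hypothesis Rdom : forall a b w, 0 <= a -> cdom A (Rz a b w).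
Hypothesis shiftR : forall a b w, 0 <= a -> opshift a b (Rz a b w) = w.
Hypothesis Rshift : forall a b u, 0 <= a -> cdom A u -> Rz a b (opshift a b u) = u.
Hypothesis R_bound : forall a b w, 0 <= a -> `|Rz a b w| <= M * `|w|.
Hypothesis zR_bound : forall a b w, 0 <= a -> `|cmul a b (Rz a b w)| <= M * `|w|.
Hypothesis M0 : 0 <= M.

Lemma Rz_add a b u v : 0 <= a -> Rz a b (u + v) = Rz a b u + Rz a b v.
Proof.
move=> a0; rewrite -{1}(shiftR b u a0) -{1}(shiftR b v a0).
by rewrite -opshift_add ?Rshift//; [exact: cdom_add (Rdom _ _ _) (Rdom _ _ _)|exact: Rdom..].
Qed.

Lemma Rz_cmul a b c d u : 0 <= a -> Rz a b (cmul c d u) = cmul c d (Rz a b u).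
Proof.
move=> a0; rewrite -{1}(shiftR b u a0) -opshift_cmul ?Rshift//; last exact: Rdom.
by apply: cdom_cmul; exact: Rdom.
Qed.

Lemma Rz_opp a b u : 0 <= a -> Rz a b (- u) = - Rz a b u.
Proof.
move=> a0; rewrite (_ : - u = cmul (-1) 0 u) ?Rz_cmul// ?cmul_real ?scaleN1r//.
Qed.

Lemma Rz_capp a b u : 0 <= a -> cdom A u ->
  cdom A (capp A (Rz a b u)) /\ capp A (Rz a b u) = Rz a b (capp A u).
Proof.
move=> a0 du; set q := Rz a b u; have dq : cdom A q by exact: Rdom.
have Aq : capp A q = u - cmul a b q.
  by apply/eqP; rewrite eq_sym subr_eq addrC; apply/eqP; rewrite -[LHS](shiftR b u a0).
have dAq : cdom A (capp A q).
  by rewrite Aq; apply: cdom_add => //; apply: cdom_opp; exact: cdom_cmul.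
split => //; rewrite -[LHS](Rshift b a0 dAq); congr Rz.
rewrite -[in RHS](shiftR b u a0) -/q {2}/opshift capp_add//; last exact: cdom_cmul.
by rewrite capp_cmul.
Qed.

Lemma resolvent_identity a b a' b' y : 0 <= a -> 0 <= a' ->
  Rz a b y - Rz a' b' y = Rz a b (cmul (a' - a) (b' - b) (Rz a' b' y)).
Proof.
move=> a0 a'0; set q := Rz a' b' y; have dq : cdom A q by exact: Rdom.
rewrite -{1}(Rshift b a0 dq) -Rz_opp// -Rz_add//; congr Rz.
rewrite -[in LHS](shiftR b' y a'0) -/q /opshift cmulBl opprD addrA.
by rewrite [_ + _ - cmul a b q]addrAC addrK.
Qed.

Lemma resolvent_lipschitz a b a' b' y : 0 <= a -> 0 <= a' ->
  `|Rz a b y - Rz a' b' y| <= M ^+ 2 * `|y| * (`|a - a'| + `|b - b'|).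
Proof.
move=> a0 a'0; rewrite resolvent_identity//; apply: le_trans (R_bound _ _ a0) _.
rewrite expr2 -!mulrA ler_wpM2l//; apply: le_trans (norm_cmul_le _ _ _) _.
rewrite (distrC a) (distrC b) mulrC mulrA ler_wpM2r ?addr_ge0//; exact: R_bound.
Qed.

Section SecondDifference.
Variables (a b u v : R) (y : X * X).
Hypotheses (a0 : 0 <= a) (au0 : 0 <= a + u) (au0' : 0 <= a - u).
Let N x := Rz a b (cmul u v (Rz a b (cmul u v x))).
Let k := Rz a b y.
Let p := Rz (a + u) (b + v) y.
Let m := Rz (a - u) (b - v) y.

(** For the displacement c = u + i v one has k - p = R c p and m - k = R c m.  The
    sum of these is m - p = R c (p + m), and their difference is
    p + m - 2 k = R c (m - p). *)
Lemma second_difference : p + m - (k + k) = N (p + m).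
Proof.
have h1 : k - p = Rz a b (cmul u v p).
  by rewrite resolvent_identity//; congr (Rz _ _ (cmul _ _ _)); ring.
have h2 : k - m = - Rz a b (cmul u v m).
  rewrite resolvent_identity// -Rz_opp//; congr Rz; rewrite -cmulNl; congr cmul; ring.
have mp : m - p = Rz a b (cmul u v (p + m)).
  by rewrite cmulD Rz_add// -h1 -[Rz a b (cmul u v m)]opprK -h2 opprB [RHS]addrC addrA subrK.
rewrite /N -mp cmulB Rz_add// Rz_opp// -h1 -[Rz a b (cmul u v m)]opprK -h2.
by rewrite !opprB opprD addrACA addrC.
Qed.

Lemma second_difference_bound :
  `|p + m - (k + k) - N (k + k)| <= 2 * M ^+ 4 * `|y| * (`|u| + `|v|) ^+ 3.
Proof.
have NB x : `|N x| <= M ^+ 2 * (`|u| + `|v|) ^+ 2 * `|x|.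
  apply: le_trans (R_bound _ _ a0) _.
  apply: (@le_trans _ _ (M * ((`|u| + `|v|) * (M * ((`|u| + `|v|) * `|x|))))).
    rewrite ler_wpM2l//; apply: le_trans (norm_cmul_le _ _ _) _.
    rewrite ler_wpM2l ?addr_ge0//; apply: le_trans (R_bound _ _ a0) _.
    by rewrite ler_wpM2l//; exact: norm_cmul_le.
  by rewrite le_eqVlt; apply/orP; left; apply/eqP; ring.
have -> : p + m - (k + k) - N (k + k) = N (p + m - (k + k)).
  by rewrite {1}second_difference /N cmulB Rz_add// Rz_opp// cmulB Rz_add// Rz_opp.
apply: le_trans (NB _) _.
have e : p + m - (k + k) = (p - k) + (m - k) by rewrite opprD addrACA.
have h1 : `|p - k| <= M ^+ 2 * `|y| * (`|u| + `|v|).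
  have := resolvent_lipschitz (b + v) b y au0 a0.
  have -> : a + u - a = u by ring.
  have -> : b + v - b = v by ring.
  exact.
have h2 : `|m - k| <= M ^+ 2 * `|y| * (`|u| + `|v|).
  have := resolvent_lipschitz (b - v) b y au0' a0.
  have -> : a - u - a = - u by ring.
  have -> : b - v - b = - v by ring.
  rewrite !normrN; exact.
have -> : 2 * M ^+ 4 * `|y| * (`|u| + `|v|) ^+ 3 =
   M ^+ 2 * (`|u| + `|v|) ^+ 2 * (M ^+ 2 * `|y| * (`|u| + `|v|) + M ^+ 2 * `|y| * (`|u| + `|v|)) by ring.
rewrite ler_wpM2l ?mulr_ge0 ?sqr_ge0// e; apply: le_trans (ler_normD _ _) _.
by rewrite lerD.
Qed.

End SecondDifference.

(** The leading terms (R c)^2 (2 k) of the second differences for c = r and c = i r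
    are opposite, because multiplication by i commutes with R. *)
Lemma resolvent_mean a b r y : 0 < r -> r < a ->
  `|4^-1 *: (Rz (a + r) b y + Rz (a - r) b y + Rz a (b + r) y + Rz a (b - r) y) - Rz a b y| <=
    M ^+ 4 * `|y| * r ^+ 3.
Proof.
move=> r0 ra; have a0 : 0 <= a by lra.
have h1 := @second_difference_bound a b r 0 y a0 ltac:(lra) ltac:(lra).
have h2 := @second_difference_bound a b 0 r y a0 ltac:(lra) ltac:(lra).
move: h1 h2; rewrite !addr0 !subr0 normr0 addr0 add0r (gtr0_norm r0).
set k := Rz a b y; set p := Rz (a + r) b y; set m := Rz (a - r) b y.
set p' := Rz a (b + r) y; set m' := Rz a (b - r) y.
rewrite !Rz_cmul// !cmulA; set Q := Rz a b (Rz a b (k + k)).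
rewrite (_ : 0 * 0 - r * r = - (r * r - 0 * 0)); last by ring.
rewrite (_ : 0 * r + r * 0 = - (r * 0 + 0 * r)); last by ring.
rewrite cmulNl opprK => h1 h2.
have -> : 4^-1 *: (p + m + p' + m') - k =
   4^-1 *: ((p + m - (k + k) - cmul (r * r - 0 * 0) (r * 0 + 0 * r) Q) +
            (p' + m' - (k + k) + cmul (r * r - 0 * 0) (r * 0 + 0 * r) Q)).
  have k4 : 4^-1 *: (k + k + (k + k)) = k.
    by rewrite -!mulr2n -mulrnA -[k *+ _]scaler_nat scalerA mulVf ?pnatr_eq0// scale1r.
  rewrite addrACA addNr addr0 addrACA -opprD scalerBr k4.
  by rewrite addrA.
rewrite normrZ ger0_norm ?invr_ge0//.
apply: (@le_trans _ _ (4^-1 * (2 * M ^+ 4 * `|y| * r ^+ 3 + 2 * M ^+ 4 * `|y| * r ^+ 3))).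
  by rewrite ler_wpM2l ?invr_ge0//; apply: le_trans (ler_normD _ _) _; rewrite lerD.
by rewrite le_eqVlt; apply/orP; left; apply/eqP; field.
Qed.

Lemma resolvent_decay a b rho y : 0 <= a -> 0 < rho -> rho < a \/ rho < `|b| ->
  `|Rz a b y| <= 2 * M * `|y| / rho.
Proof.
move=> a0 r0 far; set n := a ^+ 2 + b ^+ 2.
pose s := Num.max a `|b|.
have rs : rho < s by rewrite lt_max; case: far => ->; rewrite ?orbT.
have s0 : 0 < s by exact: lt_trans rs.
have as_ : a <= s by rewrite le_max lexx.
have bs : `|b| <= s by rewrite le_max lexx orbT.
have ns : s ^+ 2 <= n.
  rewrite /n -(real_normK (num_real b)) /s.
  by have [h|h] := leP a `|b|; rewrite ?lerDr ?lerDl sqr_ge0.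
have n0 : 0 < n by apply: lt_le_trans ns; rewrite exprn_gt0.
have -> : Rz a b y = cmul (a / n) (- b / n) (cmul a b (Rz a b y)).
  rewrite cmulA (_ : a / n * a - - b / n * b = 1); last by rewrite /n in n0 *; field; rewrite gt_eqF.
  rewrite (_ : a / n * b + - b / n * a = 0); last by ring.
  by rewrite cmul_real scale1r.
apply: le_trans (norm_cmul_le _ _ _) _.
have h : `|a / n| + `|- b / n| <= 2 / rho.
  rewrite !normrM normfV (gtr0_norm n0) normrN (ger0_norm a0) -mulrDl.
  apply: (@le_trans _ _ (2 * s / s ^+ 2)).
    apply: ler_pM; rewrite ?addr_ge0 ?invr_ge0 ?(ltW n0)//; first lra.
    by rewrite lef_pV2 ?posrE// exprn_gt0.
  rewrite expr2 invfM mulrA mulfK ?gt_eqF// ler_pM2l// lef_pV2 ?posrE//; exact: ltW.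
have -> : 2 * M * `|y| / rho = 2 / rho * (M * `|y|) by ring.
apply: ler_pM => //; exact: zR_bound.
Qed.

End ResolventFamily.

Section HullPrinciple.
Context {R : realType} {X : normedModType R}.
Variable A : linop X.
Variables (Rz : R -> R -> X * X -> X * X) (M : R).
Hypothesis Rdom : forall a b w, 0 <= a -> cdom A (Rz a b w).
Hypothesis shiftR : forall a b w, 0 <= a -> opshift A a b (Rz a b w) = w.
Hypothesis Rshift : forall a b u, 0 <= a -> cdom A u -> Rz a b (opshift A a b u) = u.
Hypothesis R_bound : forall a b w, 0 <= a -> `|Rz a b w| <= M * `|w|.
Hypothesis zR_bound : forall a b w, 0 <= a -> `|cmul a b (Rz a b w)| <= M * `|w|.
Hypothesis M0 : 0 <= M.

(** Convexity turns resolvent_mean into the submean property of phi (R(z) y).  At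
    infinity phi (R(z) y) tends to phi 0, which is at most B as a limit along the
    axis.  The origin of the axis is recovered by continuity. *)
Lemma hull_principle (phi : X * X -> R) (B : R) (y : X * X) :
  (forall u1 u2 u3 u4,
     phi (4^-1 *: (u1 + u2 + u3 + u4)) <= 4^-1 * (phi u1 + phi u2 + phi u3 + phi u4)) ->
  (forall rho : R, exists2 L : R, 0 <= L &
     forall u v, `|u| <= rho -> `|v| <= rho -> phi u - phi v <= L * `|u - v|) ->
  (forall b, b != 0 -> phi (Rz 0 b y) <= B) ->
  forall a b, 0 <= a -> phi (Rz a b y) <= B.
Proof.
move=> mean lip bd.
have [L L0 hL] := lip (M * `|y|).
have L1 : 0 < L * M ^+ 2 * `|y| + 1 by rewrite ltr_wpDl// !mulr_ge0// sqr_ge0.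
have My : 0 <= M * `|y| by exact: mulr_ge0.
have klip (a b a' b' : R) : 0 <= a -> 0 <= a' ->
    phi (Rz a b y) - phi (Rz a' b' y) <= L * M ^+ 2 * `|y| * (`|a - a'| + `|b - b'|).
  move=> a0 a'0; apply: le_trans (hL _ _ (R_bound _ _ a0) (R_bound _ _ a'0)) _.
  rewrite -!mulrA ler_wpM2l// !mulrA.
  exact: (resolvent_lipschitz Rdom shiftR Rshift R_bound M0).
have bd' (b : R) : phi (Rz 0 b y) <= B.
  have [->|/bd//] := eqVneq b 0; apply/ler_addgt0Pr => e e0.
  pose t := e / (L * M ^+ 2 * `|y| + 1).
  have t0 : 0 < t by rewrite divr_gt0.
  have := klip 0 0 0 t (lexx 0) (lexx 0).
  rewrite subrr normr0 add0r sub0r normrN (gtr0_norm t0) => h.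
  have h1 := bd t (lt0r_neq0 t0).
  have : L * M ^+ 2 * `|y| * t <= e.
    rewrite /t mulrCA ler_piMr ?(ltW e0)// ler_pdivrMr// mul1r lerDl//.
  by lra.
have decay (e : R) : 0 < e -> exists2 rho : R, 0 < rho & forall a b : R, 0 <= a ->
    rho < a \/ rho < `|b| -> L * `|Rz a b y| <= e.
  move=> e0; have r0 : 0 < (L * (2 * M * `|y|) + 1) / e.
    by rewrite divr_gt0// ltr_wpDl// !mulr_ge0.
  exists ((L * (2 * M * `|y|) + 1) / e) => // a b a0 far.
  have h := resolvent_decay zR_bound y a0 r0 far.
  apply: le_trans (ler_wpM2l L0 h) _.
  set c := L * _; have c0 : 0 <= c by rewrite !mulr_ge0.
  rewrite invf_div (_ : L * _ = e * (c / (c + 1))); last by rewrite /c; ring.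
  by rewrite ler_piMr ?(ltW e0)// ler_pdivrMr ?mul1r ?lerDl// ltr_wpDl.
have phi0 : phi 0 <= B.
  apply/ler_addgt0Pr => e e0; have [rho r0 far] := decay e e0.
  have h := hL 0 (Rz 0 (rho + 1) y); rewrite normr0 My in h.
  have := h isT (R_bound _ _ (lexx 0)); rewrite sub0r normrN => h1.
  have : L * `|Rz 0 (rho + 1) y| <= e.
    by apply: far => //; right; rewrite gtr0_norm ?addr_gt0// ltrDl.
  have := bd' (rho + 1); lra.
apply: (max_principle (F := fun a b => phi (Rz a b y)) (L := L * M ^+ 2 * `|y|)
  (C := L * (M ^+ 4 * `|y|))) => //.
- by rewrite !mulr_ge0// exprn_ge0.
- by rewrite !mulr_ge0// sqr_ge0.
- move=> a b r r0 ra; have a0 : 0 <= a by lra.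
  have := resolvent_mean Rdom shiftR Rshift R_bound M0 b y r0 ra.
  set m := 4^-1 *: _ => h.
  have mM : `|m| <= M * `|y|.
    rewrite /m normrZ ger0_norm ?invr_ge0// ler_pdivrMl//.
    have h1 : `|Rz (a + r) b y| <= M * `|y| by apply: R_bound; lra.
    have h2 : `|Rz (a - r) b y| <= M * `|y| by apply: R_bound; lra.
    have h3 : `|Rz a (b + r) y| <= M * `|y| by apply: R_bound; lra.
    have h4 : `|Rz a (b - r) y| <= M * `|y| by apply: R_bound; lra.
    have -> : 4 * (M * `|y|) = M * `|y| + M * `|y| + M * `|y| + M * `|y| by ring.
    apply: le_trans (ler_normD _ _) _; apply: lerD => //.
    apply: le_trans (ler_normD _ _) _; apply: lerD => //.
    by apply: le_trans (ler_normD _ _) _; apply: lerD.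
  have h1 := hL _ _ (R_bound b y a0) mM; rewrite distrC in h1.
  have h2 := mean (Rz (a + r) b y) (Rz (a - r) b y) (Rz a (b + r) y) (Rz a (b - r) y).
  rewrite -/m in h2.
  have := ler_wpM2l L0 h; rewrite [L * (M ^+ 4 * `|y| * r ^+ 3)]mulrA.
  lra.
- move=> e e0; have [rho r0 far] := decay e e0; exists rho => a b a0 h.
  have := far a b a0 h; have := hL (Rz a b y) 0 (R_bound _ _ a0).
  rewrite normr0 subr0 => /(_ My); lra.
Qed.

End HullPrinciple.

(** * Sectorial operators of angle less than pi/2 *)

Section ComplexNorm.
Context {R : realType} {X : normedModType R}.
Implicit Types w : X * X.

Lemma cnorm_has_sup w :
  has_sup (range (fun t : R => `|cos t *: w.1 + sin t *: w.2|)).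
Proof.
split; first by exists `|cos 0 *: w.1 + sin 0 *: w.2|, 0.
exists (`|w.1| + `|w.2|) => _ [t _ <-]; apply: le_trans (ler_normD _ _) _.
by rewrite !normrZ lerD// ler_piMl// ?cos_max ?sin_max.
Qed.

Lemma cnorm_le w : cnorm w <= `|w.1| + `|w.2|.
Proof.
apply: ge_sup; first by have [] := cnorm_has_sup w.
move=> _ [t _ <-]; apply: le_trans (ler_normD _ _) _.
by rewrite !normrZ lerD// ler_piMl// ?cos_max ?sin_max.
Qed.

Lemma norm_fst_le_cnorm w : `|w.1| <= cnorm w.
Proof.
apply: sup_upper_bound; first exact: cnorm_has_sup.
by exists 0 => //; rewrite cos0 sin0 scale1r scale0r addr0.
Qed.

Lemma norm_snd_le_cnorm w : `|w.2| <= cnorm w.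
Proof.
apply: sup_upper_bound; first exact: cnorm_has_sup.
by exists (pi / 2) => //; rewrite cos_pihalf sin_pihalf scale1r scale0r add0r.
Qed.

Lemma norm_le_cnorm w : `|w| <= cnorm w.
Proof. by rewrite prod_normE ge_max norm_fst_le_cnorm norm_snd_le_cnorm. Qed.

Lemma cnorm_le2 w : cnorm w <= 2 * `|w|.
Proof.
apply: le_trans (cnorm_le w) _; rewrite mulr_natl mulr2n prod_normE.
by rewrite lerD// le_max lexx ?orbT.
Qed.

Lemma cnorm_ge0 w : 0 <= cnorm w.
Proof. exact: le_trans (norm_le_cnorm w). Qed.

Lemma operator_norm_le (T : X * X -> X * X) (C : R) :
  (forall w, cnorm (T w) <= C * cnorm w) -> forall w, `|T w| <= 2 * `|C| * `|w|.
Proof.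
move=> TC w; apply: le_trans (norm_le_cnorm _) _; apply: le_trans (TC w) _.
apply: (@le_trans _ _ (`|C| * cnorm w)); first by rewrite ler_wpM2r ?cnorm_ge0// ler_norm.
by rewrite [2 * _]mulrC -mulrA ler_wpM2l// cnorm_le2.
Qed.

End ComplexNorm.

Section Argument.
Context {R : realType}.
Implicit Types (a b s : R) (z : R[i]).

Let modulus z : R := Num.sqrt (complex.Re z ^+ 2 + complex.Im z ^+ 2).

Lemma normc_ge_Im z : (`|complex.Im z|%:C)%C <= `|z|.
Proof.
rewrite normc_def lecR -sqrtr_sqr ler_sqrt ?lerDr ?sqr_ge0//.
by rewrite addr_ge0 ?sqr_ge0.
Qed.

Lemma modulus_gt0 z : z != 0 -> 0 < modulus z.
Proof.
move=> z0; rewrite sqrtr_gt0 lt0r addr_ge0 ?sqr_ge0// andbT.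
rewrite paddr_eq0 ?sqr_ge0// !sqrf_eq0; apply: contra z0.
by case: z => x y /= /andP[/eqP -> /eqP ->].
Qed.

Lemma abs_carg z : z != 0 -> 
  -1 <= complex.Re z / modulus z <= 1 /\ `|carg z| = acos (complex.Re z / modulus z).
Proof.
move=> z0; have m0 := modulus_gt0 z0.
have h : -1 <= complex.Re z / modulus z <= 1.
  rewrite -ler_norml normrM normfV (gtr0_norm m0) ler_pdivrMr// mul1r.
  rewrite -sqrtr_sqr /modulus ler_sqrt ?lerDl ?sqr_ge0//.
  by rewrite addr_ge0 ?sqr_ge0.
split => //; rewrite /carg normc_def /= -/(modulus z).
by case: ifP => _; rewrite ?normrN ger0_norm// acos_ge0.
Qed.

Lemma abs_carg_ge z : z != 0 -> complex.Re z <= 0 -> pi / 2 <= `|carg z|.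
Proof.
move=> z0 re; have [h ->] := abs_carg z0; have m0 := modulus_gt0 z0.
set x := _ / _ in h *; have [/andP[a0 api] e] := acos_def h.
rewrite leNgt; apply/negP => H.
have : 0 < cos (acos x) by apply: cos_gt0_pihalf; rewrite H andbT (lt_le_trans _ a0)// oppr_lt0 divr_gt0// pi_gt0.
by rewrite e ltNge /x ler_pdivrMr// mul0r re.
Qed.

Lemma abs_carg_gt z : z != 0 -> pi / 2 < `|carg z| -> complex.Re z < 0.
Proof.
move=> z0; have [h ->] := abs_carg z0; have m0 := modulus_gt0 z0.
set x := _ / _ in h *; have [/andP[a0 api] e] := acos_def h => H.
have p0 : 0 <= pi / 2 :> R by rewrite divr_ge0// pi_ge0.
have p1 : pi / 2 <= pi :> R by have := pi_ge0 R; lra.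
have : cos (acos x) < cos (pi / 2).
  by rewrite ltr_cos// in_itv /= ?a0 ?api ?p0 ?p1.
by rewrite e cos_pihalf /x ltr_pdivrMr// mul0r.
Qed.

Lemma sector_Re s z : 0 < s < pi / 2 -> sector s z ->
  cos s * `|complex.Im z| <= complex.Re z /\ 0 < complex.Re z.
Proof.
move=> /andP[s0 s2] [z0]; have [h ->] := abs_carg z0; have m0 := modulus_gt0 z0.
set x := _ / _ in h *; have [/andP[a0 api] e] := acos_def h => H.
have spi : s <= pi by have := pi_ge0 R; lra.
have : cos s < cos (acos x) by rewrite ltr_cos// in_itv /= ?a0 ?api ?(ltW s0) ?spi.
have c0 : 0 < cos s by apply: cos_gt0_pihalf; rewrite s2 andbT (lt_trans _ s0)// oppr_lt0 (lt_trans s0).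
rewrite e /x ltr_pdivlMr// => re; split; last by apply: lt_trans re; exact: mulr_gt0.
apply: le_trans (ltW re); rewrite ler_wpM2l ?(ltW c0)//.
rewrite -sqrtr_sqr /modulus ler_sqrt ?lerDr ?sqr_ge0//.
by rewrite addr_ge0 ?sqr_ge0.
Qed.

(** The sector lies in the cone Re z >= cos s * |Im z|, from which - a - i b has
    a positive distance. *)
Lemma notin_closure_sector s a b : 0 < s < pi / 2 -> 0 <= a -> (a != 0) || (b != 0) ->
  ~ closure (sector s) (Complex (- a) (- b) : (R[i] : numFieldType)).
Proof.
move=> hs a0 ab cl.
have c0 : 0 < cos s.
  move: hs => /andP[s0 s2].
  by apply: cos_gt0_pihalf; rewrite s2 andbT (lt_trans _ s0)// oppr_lt0 (lt_trans s0).
have near_sector (e : R) : 0 < e -> exists v, [/\ sector s v, complex.Re v < e - a & `|b| - e < `|complex.Im v|].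
  move=> e0.
  have e0' : 0 < (e%:C)%C :> R[i] by rewrite ltcR.
  have [v [sv]] := cl _ (nbhsx_ballx (Complex (- a) (- b) : (R[i] : numFieldType)) _ e0').
  rewrite -ball_normE /= => bv; exists v; split => //.
    have := le_lt_trans (normc_ge_Re _) bv; rewrite ltcR; case: v {bv sv} => x y /=.
    by rewrite ltr_norml => /andP[h1 h2]; lra.
  have := le_lt_trans (normc_ge_Im _) bv; rewrite ltcR; case: v {bv sv} => x y /=.
  have := ler_normB (- (- b - y)) y.
  rewrite (_ : - (- b - y) - y = b); last by ring.
  by rewrite normrN => h1 h2; lra.
have [a00|az] := eqVneq a 0; last first.
  have a1 : 0 < a by rewrite lt0r az.
  have [v [/(sector_Re hs)[_ h1] h2 _]] := near_sector a a1.
  by move: h2; rewrite subrr; lra.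
have b0 : 0 < `|b| by rewrite normr_gt0; move: ab; rewrite a00 eqxx.
have e0 : 0 < cos s * `|b| / 2 by rewrite divr_gt0// mulr_gt0.
have [v [/(sector_Re hs)[h1 _] h2 h3]] := near_sector _ e0.
have c1 := cos_le1 s.
have : cos s * (`|b| - cos s * `|b| / 2) <= cos s * `|complex.Im v| by rewrite ler_wpM2l ?ltW.
move: h1 h2 h3 b0 c0 c1 e0; rewrite a00.
move: (complex.Re v) `|complex.Im v| `|b| (cos s) => p q m k h1 h2 h3 m0 k0 k1 e0 h4.
have : k * (k * m) <= k * m by rewrite ler_piMl// mulr_ge0 ?ltW.
nra.
Qed.

End Argument.

Section HalfPlaneResolvent.
Context {R : realType} {X : normedModType R}.
Variable A : linop X.

Lemma cscale_cmul (a b : R) (w : X * X) : Defs.cscale (Complex a b) w = cmul a b w.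
Proof. by []. Qed.

Lemma resolvent_shift (a b : R) (T : X * X -> X * X) : is_resolvent A (Complex (- a) (- b)) T ->
  (forall w, cdom A (- T w) /\ opshift A a b (- T w) = w) /\
  (forall u, cdom A u -> - T (opshift A a b u) = u).
Proof.
move=> [_ TR TL]; split => [w|u du].
  have [dT] := TR w; rewrite cscale_cmul cmulNl => e; split; first exact: cdom_opp.
  by rewrite /opshift cmulN capp_opp.
have duN : cdom A (- u) by exact: cdom_opp.
have := TL _ duN; rewrite cscale_cmul cmulNl cmulN opprK capp_opp// opprK => ->.
by rewrite opprK.
Qed.

(** An angle less than pi / 2 leaves room for some s' < pi / 2 in the resolvent
    estimate, which therefore covers the closed half plane.  The bound of R(z)
    itself near the origin comes from R(0) and R(z) = R(0) - R(0) z R(z). *)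
Lemma halfplane_resolvent (sigma : R) : sectorial A -> sectoriality_angle A = sigma ->
  sigma < pi / 2 -> resolvent_set A 0 ->
  exists (Rz : R -> R -> X * X -> X * X) (M : R), 0 <= M /\
  [/\ forall a b w, 0 <= a -> cdom A (Rz a b w),
      forall a b w, 0 <= a -> opshift A a b (Rz a b w) = w,
      forall a b u, 0 <= a -> cdom A u -> Rz a b (opshift A a b u) = u,
      forall a b w, 0 <= a -> `|Rz a b w| <= M * `|w| &
      forall a b w, 0 <= a -> `|cmul a b (Rz a b w)| <= M * `|w|].
Proof.
move=> secA angle sig h0.
have [s [/andP[s0 spi] _ spec unif] s2] : exists2 s, sectorial_of_type A s & s < pi / 2.
  by apply: inf_lt; [|move: sig; rewrite -angle].
have exT (p : R * R) : exists T, 0 <= p.1 -> is_resolvent A (Complex (- p.1) (- p.2)) T.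
  have [p0|p0] := leP 0 p.1; last by exists id.
  have [/andP[/eqP p1 /eqP p2]|np] := boolP ((p.1 == 0) && (p.2 == 0)).
    by have [T hT] := h0; exists T => _; rewrite p1 p2 oppr0.
  have : resolvent_set A (Complex (- p.1) (- p.2)).
    apply: contrapT => H; have := spec _ H; apply: notin_closure_sector => //.
      by rewrite s0 s2.
    by rewrite -negb_and.
  by move=> [T hT]; exists T.
have [T hT] := choice exT.
pose Rz (a b : R) w := - T (a, b) w.
have RT (a b : R) : 0 <= a -> is_resolvent A (Complex (- a) (- b)) (T (a, b)).
  by move=> a0; exact: (hT (a, b)).
have Rdom (a b : R) w : 0 <= a -> cdom A (Rz a b w).
  by move=> a0; have [H _] := resolvent_shift (RT a b a0); have [] := H w.
have shiftR (a b : R) w : 0 <= a -> opshift A a b (Rz a b w) = w.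
  by move=> a0; have [H _] := resolvent_shift (RT a b a0); have [] := H w.
have Rshift (a b : R) u : 0 <= a -> cdom A u -> Rz a b (opshift A a b u) = u.
  by move=> a0; have [_ H] := resolvent_shift (RT a b a0); exact: H.
pose s' := (s + pi / 2) / 2.
have ss' : s < s' by rewrite /s'; lra.
have s'2 : s' < pi / 2 by rewrite /s'; lra.
have [C hC] : uniformly_bounded (sectorial_family A s').
  by apply: unif; rewrite ss' (lt_trans s'2)//; have := pi_gt0 R; lra.
have zR (a b : R) w : 0 <= a -> `|cmul a b (Rz a b w)| <= 2 * `|C| * `|w|.
  move=> a0; have [/andP[/eqP a00 /eqP b00]|np] := boolP ((a == 0) && (b == 0)).
    by rewrite a00 b00 cmul0l normr0 !mulr_ge0.
  have nz : Complex (- a) (- b) != 0.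
    by apply: contra np; rewrite eq_complex /= !oppr_eq0.
  have := @operator_norm_le _ _ (fun w => Defs.cscale (Complex (- a) (- b)) (T (a, b) w)) C.
  rewrite /= => /(_ _ w); rewrite cscale_cmul cmulNl /Rz cmulN; apply.
  apply: hC; exists (Complex (- a) (- b)), (T (a, b)); split => //; last exact: RT.
  by apply: lt_le_trans s'2 _; apply: abs_carg_ge => //=; rewrite oppr_le0.
have [[m hm] _ _] := RT 0 0 (lexx 0).
have R0 w : `|Rz 0 0 w| <= 2 * `|m| * `|w| by rewrite normrN; exact: operator_norm_le.
pose M := 2 * `|C| + 2 * `|m| * (1 + 2 * `|C|).
exists Rz, M; split; first by rewrite /M !addr_ge0// !mulr_ge0// addr_ge0// mulr_ge0.
split => // a b w a0.
- have e := resolvent_identity Rdom shiftR Rshift 0 b w (lexx 0) a0; rewrite !subr0 in e.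
  have -> : Rz a b w = Rz 0 0 w - Rz 0 0 (cmul a b (Rz a b w)) by rewrite -e opprB addrC subrK.
  apply: le_trans (ler_normB _ _) _.
  have h1 := R0 w; have h2 := R0 (cmul a b (Rz a b w)).
  have h3 : 2 * `|m| * `|cmul a b (Rz a b w)| <= 2 * `|m| * (2 * `|C| * `|w|).
    by rewrite ler_wpM2l ?mulr_ge0//; exact: zR.
  have h4 : 0 <= 2 * `|C| * `|w| by rewrite !mulr_ge0.
  apply: le_trans (lerD h1 (le_trans h2 h3)) _.
  rewrite /M -subr_ge0 (_ : _ - _ = 2 * `|C| * `|w|)//; ring.
- apply: le_trans (zR _ _ _ a0) _; rewrite ler_wpM2r// /M lerDl.
  by rewrite !mulr_ge0// addr_ge0// mulr_ge0.
Qed.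

End HalfPlaneResolvent.

(** * Gaussian sums in the complexification *)

(** The integral of a nonnegative function is a supremum over the simple functions
    below it, whence monotonicity without measurability.  The complex norm, a
    supremum over a continuum of angles, is treated in this way. *)
Lemma nonneg_integral_le (d : measure_display) (T : measurableType d) (R : realType)
    (mu : measure T R) (f h : T -> \bar R) :
  (forall x, 0 <= f x)%E -> (forall x, f x <= h x)%E -> (\int[mu]_x f x <= \int[mu]_x h x)%E.
Proof.
move=> f0 fh; have h0 x : (0 <= h x)%E by apply: le_trans (fh x).
rewrite !ge0_integralTE//; apply: le_ereal_sup => _ [k kf <-]; exists k => // x.
exact: le_trans (kf x) (fh x).
Qed.

Section ComplexGauss.
Context {R : realType} {d : measure_display} {Omega : measurableType d}.
Context {P : probability Omega R} {g : nat -> {RV P >-> R}}.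
Hypothesis hg : gaussian_sequence g.
Context {X : normedModType R}.

(** Up to constants, the mean square of a Gaussian sum in the complex norm; unlike
    the latter it is directly a sum of two real mean squares. *)
Definition cgsq (J : finType) (V : J -> X * X) : R :=
  gsq g (fun j => (V j).1) + gsq g (fun j => (V j).2).

Section Fixed.
Variable J : finType.
Implicit Types V W : J -> X * X.

Lemma cgsqD2_le V W : cgsq (fun j => V j + W j) <= 2 * cgsq V + 2 * cgsq W.
Proof.
have h1 := gsqD2_le hg (fun j => (V j).1) (fun j => (W j).1).
have h2 := gsqD2_le hg (fun j => (V j).2) (fun j => (W j).2).
by rewrite /cgsq; move: h1 h2; lra.
Qed.

Lemma cgsqD_le V W (t : R) : 0 < t ->
  cgsq (fun j => V j + W j) <= (1 + t) * cgsq V + (1 + t^-1) * cgsq W.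
Proof.
move=> t0; have h1 := gsqD_le hg (fun j => (V j).1) (fun j => (W j).1) t0.
have h2 := gsqD_le hg (fun j => (V j).2) (fun j => (W j).2) t0.
by rewrite /cgsq !mulrDr addrACA; apply: lerD.
Qed.

Lemma cgsqN V : cgsq (fun j => - V j) = cgsq V.
Proof.
have H (x : J -> X) : gsq g (fun j => - x j) = gsq g x.
  have := gsqZ hg (-1) x; rewrite sqrrN expr1n mul1r => <-; congr gsq.
  by apply/funext => j; rewrite scaleN1r.
by congr (_ + _); rewrite -[RHS]H.
Qed.

Lemma cgsq_midpoint V W :
  cgsq (fun j => 2^-1 *: (V j + W j)) <= 2^-1 * (cgsq V + cgsq W).
Proof.
have t : 0 <= (2^-1 : R) <= 1 by apply/andP; split; lra.
have h1 := gsq_convex hg (fun j => (V j).1) (fun j => (W j).1) t.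
have h2 := gsq_convex hg (fun j => (V j).2) (fun j => (W j).2) t.
have e : 1 - 2^-1 = 2^-1 :> R by field.
rewrite /cgsq mulrDr !mulrDr addrACA; apply: lerD.
  apply: le_trans (le_trans _ h1) _; rewrite e// le_eqVlt; apply/orP; left; apply/eqP.
  by congr gsq; apply/funext => j; rewrite /= scalerDr.
apply: le_trans (le_trans _ h2) _; rewrite e// le_eqVlt; apply/orP; left; apply/eqP.
by congr gsq; apply/funext => j; rewrite /= scalerDr.
Qed.

Lemma cgsq_norm_le : exists K : R, 0 <= K /\
  forall e V, (forall j, `|V j| <= e) -> cgsq V <= K * e ^+ 2.
Proof.
have [K [K0 hK]] := gsq_norm_le hg X J.
exists (K + K); split; first by rewrite addr_ge0.
move=> e V Ve; rewrite mulrDl; apply: lerD; apply: hK => j; apply: le_trans (Ve j);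
  by rewrite prod_normE le_max lexx ?orbT.
Qed.

Definition update V j v k := if k == j then v else V k.

Lemma cgsq_update_lipschitz V j (rho : R) : exists2 L : R, 0 <= L & forall u v,
  `|u| <= rho -> `|v| <= rho -> cgsq (update V j u) - cgsq (update V j v) <= L * `|u - v|.
Proof.
have [K [K0 hK]] := cgsq_norm_le.
pose e := `|rho| + \sum_k `|V k|.
exists (K * e ^+ 2 + K * (2 * `|rho| + 1)).
  by apply: addr_ge0; apply: mulr_ge0; rewrite ?sqr_ge0// addr_ge0// mulr_ge0.
move=> u v ur vr; have [->|uv] := eqVneq u v; first by rewrite !subrr normr0 mulr0.
set dl := `|u - v|; have dl0 : 0 < dl by rewrite normr_gt0 subr_eq0.
pose h k := if k == j then u - v else 0.
have -> : update V j u = (fun k => update V j v k + h k).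
  by apply/funext => k; rewrite /update /h; case: eqP => _; rewrite ?addr0// addrC subrK.
have rr : rho <= `|rho| by exact: ler_norm.
have hv : cgsq (update V j v) <= K * e ^+ 2.
  apply: hK => k; rewrite /update /e; case: eqP => _.
    by apply: le_trans vr _; rewrite (le_trans rr)// lerDl sumr_ge0.
  by rewrite (bigD1 k)//= addrCA lerDl addr_ge0// sumr_ge0.
have hh : cgsq h <= K * dl ^+ 2.
  by apply: hK => k; rewrite /h; case: eqP => _ //; rewrite normr0 ltW.
have dr : dl <= 2 * `|rho|.
  by apply: le_trans (ler_normB _ _) _; rewrite mulr_natl mulr2n lerD// (le_trans _ rr).
have := cgsqD_le (update V j v) h dl0.
have h1 : dl * cgsq (update V j v) <= dl * (K * e ^+ 2) by rewrite ler_wpM2l// ltW.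
have h2 : (1 + dl^-1) * cgsq h <= (1 + dl^-1) * (K * dl ^+ 2).
  by rewrite ler_wpM2l// addr_ge0// invr_ge0 ltW.
have h3 : (1 + dl^-1) * (K * dl ^+ 2) = K * (dl + 1) * dl by field; rewrite gt_eqF.
have h4 : K * (dl + 1) * dl <= K * (2 * `|rho| + 1) * dl.
  by rewrite ler_wpM2r ?(ltW dl0)// ler_wpM2l// lerD2r.
rewrite h3 in h2; move=> h5; move: h1 h2 h4 h5; rewrite mulrDl mul1r [(_ + K * _) * dl]mulrDl.
rewrite [dl * (K * _)]mulrC; lra.
Qed.

Lemma cgsq_update_mean V j u1 u2 u3 u4 :
  cgsq (update V j (4^-1 *: (u1 + u2 + u3 + u4))) <=
  4^-1 * (cgsq (update V j u1) + cgsq (update V j u2) + cgsq (update V j u3) + cgsq (update V j u4)).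
Proof.
have mid u v : cgsq (update V j (2^-1 *: (u + v))) <= 2^-1 * (cgsq (update V j u) + cgsq (update V j v)).
  apply: le_trans (cgsq_midpoint _ _); rewrite le_eqVlt; apply/orP; left; apply/eqP.
  congr cgsq; apply/funext => k; rewrite /update; case: eqP => // _.
  by rewrite -mulr2n -[V k *+ 2]scaler_nat scalerA mulVf ?pnatr_eq0// scale1r.
have -> : 4^-1 *: (u1 + u2 + u3 + u4) = 2^-1 *: (2^-1 *: (u1 + u2) + 2^-1 *: (u3 + u4)).
  by rewrite -scalerDr scalerA addrA; congr (_ *: _); field.
by have := mid (2^-1 *: (u1 + u2)) (2^-1 *: (u3 + u4)); have := mid u1 u2; have := mid u3 u4; lra.
Qed.

End Fixed.

Lemma gsum_ord (V : normedModType R) n (x : 'I_n -> V) w : gsum g x w = \sum_(i < n) (g i w : R) *: x i.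
Proof. by apply: eq_bigr => i _; rewrite enum_rank_ord. Qed.

Lemma fst_sum (I : Type) (r : seq I) (c : I -> R) (V : I -> X * X) :
  (\sum_(i <- r) c i *: V i).1 = \sum_(i <- r) c i *: (V i).1 /\
  (\sum_(i <- r) c i *: V i).2 = \sum_(i <- r) c i *: (V i).2.
Proof.
by elim: r => [|i r [h1 h2]]; rewrite ?big_nil// !big_cons /= h1 h2.
Qed.

Lemma gauss_sq_cnorm n (V : 'I_n -> X * X) :
  ((2^-1 * cgsq V)%:E <= gauss_sq g cnorm V)%E /\ (gauss_sq g cnorm V <= (2 * cgsq V)%:E)%E.
Proof.
have m1 : measurable_fun setT (fun w => (`|gsum g (fun i => (V i).1) w| ^+ 2)%:E).
  exact: measurable_int (integrable_gsum hg _).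
have m2 : measurable_fun setT (fun w => (`|gsum g (fun i => (V i).2) w| ^+ 2)%:E).
  exact: measurable_int (integrable_gsum hg _).
have E (c : R) : 0 <= c -> (\int[P]_w (c * (`|gsum g (fun i => (V i).1) w| ^+ 2 + `|gsum g (fun i => (V i).2) w| ^+ 2))%:E)%E
    = (c * cgsq V)%:E.
  move=> c0; under eq_integral do rewrite EFinM EFinD.
  rewrite ge0_integralZl//; first last.
  - by move=> w _; rewrite adde_ge0// lee_fin sqr_ge0.
  - exact: emeasurable_funD.
  rewrite ge0_integralD//; try by move=> w _; rewrite lee_fin sqr_ge0.
  by rewrite !(gsqE hg).
rewrite /gauss_sq unlock -!E ?invr_ge0//.
have cn w : (\sum_(i < n) (g i w : R) *: V i).1 = gsum g (fun i => (V i).1) w /\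
            (\sum_(i < n) (g i w : R) *: V i).2 = gsum g (fun i => (V i).2) w.
  by rewrite !gsum_ord; have [-> ->] := fst_sum (index_enum 'I_n) (fun i => g i w : R) V.
split; apply: nonneg_integral_le => w; rewrite lee_fin.
- by rewrite mulr_ge0 ?invr_ge0// addr_ge0// sqr_ge0.
- have [<- <-] := cn w; set u := \sum_(i < n) _.
  have h1 := norm_fst_le_cnorm u; have h2 := norm_snd_le_cnorm u.
  have := cnorm_ge0 u; have := normr_ge0 u.1; have := normr_ge0 u.2.
  by move: (cnorm u) `|u.1| `|u.2| h1 h2 => c p q *; nra.
- exact: sqr_ge0.
- have [<- <-] := cn w; set u := \sum_(i < n) _.
  have := cnorm_le u; have := cnorm_ge0 u; have := normr_ge0 u.1; have := normr_ge0 u.2.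
  by move: (cnorm u) `|u.1| `|u.2| => c p q q0 p0 c0 h; have := sqr_ge0 (p - q); nra.
Qed.

End ComplexGauss.

(** * Gamma-bounds in the half plane *)

Section HalfPlaneGammaBound.
Context {R : realType} {d : measure_display} {Omega : measurableType d}.
Context {P : probability Omega R} {g : nat -> {RV P >-> R}}.
Hypothesis hg : gaussian_sequence g.
Context {X : normedModType R}.
Variables (A : linop X) (S : R -> X -> X) (C : R).
Hypothesis hS : bounded_C0_semigroup S.
Hypothesis hAS : generated_by_opp A S.
Hypothesis hC : forall f, test_function A f ->
  let u := convolution S f in
  [/\ forall t, 0 <= t -> dom A (u t), in_gamma g (A \o u) &
    forall r q, has_gamma_norm g f r -> has_gamma_norm g (A \o u) q -> q <= C * r].
Variables (Rz : R -> R -> X * X -> X * X) (M : R).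
Hypothesis Rdom : forall a b w, 0 <= a -> cdom A (Rz a b w).
Hypothesis shiftR : forall a b w, 0 <= a -> opshift A a b (Rz a b w) = w.
Hypothesis Rshift : forall a b u, 0 <= a -> cdom A u -> Rz a b (opshift A a b u) = u.
Hypothesis R_bound : forall a b w, 0 <= a -> `|Rz a b w| <= M * `|w|.
Hypothesis zR_bound : forall a b w, 0 <= a -> `|cmul a b (Rz a b w)| <= M * `|w|.
Hypothesis M0 : 0 <= M.
Variable J : finType.

(** The real and imaginary parts of w = (i xi + A) x are the vectors A x1 - xi x2
    and A x2 + xi x1 of the a priori inequality for the frequency - xi. *)
Lemma imaginary_axis_bound (w : J -> X * X) (xi : J -> R) :
  (forall j, cdom A (w j)) -> (forall j, xi j != 0) ->
  cgsq (g := g) (fun j => Rz 0 (xi j) (capp A (w j))) <= 16 * C ^+ 2 * cgsq (g := g) w.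
Proof.
move=> dw xi0; pose x j := Rz 0 (xi j) (w j).
have dx j : cdom A (x j) by exact: Rdom.
have [dAx Ax] : (forall j, cdom A (capp A (x j))) /\
    (forall j, capp A (x j) = Rz 0 (xi j) (capp A (w j))).
  by split => j; have [] := Rz_capp Rdom shiftR Rshift (xi j) (lexx 0) (dw j).
have xi0' j : - xi j != 0 by rewrite oppr_eq0.
have wE j : w j = opshift A 0 (xi j) (x j) by rewrite shiftR.
have w1 j : (w j).1 = A (x j).1 + (- xi j) *: (x j).2.
  by rewrite wE /= scale0r sub0r addrC scaleNr.
have w2 j : (w j).2 = A (x j).2 - (- xi j) *: (x j).1.
  by rewrite wE /= scale0r addr0 addrC scaleNr opprK.
have := apriori hg hS hAS hC xi0' (fun j => (dx j).1) (fun j => (dx j).2)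
  (fun j => (dAx j).1) (fun j => (dAx j).2).
rewrite -(funext w1) -(funext w2).
have -> : (fun j => Rz 0 (xi j) (capp A (w j))) = (fun j => capp A (x j)).
  by apply/funext => j; rewrite Ax.
exact.
Qed.

(** The indices in s are those which have been allowed to leave the axis.  Moving
    one more of them changes a single vector, in which the mean square is convex. *)
Lemma halfplane_bound (w : J -> X * X) (a b : J -> R) :
  (forall j, cdom A (w j)) -> (forall j, 0 <= a j) ->
  cgsq (g := g) (fun j => Rz (a j) (b j) (capp A (w j))) <= 16 * C ^+ 2 * cgsq (g := g) w.
Proof.
move=> dw a0.
suff H (s : seq J) : forall a b : J -> R, (forall j, 0 <= a j) ->
    (forall j, j \notin s -> a j = 0 /\ b j != 0) ->
    cgsq (g := g) (fun j => Rz (a j) (b j) (capp A (w j))) <= 16 * C ^+ 2 * cgsq (g := g) w.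
  by apply: (H (enum J)) => // j; rewrite mem_enum.
elim: s {a b a0} => [|j s IH] a b a0 ab.
  have -> : (fun j => Rz (a j) (b j) (capp A (w j))) = (fun j => Rz 0 (b j) (capp A (w j))).
    by apply/funext => j; have [-> _] := ab j isT.
  by apply: imaginary_axis_bound => // j; have [] := ab j isT.
pose V k := Rz (a k) (b k) (capp A (w k)).
have VE p q : update V j (Rz p q (capp A (w j))) =
    (fun k => Rz (if k == j then p else a k) (if k == j then q else b k) (capp A (w k))).
  by apply/funext => k; rewrite /update /V; case: eqP => [->|].
have VV : V = update V j (Rz (a j) (b j) (capp A (w j))).
  by apply/funext => k; rewrite /update; case: eqP => [->|].
rewrite -[X in cgsq X <= _]/V VV.
apply: (hull_principle Rdom shiftR Rshift R_bound zR_bound M0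
  (phi := fun v => cgsq (g := g) (update V j v))) => //.
- by move=> u1 u2 u3 u4; exact: cgsq_update_mean.
- by move=> rho; exact: cgsq_update_lipschitz.
- move=> q q0; rewrite VE; apply: IH => k; first by case: eqP.
  by case: eqP => [->|/eqP kj] // ks; apply: ab; rewrite inE negb_or kj.
Qed.

Hypothesis dense_dom : dense (dom A).

Lemma approx_cdom (v : X * X) (e : R) : 0 < e -> exists2 w, cdom A w & `|v - w| < e.
Proof.
move=> e0; have H (x : X) : exists2 y, dom A y & `|x - y| < e.
  have [|y []] := dense_dom _ (ball_open x e); first by exists x; exact: ballxx.
  by rewrite -ball_normE => xy dy; exists y.
have [y1 d1 n1] := H v.1; have [y2 d2 n2] := H v.2.
by exists (y1, y2) => //; rewrite prod_normE gt_max /= n1 n2.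
Qed.

(** A R(z), in a form which makes sense on all vectors. *)
Let K (a b : R) v := v - cmul a b (Rz a b v).

Lemma K_bound a b v : 0 <= a -> `|K a b v| <= (1 + M) * `|v|.
Proof.
move=> a0; rewrite mulrDl mul1r; apply: le_trans (ler_normB _ _) _.
by rewrite lerD2l; exact: zR_bound.
Qed.

Lemma K_capp a b v : 0 <= a -> cdom A v -> K a b v = Rz a b (capp A v).
Proof.
move=> a0 dv; have [_ <-] := Rz_capp Rdom shiftR Rshift b a0 dv.
by rewrite /K -{1}(shiftR b v a0) /opshift addrAC subrr add0r.
Qed.

Lemma K_sub a b u v : 0 <= a -> K a b (u - v) = K a b u - K a b v.
Proof.
move=> a0; rewrite /K (Rz_add Rdom shiftR Rshift)// (Rz_opp Rdom shiftR Rshift)// cmulB.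
by rewrite !opprB addrACA [RHS]addrACA; congr (_ + _); exact: addrC.
Qed.

(** Each v j is approximated in the domain, where K coincides with R(z) A. *)
Lemma K_gamma_bound (v : J -> X * X) (a b : J -> R) : (forall j, 0 <= a j) ->
  cgsq (g := g) (fun j => K (a j) (b j) (v j)) <= 64 * C ^+ 2 * cgsq (g := g) v.
Proof.
move=> a0; have [N [N0 hN]] := cgsq_norm_le hg (X := X) J.
apply/ler_addgt0Pr => e e0.
pose c := 2 * N * (1 + M) ^+ 2 + 64 * C ^+ 2 * N + 1.
have c0 : 0 < c.
  have p1 : 0 <= 2 * N * (1 + M) ^+ 2 by apply: mulr_ge0; [exact: mulr_ge0|exact: sqr_ge0].
  have p2 : 0 <= 64 * C ^+ 2 * N by apply: mulr_ge0 => //; apply: mulr_ge0 => //; exact: sqr_ge0.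
  by rewrite ltr_wpDl// addr_ge0.
(* The precision t makes the total error c t^2 at most e. *)
pose t := Num.min 1 (e / c).
have t0 : 0 < t by rewrite lt_min ltr01 divr_gt0.
have te : c * t ^+ 2 <= e.
  apply: (@le_trans _ _ (c * t)).
    by rewrite ler_wpM2l ?(ltW c0)// expr2 ler_piMl ?(ltW t0)// ge_min lexx.
  by rewrite mulrC -ler_pdivlMr// ge_min lexx orbT.
have [w hw] := choice (fun j => let: ex_intro2 w dw nw := approx_cdom (v j) t0 in
  ex_intro (fun w => cdom A w /\ `|v j - w| < t) w (conj dw nw)).
have hK : cgsq (g := g) (fun j => K (a j) (b j) (w j)) <= 16 * C ^+ 2 * cgsq (g := g) w.
  rewrite (_ : (fun j => _) = (fun j => Rz (a j) (b j) (capp A (w j)))).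
    by apply: halfplane_bound => // j; case: (hw j).
  by apply/funext => j; rewrite K_capp//; case: (hw j).
have h1 : cgsq (g := g) (fun j => K (a j) (b j) (v j)) <=
    2 * cgsq (g := g) (fun j => K (a j) (b j) (w j)) +
    2 * cgsq (g := g) (fun j => K (a j) (b j) (v j - w j)).
  apply: le_trans (cgsqD2_le hg _ _); rewrite le_eqVlt; apply/orP; left; apply/eqP.
  by congr cgsq; apply/funext => j; rewrite K_sub// addrC subrK.
have h2 : cgsq (g := g) (fun j => K (a j) (b j) (v j - w j)) <= N * ((1 + M) * t) ^+ 2.
  apply: hN => j; apply: le_trans (K_bound _ _ (a0 j)) _; rewrite ler_wpM2l ?addr_ge0//.
  by case: (hw j) => _ /ltW.
have h3 : cgsq (g := g) w <= 2 * cgsq (g := g) v + 2 * cgsq (g := g) (fun j => w j - v j).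
  apply: le_trans (cgsqD2_le hg _ _); rewrite le_eqVlt; apply/orP; left; apply/eqP.
  by congr cgsq; apply/funext => j; rewrite addrC subrK.
have h4 : cgsq (g := g) (fun j => w j - v j) <= N * t ^+ 2.
  by apply: hN => j; rewrite distrC; case: (hw j) => _ /ltW.
have C2 := sqr_ge0 C.
have h5 : 16 * C ^+ 2 * cgsq (g := g) w <= 16 * C ^+ 2 * (2 * cgsq (g := g) v + 2 * (N * t ^+ 2)).
  by apply: ler_wpM2l; [exact: mulr_ge0|lra].
have h6 : 0 <= t ^+ 2 by exact: sqr_ge0.
move: hK h1 h2 h5 te; rewrite /c exprMn.
move: (cgsq _) (cgsq _) (cgsq _) (cgsq _) (t ^+ 2) (C ^+ 2) h6 C2 ((1 + M) ^+ 2) => p q r s; clear.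
move=> tt cc t0 c0 m *; lra.
Qed.

Lemma zR_gamma_bound (v : J -> X * X) (a b : J -> R) : (forall j, 0 <= a j) ->
  cgsq (g := g) (fun j => cmul (a j) (b j) (Rz (a j) (b j) (v j))) <=
    (2 + 128 * C ^+ 2) * cgsq (g := g) v.
Proof.
move=> a0; have h := K_gamma_bound v b a0.
have -> : (fun j => cmul (a j) (b j) (Rz (a j) (b j) (v j))) = (fun j => v j + - K (a j) (b j) (v j)).
  by apply/funext => j; rewrite /K opprB addrC subrK.
apply: le_trans (cgsqD2_le hg _ _) _; rewrite (cgsqN hg); move: h; lra.
Qed.

End HalfPlaneGammaBound.

(** * The theorem *)

Lemma sectorial_of_type_mono (R : realType) (X : normedModType R) (A : linop X) (s t : R) :
  s <= t -> t < pi -> sectorial_of_type A s -> sectorial_of_type A t.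
Proof.
move=> st tpi [/andP[s0 _] opA spec unif]; split => //.
- by rewrite (lt_le_trans s0 st).
- have sub : sector s `<=` sector t by move=> z [z0 zs]; split => //; exact: lt_le_trans st.
  exact: subset_trans spec (@closureS _ _ _ sub).
- by move=> s' /andP[ts' s'pi]; apply: unif; rewrite (le_lt_trans st ts').
Qed.

Theorem theorem3p6 (R : realType)
    (d : measure_display) (Omega : measurableType d) (P : probability Omega R)
    (g : nat -> {RV P >-> R}) (hg : gaussian_sequence g)
    (X : completeNormedModType R) (A : linop X) (sigma : R)
    (hsigma : 0 < sigma < pi / 2)
    (hA : sectorial A) (hangle : sectoriality_angle A = sigma)
    (hreg : maximal_gamma_regularity g A)
    (h0 : resolvent_set A 0) :
  gamma_sectorial g A.
Proof.
have [_ sig2] := andP hsigma.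
have [Rz [M [M0 [Rdom shiftR Rshift R_bound zR_bound]]]] := halfplane_resolvent hA hangle sig2 h0.
have [S [hS hAS [C hC]]] := hreg.
have [s typeA s2] : exists2 s, sectorial_of_type A s & s < pi / 2.
  by apply: inf_lt; [|move: sig2; rewrite -hangle].
have [_ [_ denseA _ _] _ _] := typeA.
have pi2 : pi / 2 < pi :> R by have := pi_gt0 R; lra.
exists (pi / 2); split; first exact: sectorial_of_type_mono (ltW s2) pi2 typeA.
move=> s' /andP[s'2 _].
have C0 : 0 <= 8 + 512 * C ^+ 2.
  by apply: addr_ge0; [exact: ler0n|apply: mulr_ge0; [exact: ler0n|exact: sqr_ge0]].
exists (Num.sqrt (8 + 512 * C ^+ 2)); split; first exact: sqrtr_ge0.
move=> n T x FT; rewrite sqr_sqrtr//.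
have hT i : exists ab : R * R, 0 <= ab.1 /\
    forall w, T i w = cmul ab.1 ab.2 (Rz ab.1 ab.2 w).
  have [z [U [z0 zs [_ UR _] ->]]] := FT i.
  have rez := abs_carg_gt z0 (lt_trans s'2 zs).
  exists (- complex.Re z, - complex.Im z); split => [|w] /=; first by rewrite oppr_ge0 ltW.
  have [dU eU] := UR w.
  have e : opshift A (- complex.Re z) (- complex.Im z) (- U w) = w.
    by rewrite /opshift cmulN cmulNl opprK capp_opp.
  have := Rshift (- complex.Re z) (- complex.Im z) (- U w).
  rewrite e oppr_ge0 => -> //; last exact: cdom_opp; last exact: ltW.
  by rewrite cmulN cmulNl opprK.
have [ab hab] := choice hT.
have h := zR_gamma_bound hg hS hAS hC Rdom shiftR Rshift R_bound zR_bound M0 denseA x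
  (fun i => (ab i).2) (fun i => (hab i).1).
have [_ up] := gauss_sq_cnorm hg (fun i => T i (x i)); have [low _] := gauss_sq_cnorm hg x.
apply: le_trans up _; apply: (@le_trans _ _ ((8 + 512 * C ^+ 2)%:E * (2^-1 * cgsq (g := g) x)%:E)%E).
  rewrite -EFinM lee_fin (_ : (fun i => T i (x i)) =
    (fun i => cmul (ab i).1 (ab i).2 (Rz (ab i).1 (ab i).2 (x i)))); last first.
    by apply/funext => i; have [_ ->] := hab i.
  move: h; lra.
by apply: lee_wpmul2l => //; rewrite lee_fin.
Qed.
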